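(* Assume $\Bbbk$ is algebraically closed (of characteristic zero) and let $n\ge2$. Let $M$ be an infinite-dimensional simple completely pointed $\mathfrak{sp}_{2n}$-module and let $J=\operatorname{Ann}_{U(\mathfrak{sp}_{2n})}M$. Then $J=\ker\psi$, where $\psi:U(\mathfrak{sp}_{2n})\to\mathcal{A}(\widetilde{C_n})$ is the surjective homomorphism given by $$\psi(e_i)=X_i,\ \psi(f_i)=Y_i,\ \psi(h_i)=u_i-u_{i+1}\ (1\le i\le n-1),\quad \psi(e_n)=\tfrac{\sqrt{-1}}{2}X_n,\ \psi(f_n)=\tfrac{\sqrt{-1}}{2}Y_n,\ \psi(h_n)=u_n-\tfrac12,$$ and hence the primitive quotient $U(\mathfrak{sp}_{2n})/J$ is isomorphic to $\mathcal{A}(\widetilde{C_n})$ as $\mathbb{Z}V$-graded $R_E$-rings with involution.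
   Context: Rings are associative and unital. A weight module $M=\bigoplus_{\mu\in\mathfrak{h}^*}M_\mu$ over a semisimple Lie algebra with Cartan subalgebra $\mathfrak{h}$ is completely pointed if $\dim_\Bbbk M_\mu\le1$ for all $\mu$. TGW algebras. Given a $\Bbbk$-algebra $R$, commuting $\Bbbk$-algebra automorphisms $\sigma=(\sigma_i)_{i\in I}$ of $R$ and nonzero central elements $t=(t_i)_{i\in I}$, the TGW construction (with all $\mu_{ij}=1$) is the free $R$-ring on symbols $X_i,Y_i$ ($i\in I$) modulo $X_ir=\sigma_i(r)X_i$, $Y_ir=\sigma_i^{-1}(r)Y_i$, $Y_iX_i=t_i$, $X_iY_i=\sigma_i(t_i)$, and $X_iY_j=Y_jX_i$ for $i\neq j$; it is graded by the free abelian group $\mathbb{Z}I$ with $\deg X_i=i$, $\deg Y_i=-i$, $\deg R=0$. The TGW algebra $\mathcal{A}(R,\sigma,t)$ is its quotient by the sum of all graded ideals having zero intersection with the degree-zero component. For commutative $R$ it is an $R$-ring with involution ($R$-linear anti-automorphism of order two fixing the image of $R$ pointwise) via $X_i^*=Y_i$, $Y_i^*=X_i$, $r^*=r$. A map of $R$-rings with involution is a ring homomorphism compatible with the maps from $R$ and with the involutions. The algebra $\mathcal{A}(\widetilde{C_n})$. $\widetilde{C_n}$ is the multiquiver with vertex set $V=\{1,\dots,n\}$ and edge set $E=\{1,\dots,n\}$: edge $1$ has target $1$ and no source, edge $i$ ($2\le i\le n$) goes from $i-1$ to $i$, all multiplicities being $1$ except that edge $n$ has incoming multiplicity $2$ at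 vertex $n$; its incidence matrix (rows $E$, columns $V$) is $\gamma_{ii}=1$ ($i<n$), $\gamma_{nn}=2$, $\gamma_{i+1,i}=-1$, zero otherwise. $\mathcal{A}(\widetilde{C_n})=\mathcal{A}(R_E,\sigma,t)$ with index set $V$, $R_E=\Bbbk[u_1,\dots,u_n]$, $\sigma_v(u_e)=u_e-\gamma_{ev}$, $t_i=u_i(u_{i+1}-1)$ for $i<n$, $t_n=u_n(u_n+1)$. $V$ is identified with the set of simple roots of $\mathfrak{sp}_{2n}$ ($n$ being the long simple root), so $\mathbb{Z}V$ is the root lattice, grading $U(\mathfrak{sp}_{2n})$; $e_i,f_i,h_i$ are Chevalley generators. $U(\mathfrak{sp}_{2n})$ is an $R_E$-ring via $u_i-u_{i+1}\mapsto h_i$ ($i<n$), $u_n-\frac12\mapsto h_n$, and has the $\Bbbk$-linear involution with $e_i^*=f_i$, $f_i^*=e_i$, $h_i^*=h_i$. *)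

(* Defs.v *)
From HB Require Import structures.
From mathcomp Require Import all_boot all_order all_algebra.
From mathcomp Require Import generic_quotient boolp.
From mathcomp Require finmap.
From mathcomp.multinomials Require xfinmap monalg mpoly.

Set Implicit Arguments.
Unset Strict Implicit.
Unset Printing Implicit Defensive.

Import GRing.Theory.
Local Open Scope ring_scope.
Local Open Scope quotient_scope.

Section TwoSidedIdeals.
Variable A : pzRingType.

Record two_sided (I : A -> Prop) : Prop := TwoSided {
  two_sided0 : I 0;
  two_sidedD : forall x y, I x -> I y -> I (x + y);
  two_sidedMl : forall a x, I x -> I (a * x);
  two_sidedMr : forall a x, I x -> I (x * a)
}.

Record ideal := Ideal { ideal_set :> A -> Prop; _ : two_sided ideal_set }.

Lemma idealP (I : ideal) : two_sided I. Proof. by case: I. Qed.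

Lemma two_sidedN I x : two_sided I -> I x -> I (- x).
Proof. by move=> tI Ix; rewrite -mulN1r; apply: two_sidedMl. Qed.

Lemma two_sided_sum I (s : seq A) : two_sided I ->
  (forall x, x \in s -> I x) -> I (\sum_(x <- s) x).
Proof.
move=> tI; elim: s => [|x s IHs] Is; first by rewrite big_nil; apply: two_sided0.
rewrite big_cons; apply: (two_sidedD tI); first by apply: Is; rewrite inE eqxx.
by apply: IHs => y ys; apply: Is; rewrite inE ys orbT.
Qed.

Definition gen_ideal_set (P : A -> Prop) (x : A) : Prop :=
  forall I : A -> Prop, two_sided I -> (forall p, P p -> I p) -> I x.

Lemma gen_ideal_two_sided P : two_sided (gen_ideal_set P).
Proof.
split=> [I tI _ |x y Px Py I tI PI|a x Px I tI PI|a x Px I tI PI].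
- exact: two_sided0.
- by apply: (two_sidedD tI); [apply: Px | apply: Py].
- by apply: (two_sidedMl tI); apply: Px.
- by apply: (two_sidedMr tI); apply: Px.
Qed.

Definition gen_ideal (P : A -> Prop) : ideal := Ideal (gen_ideal_two_sided P).

Lemma gen_idealW (P : A -> Prop) p : P p -> gen_ideal P p.
Proof. by move=> Pp I tI; apply. Qed.

End TwoSidedIdeals.

Module QuotientRing.
Section QuotientRing.
Variables (A : pzRingType) (I : ideal A).

Definition quot_rel (x y : A) : bool := `[< I (x - y) >].

Fact quot_rel_equiv : equiv_class_of quot_rel.
Proof.
have tI := idealP I; split=> [x|x y|y x z].
- by apply/asboolP; rewrite subrr; apply: two_sided0.
- by apply/asboolP/asboolP => /(two_sidedN tI); rewrite opprB.
- move=> /asboolP xy /asboolP yz; apply/asboolP.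
  by have := two_sidedD tI xy yz; rewrite addrA subrK.
Qed.

Canonical quot_equiv := EquivRelPack quot_rel_equiv.

Definition quot := {eq_quot quot_rel}.
HB.instance Definition _ := Choice.on quot.
HB.instance Definition _ := EqQuotient.on quot.

(* The quotient may be the zero ring, hence pzRingType rather than algType; the
   scalars of k are carried by explicit structure maps (Uscal, tgw_scal).
   Everything below is locked so that unification never unfolds it. *)
Fact quot_key : unit. Proof. exact: tt. Qed.
Definition quot_pi : A -> quot := locked_with quot_key (fun x => \pi_quot x).
Definition quot_repr : quot -> A := locked_with quot_key (fun x => repr x).

Lemma quot_reprK x : quot_pi (quot_repr x) = x.
Proof. by rewrite [quot_pi]locked_withE [quot_repr]locked_withE reprK. Qed.

Lemma quot_piP x y : quot_pi x = quot_pi y <-> I (x - y).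
Proof.
rewrite [quot_pi]locked_withE.
by split=> [/eqmodP/asboolP|H] //; apply/eqmodP/asboolP.
Qed.

Lemma quot_repr_pi x : I (quot_repr (quot_pi x) - x).
Proof. by apply/quot_piP; rewrite quot_reprK. Qed.

Definition quot_zero : quot := locked_with quot_key (quot_pi 0).
Definition quot_one : quot := locked_with quot_key (quot_pi 1).
Definition quot_opp : quot -> quot :=
  locked_with quot_key (fun x => quot_pi (- quot_repr x)).
Definition quot_add : quot -> quot -> quot :=
  locked_with quot_key (fun x y => quot_pi (quot_repr x + quot_repr y)).
Definition quot_mul : quot -> quot -> quot :=
  locked_with quot_key (fun x y => quot_pi (quot_repr x * quot_repr y)).

Let tI := idealP I.

Let pi0 : quot_zero = quot_pi 0. Proof. exact: locked_withE. Qed.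
Let pi1 : quot_one = quot_pi 1. Proof. exact: locked_withE. Qed.

Let piN x : quot_opp (quot_pi x) = quot_pi (- x).
Proof.
rewrite [quot_opp]locked_withE; apply/quot_piP.
by rewrite -opprD; apply: two_sidedN => //; apply: quot_repr_pi.
Qed.

Let piD x y : quot_add (quot_pi x) (quot_pi y) = quot_pi (x + y).
Proof.
rewrite [quot_add]locked_withE; apply/quot_piP; rewrite opprD addrACA.
by apply: (two_sidedD tI); apply: quot_repr_pi.
Qed.

Let piM x y : quot_mul (quot_pi x) (quot_pi y) = quot_pi (x * y).
Proof.
rewrite [quot_mul]locked_withE; apply/quot_piP.
set x' := quot_repr _; set y' := quot_repr _.
have -> : x' * y' - x * y = (x' - x) * y' + x * (y' - y).
  by rewrite mulrBl mulrBr addrA subrK.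
by apply: (two_sidedD tI); [apply: (two_sidedMr tI) | apply: (two_sidedMl tI)];
  apply: quot_repr_pi.
Qed.

Lemma quotW (P : quot -> Prop) : (forall a, P (quot_pi a)) -> forall x, P x.
Proof. by move=> Ppi x; rewrite -[x]quot_reprK. Qed.

Fact quot_addA : associative quot_add.
Proof.
by elim/quotW=> x; elim/quotW=> y; elim/quotW=> z; rewrite !piD addrA.
Qed.
Fact quot_addC : commutative quot_add.
Proof. by elim/quotW=> x; elim/quotW=> y; rewrite !piD addrC. Qed.
Fact quot_add0 : left_id quot_zero quot_add.
Proof. by elim/quotW=> x; rewrite pi0 piD add0r. Qed.
Fact quot_addN : left_inverse quot_zero quot_opp quot_add.
Proof. by elim/quotW=> x; rewrite piN piD addNr pi0. Qed.
HB.instance Definition _ :=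
  GRing.isZmodule.Build quot quot_addA quot_addC quot_add0 quot_addN.

Fact quot_mulA : associative quot_mul.
Proof.
by elim/quotW=> x; elim/quotW=> y; elim/quotW=> z; rewrite !piM mulrA.
Qed.
Fact quot_mul1 : left_id quot_one quot_mul.
Proof. by elim/quotW=> x; rewrite pi1 piM mul1r. Qed.
Fact quot_mulr1 : right_id quot_one quot_mul.
Proof. by elim/quotW=> x; rewrite pi1 piM mulr1. Qed.
Fact quot_mulDl : left_distributive quot_mul +%R.
Proof.
elim/quotW=> x; elim/quotW=> y; elim/quotW=> z.
by rewrite [_ + quot_pi _]piD !piM [RHS]piD mulrDl.
Qed.
Fact quot_mulDr : right_distributive quot_mul +%R.
Proof.
elim/quotW=> x; elim/quotW=> y; elim/quotW=> z.
by rewrite [_ + quot_pi _]piD !piM [RHS]piD mulrDr.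
Qed.
HB.instance Definition _ := GRing.Zmodule_isPzRing.Build quot
  quot_mulA quot_mul1 quot_mulr1 quot_mulDl quot_mulDr.

Fact quot_pi_is_additive : zmod_morphism quot_pi.
Proof. by move=> x y; rewrite [- quot_pi y]piN [RHS]piD. Qed.
HB.instance Definition _ := GRing.isZmodMorphism.Build A quot quot_pi
  quot_pi_is_additive.
Fact quot_pi_is_monoid_morphism : monoid_morphism quot_pi.
Proof. by split=> [|x y]; rewrite ?[RHS]piM //; apply: esym; apply: pi1. Qed.
HB.instance Definition _ := GRing.isMonoidMorphism.Build A quot quot_pi
  quot_pi_is_monoid_morphism.

Lemma quot_pi_eq0 x : quot_pi x = 0 <-> I x.
Proof. by rewrite -[0](raddf0 quot_pi) quot_piP subr0. Qed.

End QuotientRing.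
End QuotientRing.
Export QuotientRing.

Module FreeAlgebra.
Section FreeAlgebra.
Import finmap xfinmap monalg.
Variables (k : comNzRingType) (S : choiceType).

Local Notation F := {malg k[{fmonom S}]}.

(* The free associative algebra k<S>: the monoid algebra of the free monoid,
   with locked operations so that unification never unfolds them. *)
Definition freealg : Type := F.
HB.instance Definition _ := Choice.on freealg.

Fact freealg_key : unit. Proof. exact: tt. Qed.
Local Notation lock_ := (locked_with freealg_key).
Definition freealg_zero : freealg := lock_ (0 : F).
Definition freealg_one : freealg := lock_ (1 : F).
Definition freealg_opp : freealg -> freealg := lock_ (fun x : F => - x).
Definition freealg_add : freealg -> freealg -> freealg :=
  lock_ (fun x y : F => x + y).
Definition freealg_mul : freealg -> freealg -> freealg :=
  lock_ (fun x y : F => x * y).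
Definition freealg_scale : k -> freealg -> freealg :=
  lock_ (fun (c : k) (x : F) => c *: x).

Let f0 : freealg_zero = (0 : F). Proof. exact: locked_withE. Qed.
Let f1 : freealg_one = (1 : F). Proof. exact: locked_withE. Qed.
Let fN : freealg_opp = (fun x : F => - x). Proof. exact: locked_withE. Qed.
Let fD : freealg_add = (fun x y : F => x + y). Proof. exact: locked_withE. Qed.
Let fM : freealg_mul = (fun x y : F => x * y). Proof. exact: locked_withE. Qed.
Let fZ : freealg_scale = (fun c (x : F) => c *: x).
Proof. exact: locked_withE. Qed.

Fact freealg_addA : associative freealg_add.
Proof. by rewrite fD; exact: (@addrA F). Qed.
Fact freealg_addC : commutative freealg_add.
Proof. by rewrite fD; exact: (@addrC F). Qed.
Fact freealg_add0 : left_id freealg_zero freealg_add.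
Proof. by rewrite fD f0; exact: (@add0r F). Qed.
Fact freealg_addN : left_inverse freealg_zero freealg_opp freealg_add.
Proof. by rewrite fD f0 fN; exact: (@addNr F). Qed.
HB.instance Definition _ := GRing.isZmodule.Build freealg
  freealg_addA freealg_addC freealg_add0 freealg_addN.

Let FD : (+%R : freealg -> freealg -> freealg) = (+%R : F -> F -> F) := fD.
Let F0 : (0 : freealg) = (0 : F) := f0.

Fact freealg_mulA : associative freealg_mul.
Proof. by rewrite fM; exact: (@mulrA F). Qed.
Fact freealg_mul1 : left_id freealg_one freealg_mul.
Proof. by rewrite fM f1; exact: (@mul1r F). Qed.
Fact freealg_mulr1 : right_id freealg_one freealg_mul.
Proof. by rewrite fM f1; exact: (@mulr1 F). Qed.
Fact freealg_mulDl : left_distributive freealg_mul +%R.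
Proof. by rewrite fM FD; exact: (@mulrDl F). Qed.
Fact freealg_mulDr : right_distributive freealg_mul +%R.
Proof. by rewrite fM FD; exact: (@mulrDr F). Qed.
Fact freealg_1neq0 : freealg_one != 0.
Proof. by rewrite f1 F0; exact: (@oner_neq0 F). Qed.
HB.instance Definition _ := GRing.Zmodule_isNzRing.Build freealg
  freealg_mulA freealg_mul1 freealg_mulr1 freealg_mulDl freealg_mulDr
  freealg_1neq0.

Fact freealg_scaleA a b x :
  freealg_scale a (freealg_scale b x) = freealg_scale (a * b) x.
Proof. by rewrite fZ; exact: (@scalerA k F). Qed.
Fact freealg_scale1 : left_id 1 freealg_scale.
Proof. by rewrite fZ; exact: (@scale1r k F). Qed.
Fact freealg_scaleDr : right_distributive freealg_scale +%R.
Proof. by rewrite fZ FD; exact: (@scalerDr k F). Qed.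
Fact freealg_scaleDl x : {morph freealg_scale^~ x : a b / a + b}.
Proof. by rewrite fZ FD; exact: (@scalerDl k F). Qed.
HB.instance Definition _ := GRing.Zmodule_isLmodule.Build k freealg
  freealg_scaleA freealg_scale1 freealg_scaleDr freealg_scaleDl.

Let FM : ( *%R : freealg -> freealg -> freealg) = ( *%R : F -> F -> F) := fM.
Let FZ : ( *:%R : k -> freealg -> freealg) = ( *:%R : k -> F -> F) := fZ.

Fact freealg_scaleAl (c : k) (p q : freealg) : c *: (p * q) = (c *: p) * q.
Proof. by rewrite FM FZ; exact: (@scalerAl k F). Qed.
HB.instance Definition _ :=
  GRing.Lmodule_isLalgebra.Build k freealg freealg_scaleAl.

Fact freealg_scaleAr (c : k) (p q : freealg) : c *: (p * q) = p * (c *: q).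
Proof.
rewrite FM FZ; apply/malgP=> w; have le r := fsubset_refl (msupp (r : F)).
rewrite mcoeffZ (mcoeffMlw _ (le p) (le q)) (mcoeffMlw _ (le p) (msuppZ_le c q)).
rewrite mulr_sumr; apply: eq_bigr => i _.
rewrite mulr_sumr; apply: eq_bigr => j _.
by rewrite mcoeffZ mulrnAr mulrCA.
Qed.
HB.instance Definition _ :=
  GRing.Lalgebra_isAlgebra.Build k freealg freealg_scaleAr.

Definition fword : seq S -> freealg := lock_ (fun w => << FMonom w >> : F).
Definition fgen (s : S) : freealg := fword [:: s].

(* The linear extension of a function of words. *)
Definition fext (V : lmodType k) (phi : seq S -> V) : freealg -> V :=
  lock_ (fun p : F => \sum_(w <- msupp p) p@_w *: phi (fmonom_val w)).

Let fwordE w : fword w = (<< FMonom w >> : F).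
Proof. by rewrite [fword]locked_withE. Qed.

Let fextEw (V : lmodType k) (phi : seq S -> V) d (p : F) :
  fsubset (msupp p) d ->
  fext phi p = \sum_(w <- d) p@_w *: phi (fmonom_val w).
Proof.
move=> le; rewrite [fext _]locked_withE.
by apply: big_fset_incl => // w _ /mcoeff_outdom ->; rewrite scale0r.
Qed.

Fact fext_is_linear (V : lmodType k) (phi : seq S -> V) : linear (fext phi).
Proof.
move=> c p q; rewrite FD FZ.
pose d := fsetU (msupp p) (msupp q).
have dp : fsubset (msupp p) d by apply: fsubsetUl.
have dq : fsubset (msupp q) d by apply: fsubsetUr.
have dc : fsubset (msupp (c *: (p : F) + (q : F))) d.
  apply: fsubset_trans (msuppD_le _ _) _.
  by apply: fsetSU; apply: msuppZ_le.
rewrite (fextEw _ dp) (fextEw _ dq) (fextEw _ dc) scaler_sumr -big_split /=.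
by apply: eq_bigr => w _; rewrite mcoeffD mcoeffZ scalerDl scalerA.
Qed.
HB.instance Definition _ (V : lmodType k) (phi : seq S -> V) :=
  GRing.isLinear.Build k freealg V *:%R (fext phi) (fext_is_linear phi).

Lemma fext_word (V : lmodType k) (phi : seq S -> V) w :
  fext phi (fword w) = phi w.
Proof.
by rewrite fwordE (fextEw _ msuppU_le) big_seq_fset1 mcoeffUU scale1r.
Qed.

Lemma freealgE (p : freealg) : p = fext fword p.
Proof.
rewrite [RHS](fextEw _ (fsubset_refl (msupp (p : F)))).
rewrite [LHS](@monalgE _ _ (p : F)).
have big_eq (r : seq {fmonom S}) (h : {fmonom S} -> F) :
    \big[@GRing.add F/0]_(w <- r) h w = \big[@GRing.add freealg/0]_(w <- r) h w.
  elim: r => [|w r IHr]; first by rewrite !big_nil F0.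
  by rewrite !big_cons IHr FD.
rewrite big_eq; apply: eq_bigr => -[w] _; rewrite FZ fwordE.
by apply/malgP=> v; rewrite mcoeffZ !mcoeffU; case: eqP; rewrite ?mulr1 ?mulr0.
Qed.

Lemma fword_cat w v : fword (w ++ v) = fword w * fword v.
Proof.
rewrite FM !fwordE; have -> : FMonom (w ++ v) = mmul (FMonom w) (FMonom v).
  by apply/eqP; rewrite -val_eqE /= fmM.
by rewrite [RHS]malgM_def fgmulUU mulr1.
Qed.

Lemma fword_nil : fword [::] = 1.
Proof.
rewrite fwordE [RHS]f1; congr (<< _ >>).
by apply/eqP; rewrite -val_eqE /= fm1.
Qed.

Lemma freealg_ind (P : freealg -> Prop) :
  P 0 -> (forall c w p, P p -> P (c *: fword w + p)) -> forall p, P p.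
Proof.
move=> P0 PS p; rewrite [p]freealgE [fext _]locked_withE.
elim: (enum_fset (msupp (p : F))) => [|w r IHr]; first by rewrite big_nil.
by rewrite big_cons; apply: PS.
Qed.

End FreeAlgebra.
End FreeAlgebra.
Export FreeAlgebra.
Import mpoly.

Section AntiExtension.
Variables (k : comNzRingType) (S : choiceType) (f : S -> S).
Implicit Types (p q : freealg k S).

(* The linear anti-endomorphism of the free algebra that extends f. *)
Definition fanti (p : freealg k S) : freealg k S :=
  fext (fun w => fword k (rev (map f w))) p.
HB.instance Definition _ := GRing.Linear.copy fanti
  (fext (fun w => fword k (rev (map f w)))).

Lemma fanti0 : fanti 0 = 0. Proof. exact: linear0. Qed.
Lemma fantiD p q : fanti (p + q) = fanti p + fanti q.
Proof. exact: linearD. Qed.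
Lemma fantiN p : fanti (- p) = - fanti p. Proof. exact: linearN. Qed.
Lemma fantiB p q : fanti (p - q) = fanti p - fanti q.
Proof. exact: linearB. Qed.
Lemma fantiZ c p : fanti (c *: p) = c *: fanti p.
Proof. exact: linearZ. Qed.

Lemma fanti_word w : fanti (fword k w) = fword k (rev (map f w)).
Proof. exact: fext_word. Qed.

Lemma fanti_gen s : fanti (fgen k s) = fgen k (f s).
Proof. exact: fanti_word. Qed.

Lemma fanti1 : fanti 1 = 1.
Proof. by rewrite -fword_nil fanti_word. Qed.

Lemma fantiM p q : fanti (p * q) = fanti q * fanti p.
Proof.
elim/freealg_ind: p => [|a w p IHp]; first by rewrite mul0r fanti0 mulr0.
rewrite mulrDl !fantiD IHp mulrDr -scalerAl !fantiZ -scalerAr.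
congr (_ *: _ + _) => {IHp p}.
elim/freealg_ind: q => [|b v q IHq]; first by rewrite mulr0 fanti0 mul0r.
rewrite mulrDr !fantiD IHq mulrDl -scalerAr !fantiZ -scalerAl.
by congr (_ *: _ + _); rewrite -fword_cat !fanti_word map_cat rev_cat fword_cat.
Qed.

Lemma fantiK : involutive f -> involutive fanti.
Proof.
move=> fK; elim/freealg_ind => [|a w p IHp]; first by rewrite !fanti0.
rewrite !fantiD !fantiZ IHp !fanti_word.
by rewrite map_rev revK -map_comp map_id_in // => s _; apply: fK.
Qed.

Lemma fanti_gen_ideal (P : freealg k S -> Prop) :
  (forall p, P p -> gen_ideal P (fanti p)) ->
  forall p, gen_ideal P p -> gen_ideal P (fanti p).
Proof.
move=> PP p Ip; apply: (Ip (fun q => gen_ideal P (fanti q))) => //.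
have tP := idealP (gen_ideal P).
split=> [|x y Px Py|a x Px|a x Px]; rewrite ?fanti0 ?fantiD ?fantiM.
- exact: two_sided0.
- exact: (two_sidedD tP).
- exact: (two_sidedMr tP).
- exact: (two_sidedMl tP).
Qed.

End AntiExtension.

Section Gradings.

(* The span of the monomials of total degree d in generators gen of degrees
   deg; scalars act through the structure map c. *)
Definition gcomp (k : Type) (A : pzRingType) (c : k -> A) (S : Type)
    (gen : S -> A) (G : zmodType) (deg : S -> G) (d : G) (x : A) : Prop :=
  exists2 ws : seq (k * seq S),
    all (fun w => \sum_(s <- w.2) deg s == d) ws &
    x = \sum_(w <- ws) c w.1 * \prod_(s <- w.2) gen s.

Definition graded_ideal (A : pzRingType) (G : Type) (H : G -> A -> Prop)
    (I : A -> Prop) : Prop :=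
  two_sided I /\
  forall x, I x -> exists2 s : seq A,
    forall y, y \in s -> I y /\ exists d, H d y & x = \sum_(y <- s) y.

Definition gimage (A B : Type) (f : A -> B) (G : Type) (H : G -> A -> Prop)
    (d : G) (y : B) : Prop :=
  exists2 x, H d x & y = f x.

End Gradings.

Section EnvelopingAlgebra.
Variables (k : comNzRingType) (g : lmodType k) (br : g -> g -> g).

Variant Urel : freealg k g -> Prop :=
| Urel_lin (a : k) (x y : g) :
    Urel (fgen k (a *: x + y) - (a *: fgen k x + fgen k y))
| Urel_br (x y : g) :
    Urel (fgen k x * fgen k y - fgen k y * fgen k x - fgen k (br x y)).

Definition Uenv : Type := quot (gen_ideal Urel).
HB.instance Definition _ := GRing.PzRing.on Uenv.

Definition Upi : freealg k g -> Uenv := @quot_pi _ (gen_ideal Urel).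
HB.instance Definition _ := GRing.RMorphism.on Upi.

Definition Urepr : Uenv -> freealg k g := @quot_repr _ (gen_ideal Urel).

Lemma UreprK u : Upi (Urepr u) = u. Proof. exact: quot_reprK. Qed.

Definition Uscal (c : k) : Uenv := Upi c%:A.
Definition Ugen (x : g) : Uenv := Upi (fgen k x).

Record lie_module (M : lmodType k) := LieModule {
  lact :> g -> M -> M;
  lact_linearl : forall m, linear (lact^~ m);
  lact_linearr : forall x, linear (lact x);
  lact_br : forall x y m, lact (br x y) m = lact x (lact y m) - lact y (lact x m)
}.

Section Action.
Variables (M : lmodType k) (rho : lie_module M).

Definition free_act (p : freealg k g) (m : M) : M := fext (foldr rho m) p.

Lemma free_act0 m : free_act 0 m = 0. Proof. exact: linear0. Qed.
Lemma free_actD p q m : free_act (p + q) m = free_act p m + free_act q m.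
Proof. exact: linearD. Qed.
Lemma free_actB p q m : free_act (p - q) m = free_act p m - free_act q m.
Proof. exact: linearB. Qed.
Lemma free_actZ c p m : free_act (c *: p) m = c *: free_act p m.
Proof. exact: linearZ. Qed.
Lemma free_act_word w m : free_act (fword k w) m = foldr rho m w.
Proof. exact: fext_word. Qed.

Lemma foldr_linear w : linear (fun m => foldr rho m w).
Proof. by move=> c x y; elim: w => //= s w ->; rewrite lact_linearr. Qed.

Lemma free_act_linear p : linear (free_act p).
Proof.
elim/freealg_ind: p => [|a w p IHp] c x y.
  by rewrite !free_act0 scaler0 addr0.
rewrite !free_actD !free_actZ !free_act_word IHp foldr_linear.
by rewrite !scalerDr !scalerA mulrC addrACA.
Qed.

Lemma free_actr0 p : free_act p 0 = 0.
Proof.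
have := free_act_linear p (-1) 0 0.
by rewrite scaleN1r oppr0 addr0 scaleN1r addNr.
Qed.

Lemma free_actM p q m : free_act (p * q) m = free_act p (free_act q m).
Proof.
elim/freealg_ind: p => [|a w p IHp]; first by rewrite mul0r !free_act0.
rewrite mulrDl !free_actD IHp -scalerAl !free_actZ; congr (_ *: _ + _).
rewrite {IHp p} free_act_word; elim/freealg_ind: q => [|b v q IHq].
  by rewrite mulr0 !free_act0 -free_act_word free_actr0.
rewrite mulrDr !free_actD IHq -scalerAr !free_actZ -fword_cat.
by rewrite !free_act_word foldr_cat foldr_linear.
Qed.

(* U acts on M through representatives; [Uact_pi] is well-definedness. *)
Definition Uact (u : Uenv) (m : M) : M := free_act (Urepr u) m.

Lemma Uact_pi p m : Uact (Upi p) m = free_act p m.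
Proof.
apply/eqP; rewrite -subr_eq0 -free_actB; apply/eqP.
have := @quot_repr_pi _ (gen_ideal Urel) p.
move: (_ - p) m => q m Iq; move: m.
apply: (Iq (fun q => forall m, free_act q m = 0)) => [|{Iq} r [a x y|x y] m].
- split=> [m|x y Ix Iy m|a x Ix m|a x Ix m].
  + by rewrite free_act0.
  + by rewrite free_actD Ix Iy addr0.
  + by rewrite free_actM Ix free_actr0.
  + by rewrite free_actM.
- rewrite free_actB free_actD free_actZ !free_act_word /=.
  by rewrite lact_linearl subrr.
- by rewrite !free_actB !free_actM !free_act_word /= lact_br subrr.
Qed.

Definition annihilator_set (u : Uenv) : Prop := forall m, Uact u m = 0.

Lemma UactD u v m : Uact (u + v) m = Uact u m + Uact v m.
Proof.
by rewrite -{1}[u]UreprK -{1}[v]UreprK -rmorphD Uact_pi free_actD.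
Qed.

Lemma UactM u v m : Uact (u * v) m = Uact u (Uact v m).
Proof.
by rewrite -{1}[u]UreprK -{1}[v]UreprK -rmorphM Uact_pi free_actM.
Qed.

Lemma annihilator_two_sided : two_sided annihilator_set.
Proof.
split=> [m|x y Ix Iy m|a x Ix m|a x Ix m].
- by rewrite -[0](rmorph0 Upi) Uact_pi free_act0.
- by rewrite UactD Ix Iy addr0.
- by rewrite UactM Ix /Uact free_actr0.
- by rewrite UactM.
Qed.

Definition annihilator : ideal Uenv := Ideal annihilator_two_sided.

Definition simple_module : Prop :=
  (exists m : M, m <> 0) /\
  forall N : M -> Prop, N 0 -> (forall (c : k) x y, N x -> N y -> N (c *: x + y)) ->
    (forall x m, N m -> N (rho x m)) ->
    (forall m, N m -> m = 0) \/ (forall m, N m).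

End Action.
End EnvelopingAlgebra.

Definition infinite_dimensional (k : pzRingType) (M : lmodType k) : Prop :=
  ~ exists s : seq M, forall m, exists c : seq k,
      m = \sum_(i < size s) c`_i *: s`_i.

Record tgw_datum (k : comNzRingType) (R : algType k) (I : finType) := TGWDatum {
  tgw_sigma : I -> R -> R;
  tgw_sigmaV : I -> R -> R;
  tgw_t : I -> R;
  tgw_sigma_linear : forall i, linear (tgw_sigma i);
  tgw_sigma_morph : forall i, monoid_morphism (tgw_sigma i);
  tgw_sigmaK : forall i, cancel (tgw_sigma i) (tgw_sigmaV i);
  tgw_sigmaVK : forall i, cancel (tgw_sigmaV i) (tgw_sigma i);
  tgw_sigmaC : forall i j r,
    tgw_sigma i (tgw_sigma j r) = tgw_sigma j (tgw_sigma i r);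
  tgw_t_neq0 : forall i, tgw_t i != 0;
  tgw_t_central : forall i r, tgw_t i * r = r * tgw_t i
}.

Section TGW.
Variables (k : comNzRingType) (R : algType k) (I : finType).
Variable D : tgw_datum R I.

Definition tgw_sym : choiceType := (R + (I + I))%type.
Definition sym_R (r : R) : tgw_sym := inl r.
Definition sym_X (i : I) : tgw_sym := inr (inl i).
Definition sym_Y (i : I) : tgw_sym := inr (inr i).

Local Notation "''r' x" := (fgen k (sym_R x)) (at level 10, x at level 9).
Local Notation "''x' i" := (fgen k (sym_X i)) (at level 10, i at level 9).
Local Notation "''y' i" := (fgen k (sym_Y i)) (at level 10, i at level 9).

(* The first three families present the free R-ring on the X_i, Y_i. *)
Variant tgw_rel : freealg k tgw_sym -> Prop :=
| tgw_rel_lin (a : k) (r s : R) :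
    tgw_rel ('r (a *: r + s) - (a *: 'r r + 'r s))
| tgw_rel_one : tgw_rel ('r 1 - 1)
| tgw_rel_mul (r s : R) : tgw_rel ('r (r * s) - 'r r * 'r s)
| tgw_rel_Xr (i : I) (r : R) :
    tgw_rel ('x i * 'r r - 'r (tgw_sigma D i r) * 'x i)
| tgw_rel_Yr (i : I) (r : R) :
    tgw_rel ('y i * 'r r - 'r (tgw_sigmaV D i r) * 'y i)
| tgw_rel_YX (i : I) : tgw_rel ('y i * 'x i - 'r (tgw_t D i))
| tgw_rel_XY (i : I) : tgw_rel ('x i * 'y i - 'r (tgw_sigma D i (tgw_t D i)))
| tgw_rel_XYC (i j : I) : i != j -> tgw_rel ('x i * 'y j - 'y j * 'x i).

Definition tgw_cons : Type := quot (gen_ideal tgw_rel).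
HB.instance Definition _ := GRing.PzRing.on tgw_cons.
Definition tgw_cons_pi : freealg k tgw_sym -> tgw_cons :=
  @quot_pi _ (gen_ideal tgw_rel).
HB.instance Definition _ := GRing.RMorphism.on tgw_cons_pi.
Definition tgw_cons_repr : tgw_cons -> freealg k tgw_sym :=
  @quot_repr _ (gen_ideal tgw_rel).
Lemma tgw_cons_reprK x : tgw_cons_pi (tgw_cons_repr x) = x.
Proof. exact: quot_reprK. Qed.

Definition tgw_deg (s : tgw_sym) : {ffun I -> int} :=
  match s with
  | inl _ => 0
  | inr (inl i) => [ffun j => (j == i)%:R]
  | inr (inr i) => - [ffun j => (j == i)%:R]
  end.

Definition tgw_cons_comp : {ffun I -> int} -> tgw_cons -> Prop :=
  gcomp (fun c : k => tgw_cons_pi c%:A) (fun s => tgw_cons_pi (fgen k s)) tgw_deg.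

Definition tgw_negligible (J : tgw_cons -> Prop) : Prop :=
  graded_ideal tgw_cons_comp J /\ forall x, J x -> tgw_cons_comp 0 x -> x = 0.

Definition tgw_rad_set (x : tgw_cons) : Prop :=
  exists2 s : seq tgw_cons,
    forall y, y \in s -> exists2 J, tgw_negligible J & J y &
    x = \sum_(y <- s) y.

Lemma tgw_rad_two_sided : two_sided tgw_rad_set.
Proof.
split=> [|x y [s sP ->] [t tP ->]|a x [s sP ->]|a x [s sP ->]].
- by exists [::]; rewrite ?big_nil.
- exists (s ++ t); last by rewrite big_cat.
  by move=> z; rewrite mem_cat => /orP[/sP|/tP].
- exists (map (fun y => a * y) s); last by rewrite big_map mulr_sumr.
  move=> z /mapP[y /sP[J negJ Jy] ->]; exists J => //.
  by case: negJ => -[tJ _] _; apply: (two_sidedMl tJ).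
- exists (map (fun y => y * a) s); last by rewrite big_map mulr_suml.
  move=> z /mapP[y /sP[J negJ Jy] ->]; exists J => //.
  by case: negJ => -[tJ _] _; apply: (two_sidedMr tJ).
Qed.

Definition tgw_rad : ideal tgw_cons := Ideal tgw_rad_two_sided.

Definition tgw : Type := quot tgw_rad.
HB.instance Definition _ := GRing.PzRing.on tgw.
Definition tgw_pi : tgw_cons -> tgw := @quot_pi _ tgw_rad.
HB.instance Definition _ := GRing.RMorphism.on tgw_pi.
Definition tgw_repr : tgw -> tgw_cons := @quot_repr _ tgw_rad.
Lemma tgw_reprK x : tgw_pi (tgw_repr x) = x.
Proof. exact: quot_reprK. Qed.

Definition tgw_scal (c : k) : tgw := tgw_pi (tgw_cons_pi c%:A).
Definition tgw_R (r : R) : tgw := tgw_pi (tgw_cons_pi ('r r)).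
Definition tgw_X (i : I) : tgw := tgw_pi (tgw_cons_pi ('x i)).
Definition tgw_Y (i : I) : tgw := tgw_pi (tgw_cons_pi ('y i)).
Definition tgw_comp : {ffun I -> int} -> tgw -> Prop :=
  gimage tgw_pi tgw_cons_comp.

End TGW.

Section TGWInvolution.
Variables (k : comNzRingType) (R : comAlgType k) (I : finType).
Variable D : tgw_datum R I.

Definition tgw_swap (s : tgw_sym R I) : tgw_sym R I :=
  match s with
  | inl r => inl r
  | inr (inl i) => inr (inr i)
  | inr (inr i) => inr (inl i)
  end.

Lemma tgw_swapK : involutive tgw_swap. Proof. by case=> [r|[i|i]]. Qed.

Definition tgw_cons_star (x : tgw_cons D) : tgw_cons D :=
  tgw_cons_pi D (fanti tgw_swap (tgw_cons_repr x)).

Definition tgw_star (x : tgw D) : tgw D := tgw_pi (tgw_cons_star (tgw_repr x)).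

Lemma tgw_cons_star_pi p :
  tgw_cons_star (tgw_cons_pi D p) = tgw_cons_pi D (fanti tgw_swap p).
Proof.
apply/quot_piP; rewrite -fantiB; apply: fanti_gen_ideal; last exact: quot_repr_pi.
have tI := idealP (gen_ideal (tgw_rel D)).
move=> {}p [a r s||r s|i r|i r|i|i|i j ij];
  rewrite ?(fantiD, fantiN, fantiZ, fantiM, fanti_gen, fanti1) /=.
- by apply: gen_idealW; apply: tgw_rel_lin.
- apply: gen_idealW. apply: tgw_rel_one.
- by rewrite mulrC; apply: gen_idealW; apply: tgw_rel_mul.
- rewrite -opprB; apply: (two_sidedN tI); apply: gen_idealW.
  by have := tgw_rel_Yr D i (tgw_sigma D i r); rewrite tgw_sigmaK.
- rewrite -opprB; apply: (two_sidedN tI); apply: gen_idealW.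
  by have := tgw_rel_Xr D i (tgw_sigmaV D i r); rewrite tgw_sigmaVK.
- by apply: gen_idealW; apply: tgw_rel_YX.
- by apply: gen_idealW; apply: tgw_rel_XY.
- by apply: gen_idealW; apply: tgw_rel_XYC; rewrite eq_sym.
Qed.

Lemma tgw_cons_ind (P : tgw_cons D -> Prop) :
  (forall p, P (tgw_cons_pi D p)) -> forall x, P x.
Proof. by move=> Pp x; rewrite -[x]tgw_cons_reprK. Qed.

Lemma tgw_cons_starD x y :
  tgw_cons_star (x + y) = tgw_cons_star x + tgw_cons_star y.
Proof.
elim/tgw_cons_ind: x => p; elim/tgw_cons_ind: y => q.
by rewrite -rmorphD !tgw_cons_star_pi fantiD rmorphD.
Qed.

Lemma tgw_cons_starB x y :
  tgw_cons_star (x - y) = tgw_cons_star x - tgw_cons_star y.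
Proof.
elim/tgw_cons_ind: x => p; elim/tgw_cons_ind: y => q.
by rewrite -rmorphB !tgw_cons_star_pi fantiB rmorphB.
Qed.

Lemma tgw_cons_star0 : tgw_cons_star 0 = 0.
Proof. by rewrite -{1}(subrr (0 : tgw_cons D)) tgw_cons_starB subrr. Qed.

Lemma tgw_cons_star1 : tgw_cons_star 1 = 1.
Proof. by rewrite -(rmorph1 (tgw_cons_pi D)) tgw_cons_star_pi fanti1. Qed.

Lemma tgw_cons_starM x y :
  tgw_cons_star (x * y) = tgw_cons_star y * tgw_cons_star x.
Proof.
elim/tgw_cons_ind: x => p; elim/tgw_cons_ind: y => q.
by rewrite -rmorphM !tgw_cons_star_pi fantiM rmorphM.
Qed.

Lemma tgw_cons_starK : involutive tgw_cons_star.
Proof.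
elim/tgw_cons_ind=> p; rewrite !tgw_cons_star_pi fantiK //.
exact: tgw_swapK.
Qed.

Lemma tgw_cons_star_comp d x :
  tgw_cons_comp d x -> tgw_cons_comp (- d) (tgw_cons_star x).
Proof.
move=> [ws wsP ->]; exists [seq (w.1, rev (map tgw_swap w.2)) | w <- ws].
  rewrite all_map; apply: sub_all wsP => w /= /eqP <-.
  rewrite (perm_big _ (permEl (perm_rev _))) big_map -sumrN.
  by apply/eqP/eq_bigr => -[r|[i|i]] _; rewrite /= ?oppr0 ?opprK.
elim: ws wsP => [_|w ws IHws /= /andP[_ /IHws {}IHws]].
  by rewrite !big_nil tgw_cons_star0.
rewrite !big_cons tgw_cons_starD IHws; congr (_ + _).
rewrite tgw_cons_starM /=.
have -> : tgw_cons_star (tgw_cons_pi D w.1%:A) = tgw_cons_pi D w.1%:A.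
  by rewrite tgw_cons_star_pi fantiZ fanti1.
have -> : tgw_cons_star (\prod_(s <- w.2) tgw_cons_pi D (fgen k s)) =
    \prod_(s <- rev (map tgw_swap w.2)) tgw_cons_pi D (fgen k s).
  elim: w.2 => [|s v IHv]; first by rewrite !big_nil tgw_cons_star1.
  rewrite big_cons tgw_cons_starM IHv /= rev_cons -cats1 big_cat big_seq1 /=.
  by rewrite tgw_cons_star_pi fanti_gen.
rewrite -(rmorph_prod (tgw_cons_pi D)) -!rmorphM; congr (tgw_cons_pi D _).
by rewrite mulr_algl mulr_algr.
Qed.

Lemma tgw_cons_star_sum (s : seq (tgw_cons D)) :
  tgw_cons_star (\sum_(y <- s) y) = \sum_(y <- map tgw_cons_star s) y.
Proof.
elim: s => [|y s IHs]; first by rewrite !big_nil tgw_cons_star0.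
by rewrite /= !big_cons tgw_cons_starD IHs.
Qed.

Lemma tgw_cons_star_rad x : tgw_rad D x -> tgw_rad D (tgw_cons_star x).
Proof.
move=> [s sP ->]; exists (map tgw_cons_star s); last exact: tgw_cons_star_sum.
move=> _ /mapP[y /sP[J [[tJ gJ] J0] Jy] ->].
exists (fun z => J (tgw_cons_star z)); last by rewrite tgw_cons_starK.
split; [split=> [|z Jz] | move=> z Jz z0].
- split=> [|a b|a b|a b];
    rewrite ?(tgw_cons_star0, tgw_cons_starD, tgw_cons_starM).
  + exact: two_sided0.
  + exact: (two_sidedD tJ).
  + exact: (two_sidedMr tJ).
  + exact: (two_sidedMl tJ).
- have [t tP tE] := gJ _ Jz; exists (map tgw_cons_star t).
    move=> _ /mapP[u /tP[Ju [d du]] ->]; rewrite tgw_cons_starK; split=> //.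
    by exists (- d); apply: tgw_cons_star_comp.
  by rewrite -tgw_cons_star_sum -tE tgw_cons_starK.
- rewrite -[z]tgw_cons_starK [tgw_cons_star z]J0 ?tgw_cons_star0 //.
  by rewrite -oppr0; apply: tgw_cons_star_comp.
Qed.

Lemma tgw_star_pi x : tgw_star (tgw_pi x) = tgw_pi (tgw_cons_star x).
Proof.
apply/quot_piP; rewrite -tgw_cons_starB; apply: tgw_cons_star_rad.
exact: quot_repr_pi.
Qed.

Lemma tgw_ind (P : tgw D -> Prop) : (forall x, P (tgw_pi x)) -> forall x, P x.
Proof. by move=> Pp x; rewrite -[x]tgw_reprK. Qed.

Lemma tgw_starD x y : tgw_star (x + y) = tgw_star x + tgw_star y.
Proof.
elim/tgw_ind: x => p; elim/tgw_ind: y => q.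
by rewrite -rmorphD !tgw_star_pi tgw_cons_starD rmorphD.
Qed.

Lemma tgw_starM x y : tgw_star (x * y) = tgw_star y * tgw_star x.
Proof.
elim/tgw_ind: x => p; elim/tgw_ind: y => q.
by rewrite -rmorphM !tgw_star_pi tgw_cons_starM rmorphM.
Qed.

Lemma tgw_starK : involutive tgw_star.
Proof. by elim/tgw_ind=> x; rewrite !tgw_star_pi tgw_cons_starK. Qed.

Lemma tgw_star_R r : tgw_star (tgw_R D r) = tgw_R D r.
Proof. by rewrite tgw_star_pi tgw_cons_star_pi fanti_gen. Qed.
Lemma tgw_star_X i : tgw_star (tgw_X D i) = tgw_Y D i.
Proof. by rewrite tgw_star_pi tgw_cons_star_pi fanti_gen. Qed.
Lemma tgw_star_Y i : tgw_star (tgw_Y D i) = tgw_X D i.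
Proof. by rewrite tgw_star_pi tgw_cons_star_pi fanti_gen. Qed.

End TGWInvolution.

Module SymplecticLieAlgebra.
Section SymplecticLieAlgebra.
Variables (k : fieldType) (n : nat).

Definition sp_form : 'M[k]_(n + n) := block_mx 0 1%:M (- 1%:M) 0.

Definition sp_pred : {pred 'M[k]_(n + n)} :=
  fun A => A^T *m sp_form + sp_form *m A == 0.

Lemma sp_predP A : reflect (A^T *m sp_form = - (sp_form *m A)) (A \in sp_pred).
Proof. by rewrite unfold_in addr_eq0; apply: eqP. Qed.

Fact sp_submod_closed : submod_closed sp_pred.
Proof.
split=> [|a A B /sp_predP spA /sp_predP spB]; apply/sp_predP.
  by rewrite trmx0 mul0mx mulmx0 oppr0.
rewrite linearD linearZ /= mulmxDl mulmxDr -scalemxAl -scalemxAr spA spB.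
by rewrite opprD scalerN.
Qed.
HB.instance Definition _ :=
  GRing.isSubmodClosed.Build k 'M[k]_(n + n) sp_pred sp_submod_closed.

Record sp := Sp { sp_val :> 'M[k]_(n + n); sp_valP : sp_val \in sp_pred }.
HB.instance Definition _ := [isSub for sp_val].
HB.instance Definition _ := [Choice of sp by <:].
HB.instance Definition _ := [SubChoice_isSubLmodule of sp by <:].

Fact sp_br_subproof (x y : sp) : x *m y - y *m x \in sp_pred.
Proof.
have /sp_predP xP := sp_valP x; have /sp_predP yP := sp_valP y.
apply/sp_predP; rewrite linearB /= !trmx_mul mulmxBl -!mulmxA xP yP !mulmxN.
by rewrite !mulmxA xP yP !mulNmx !opprK mulmxBr !mulmxA opprB.
Qed.
Definition sp_br (x y : sp) : sp := Sp (sp_br_subproof x y).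

Lemma sp_formK : sp_form *m sp_form = - 1%:M.
Proof.
rewrite /sp_form mulmx_block !mulmx0 !mul0mx !mulmxN !mulNmx !mulmx1 !add0r !addr0.
by rewrite [in RHS]scalar_mx_block opp_block_mx !oppr0.
Qed.

Fact sp_tr_subproof (x : sp) : (x : 'M_(n + n))^T \in sp_pred.
Proof.
have /sp_predP xP := sp_valP x; apply/sp_predP; rewrite trmxK.
have /(congr1 (fun A => sp_form *m A *m sp_form)) := xP.
rewrite mulmxN mulNmx !mulmxA sp_formK mulNmx mul1mx mulNmx opprK => <-.
by rewrite -[LHS]mulmxA sp_formK mulmxN mulmx1.
Qed.
(* The anti-automorphism of sp that fixes h_i and exchanges e_i and f_i. *)
Definition sp_tr (x : sp) : sp := Sp (sp_tr_subproof x).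

Fact sp_block_subproof (A B C : 'M[k]_n) :
  B^T = B -> C^T = C -> block_mx A B C (- A^T) \in sp_pred.
Proof.
move=> hB hC; apply/sp_predP; rewrite /sp_form tr_block_mx !mulmx_block hB hC.
have -> : (- A^T)^T = - A by rewrite linearN /= trmxK.
rewrite !mulmx0 !mul0mx !mulmxN !mulNmx !mulmx1 !mul1mx.
by rewrite !add0r !addr0 opp_block_mx !opprK.
Qed.
Definition sp_block (A B C : 'M[k]_n) (hB : B^T = B) (hC : C^T = C) : sp :=
  Sp (sp_block_subproof A hB hC).

Fact zero_sym : (0 : 'M[k]_n)^T = 0. Proof. exact: trmx0. Qed.
Fact delta_sym i : (delta_mx i i : 'M[k]_n)^T = delta_mx i i.
Proof. exact: trmx_delta. Qed.

Definition sp_levi (A : 'M[k]_n) : sp := sp_block A zero_sym zero_sym.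

(* The standard Cartan subalgebra of diagonal matrices diag(d, -d). *)
Definition sp_cartan (d : 'rV[k]_n) : sp := sp_levi (diag_mx d).

(* Chevalley generators; the simple roots are indexed from 0, and the last
   index, the one with i.+1 = n, is the long simple root. *)
Definition sp_unit (i : 'I_n) : 'M[k]_n :=
  \matrix_(a, b) ((a == i) && (b == i.+1 :> nat))%:R.

Definition sp_e (i : 'I_n) : sp :=
  if i.+1 == n then sp_block 0 (delta_sym i) zero_sym
  else sp_levi (sp_unit i).

Definition sp_f (i : 'I_n) : sp :=
  if i.+1 == n then sp_block 0 zero_sym (delta_sym i)
  else sp_levi (sp_unit i)^T.

Definition sp_h (i : 'I_n) : sp :=
  sp_cartan (\row_a ((a == i)%:R - (a == i.+1 :> nat)%:R)).

Lemma sp_tr_e i : sp_tr (sp_e i) = sp_f i.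
Proof.
apply: val_inj; rewrite /sp_e /sp_f; case: eqP => _ /=; rewrite tr_block_mx.
  by rewrite !trmx0 trmx_delta oppr0 trmx0.
by rewrite !trmx0 [(- _)^T]linearN /= trmxK.
Qed.

Lemma sp_trK : involutive sp_tr.
Proof. by move=> x; apply: val_inj; rewrite /= trmxK. Qed.

Lemma sp_tr_cartan d : sp_tr (sp_cartan d) = sp_cartan d.
Proof.
apply: val_inj; rewrite /= tr_block_mx !trmx0 [(- _)^T]linearN /=.
by rewrite !tr_diag_mx.
Qed.

Lemma sp_br_ef i : sp_br (sp_e i) (sp_f i) = sp_h i.
Proof.
pose D : 'M[k]_n := diag_mx (\row_a ((a == i)%:R - (a == i.+1 :> nat)%:R)).
have next0 (a : 'I_n) : i.+1 = n -> (a == i.+1 :> nat) = false.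
  by move=> ->; apply: ltn_eqF.
apply: val_inj; rewrite /sp_e /sp_f /sp_h /=; case: eqP => [iE|iE] /=.
  rewrite !mulmx_block !mulmx0 !mul0mx !trmx0 !oppr0 !mulmx0 !mul0mx.
  rewrite !addr0 !add0r !mul_delta_mx opp_block_mx add_block_mx oppr0 !addr0 add0r.
  have -> : delta_mx i i = D.
    apply/matrixP=> a b; rewrite !mxE next0 // subr0.
    case: (eqVneq a b) => [<-|ab]; first by rewrite andbb.
    by case: (eqVneq a i) => [<-|//]; rewrite eq_sym (negbTE ab).
  by rewrite tr_diag_mx.
have lt_i : (i.+1 < n)%N by rewrite ltn_neqAle ltn_ord andbT; apply/eqP.
pose j := Ordinal lt_i.
have uE : sp_unit i = delta_mx i j by apply/matrixP=> a b; rewrite !mxE.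
rewrite uE trmx_delta !mulmx_block !mulmx0 !mul0mx !mulNmx !mulmxN !opprK.
rewrite !addr0 !add0r !trmx_delta !mul_delta_mx opp_block_mx add_block_mx.
rewrite !oppr0 !addr0.
have DE : delta_mx i i - delta_mx j j = D.
  apply/matrixP=> a b; rewrite !mxE -[a == i.+1 :> nat]/(a == j).
  case: (eqVneq a b) => [<-|ab]; first by rewrite !andbb.
  rewrite mulr0n; case: (eqVneq a i) => [<-|_]; case: (eqVneq a j) => [<-|_];
    by rewrite ?[_ == a]eq_sym ?(negbTE ab) ?subrr.
by rewrite DE -[delta_mx j j - _]opprB DE tr_diag_mx.
Qed.

Lemma sp_br_linear : (forall x, linear (sp_br x)) /\ (forall y, linear (sp_br^~ y)).
Proof.
split=> [x|y] c u v; apply: val_inj => /=.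
  rewrite !mulmxDl !mulmxDr -!scalemxAl -!scalemxAr.
  by rewrite scalerBr opprD addrACA.
rewrite !mulmxDl !mulmxDr -!scalemxAl -!scalemxAr.
by rewrite scalerBr opprD addrACA.
Qed.

End SymplecticLieAlgebra.
End SymplecticLieAlgebra.
Export SymplecticLieAlgebra.

Section EnvelopingSp.
Variables (k : fieldType) (n : nat).

Definition Usp : Type := Uenv (@sp_br k n).
HB.instance Definition _ := GRing.PzRing.on Usp.

Definition Ue (i : 'I_n) : Usp := Ugen _ (sp_e k i).
Definition Uf (i : 'I_n) : Usp := Ugen _ (sp_f k i).
Definition Uh (i : 'I_n) : Usp := Ugen _ (sp_h k i).

Definition Usp_star (u : Usp) : Usp := Upi _ (fanti (@sp_tr k n) (Urepr u)).

Lemma Usp_star_pi p : Usp_star (Upi _ p) = Upi _ (fanti (@sp_tr k n) p).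
Proof.
apply/quot_piP; rewrite -fantiB; apply: fanti_gen_ideal; last exact: quot_repr_pi.
move=> {}p [a x y|x y];
  rewrite ?(fantiD, fantiN, fantiZ, fantiM, fanti_gen); apply: gen_idealW.
  have -> : sp_tr (a *: x + y) = a *: sp_tr x + sp_tr y.
    by apply: val_inj; rewrite /= linearD linearZ.
  exact: Urel_lin.
have -> : sp_tr (sp_br x y) = sp_br (sp_tr y) (sp_tr x).
  by apply: val_inj; rewrite /= linearB /= !trmx_mul.
exact: Urel_br.
Qed.

Lemma Usp_ind (P : Usp -> Prop) : (forall p, P (Upi _ p)) -> forall u, P u.
Proof. by move=> Pp u; rewrite -[u]UreprK. Qed.

Lemma Usp_starD u v : Usp_star (u + v) = Usp_star u + Usp_star v.
Proof.
elim/Usp_ind: u => p; elim/Usp_ind: v => q.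
by rewrite -(rmorphD (Upi _)) !Usp_star_pi fantiD (rmorphD (Upi _)).
Qed.

Lemma Usp_starM u v : Usp_star (u * v) = Usp_star v * Usp_star u.
Proof.
elim/Usp_ind: u => p; elim/Usp_ind: v => q.
by rewrite -(rmorphM (Upi _)) !Usp_star_pi fantiM (rmorphM (Upi _)).
Qed.

Lemma Usp_starK : involutive Usp_star.
Proof.
by elim/Usp_ind=> p; rewrite !Usp_star_pi fantiK //; apply: sp_trK.
Qed.

Lemma Usp_star_scal c : Usp_star (Uscal _ c) = Uscal _ c.
Proof. by rewrite Usp_star_pi fantiZ fanti1. Qed.
Lemma Usp_star_e i : Usp_star (Ue i) = Uf i.
Proof. by rewrite Usp_star_pi fanti_gen sp_tr_e. Qed.
Lemma Usp_star_f i : Usp_star (Uf i) = Ue i.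
Proof. by rewrite -Usp_star_e Usp_starK. Qed.
Lemma Usp_star_h i : Usp_star (Uh i) = Uh i.
Proof. by rewrite Usp_star_pi fanti_gen sp_tr_cartan. Qed.

Variant chevalley := ChevE of 'I_n | ChevF of 'I_n | ChevH of 'I_n.

Definition chevalley_gen (s : chevalley) : Usp :=
  match s with ChevE i => Ue i | ChevF i => Uf i | ChevH i => Uh i end.

Definition chevalley_deg (s : chevalley) : {ffun 'I_n -> int} :=
  match s with
  | ChevE i => [ffun j => (j == i)%:R]
  | ChevF i => - [ffun j => (j == i)%:R]
  | ChevH _ => 0
  end.

Definition Usp_comp : {ffun 'I_n -> int} -> Usp -> Prop :=
  gcomp (@Uscal _ _ (@sp_br k n)) chevalley_gen chevalley_deg.

(* Solving u_i - u_(i+1) = h_i and u_n - 1/2 = h_n gives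
   u_i = h_i + ... + h_n + 1/2. *)
Definition Usp_u (i : 'I_n) : freealg k (sp k n) :=
  \sum_(j < n | (i <= j)%N) fgen k (sp_h k j) + (2%:R^-1)%:A.

Definition Usp_R (p : {mpoly k[n]}) : Usp :=
  Upi _ (mmap (in_alg (freealg k (sp k n))) Usp_u p).

Lemma Usp_RX i : Usp_R 'X_i = \sum_(j < n | (i <= j)%N) Uh j + Uscal _ 2%:R^-1.
Proof.
rewrite /Usp_R mmapX mmap1U /Usp_u (rmorphD (Upi _)); congr (_ + _).
exact: (rmorph_sum (Upi _)).
Qed.

Lemma Usp_RB p q : Usp_R (p - q) = Usp_R p - Usp_R q.
Proof. by rewrite /Usp_R mmapB (rmorphB (Upi _)). Qed.
Lemma Usp_RD p q : Usp_R (p + q) = Usp_R p + Usp_R q.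
Proof. by rewrite /Usp_R mmapD (rmorphD (Upi _)). Qed.
Lemma Usp_RC c : Usp_R c%:MP = Uscal _ c.
Proof. by rewrite /Usp_R mmapC. Qed.

Lemma Usp_R_h (i j : 'I_n) : j = i.+1 :> nat -> Usp_R ('X_i - 'X_j) = Uh i.
Proof.
move=> ji; rewrite Usp_RB !Usp_RX (bigD1 i) //= opprD addrACA subrr addr0.
rewrite (eq_bigl (fun l : 'I_n => (j <= l)%N)) ?addrK // => l.
by rewrite ji ltn_neqAle eq_sym andbC.
Qed.

Lemma Usp_R_hn (i : 'I_n) : i.+1 = n -> Usp_R ('X_i - (2%:R^-1)%:MP) = Uh i.
Proof.
move=> iE; rewrite Usp_RB Usp_RC Usp_RX addrK (bigD1 i) //= big1 ?addr0 // => l.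
case/andP=> il /eqP li; case: li; apply/val_inj/eqP.
by rewrite eqn_leq il andbT -ltnS iE ltn_ord.
Qed.

Lemma Uscal_central c u : Uscal (@sp_br k n) c * u = u * Uscal _ c.
Proof.
elim/Usp_ind: u => p; rewrite -!(rmorphM (Upi _)).
by rewrite mulr_algl mulr_algr.
Qed.

Lemma Uh_comm i j : Uh i * Uh j = Uh j * Uh i.
Proof.
apply/eqP; rewrite -subr_eq0; apply/eqP.
rewrite -!(rmorphM (Upi _)) -(rmorphB (Upi _)).
have := @Urel_br _ _ (@sp_br k n) (sp_h k i) (sp_h k j).
have -> : sp_br (sp_h k i) (sp_h k j) = 0.
  apply: val_inj; rewrite /= !mulmx_block !mulmx0 !mul0mx !addr0 !add0r.
  rewrite !mulNmx !mulmxN !opprK !tr_diag_mx.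
  by rewrite diag_mxC subrr.
move/gen_idealW => h1.
have := @Urel_lin _ _ (@sp_br k n) (-1) 0 0.
rewrite scaler0 add0r scaleN1r addNr subr0 => /gen_idealW h2.
have := two_sidedD (idealP (gen_ideal (Urel (@sp_br k n)))) h1 h2.
by rewrite subrK => h; apply/quot_pi_eq0.
Qed.

Lemma Usp_R_mmap1 m :
  Upi _ (mmap1 Usp_u m) = \prod_(i < n) (Usp_R 'X_i) ^+ m i.
Proof.
rewrite /mmap1 (rmorph_prod (Upi _)); apply: eq_bigr => i _.
by rewrite (rmorphXn (Upi _)) /Usp_R mmapX mmap1U.
Qed.

Lemma Usp_RX_comm i j :
  GRing.comm (Usp_R 'X_i : Usp) (Usp_R 'X_j).
Proof.
rewrite !Usp_RX; apply: commrD; last by apply: esym; apply: Uscal_central.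
apply: commr_sym; apply: commrD; last by apply: esym; apply: Uscal_central.
apply: commr_sum => l _; apply: commr_sym; apply: commr_sum => l' _.
exact: Uh_comm.
Qed.

Lemma Usp_RM p q : Usp_R (p * q) = Usp_R p * Usp_R q.
Proof.
have RZ c r : Usp_R (c *: r) = Uscal _ c * Usp_R r.
  by rewrite /Usp_R mmapZ (rmorphM (Upi _)).
have R0 : Usp_R 0 = 0 by rewrite -(subrr 0) Usp_RB subrr.
elim/mpolyind: p => [|c m p _ _ IHp]; first by rewrite mul0r R0 mul0r.
rewrite mulrDl !Usp_RD IHp mulrDl -scalerAl !RZ -mulrA; congr (_ * _ + _).
elim/mpolyind: q {IHp} => [|d l q _ _ IHq]; first by rewrite mulr0 R0 mulr0.
rewrite mulrDr !Usp_RD IHq mulrDr -scalerAr !RZ mulrA -Uscal_central -mulrA.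
congr (_ * _ + _); rewrite -mpolyXD /Usp_R !mmapX !Usp_R_mmap1.
elim: (index_enum _) => [|i r IHr]; first by rewrite !big_nil mulr1.
rewrite !big_cons IHr mnmDE exprD -!mulrA; congr (_ * _); rewrite !mulrA.
congr (_ * _); apply: commr_prod => j _; apply: commrX; apply: commr_sym.
by apply: commrX; apply: Usp_RX_comm.
Qed.

End EnvelopingSp.

Section WeightModules.
Variables (k : fieldType) (n : nat) (M : lmodType k).
Variable rho : lie_module (@sp_br k n) M.

(* The dual of the Cartan subalgebra, whose elements are sp_cartan d. *)
Definition weight := 'Hom('rV[k]_n, k^o).

Definition weight_space (mu : weight) (m : M) : Prop :=
  forall d, rho (sp_cartan d) m = (mu d : k) *: m.

Definition weight_module : Prop :=
  (forall m, exists2 s : seq M,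
     forall x, x \in s -> exists mu, weight_space mu x & m = \sum_(x <- s) x) /\
  (forall (mus : seq weight) (x : weight -> M),
     uniq mus -> (forall mu, weight_space mu (x mu)) ->
     \sum_(mu <- mus) x mu = 0 -> forall mu, mu \in mus -> x mu = 0).

Definition completely_pointed : Prop :=
  weight_module /\
  forall mu, exists v, forall m, weight_space mu m -> exists c : k, m = c *: v.

End WeightModules.

Section CTilde.
Variables (k : fieldType) (n : nat).
Implicit Types (p q : {mpoly k[n]}) (i e v : 'I_n).

Definition Ctilde_gamma e v : int :=
  if e == v then (if v.+1 == n then 2 else 1)
  else if e == v.+1 :> nat then -1 else 0.

Definition mshift (c : 'I_n -> k) p : {mpoly k[n]} :=
  p \mPo [tuple 'X_e + (c e)%:MP | e < n].

Definition Ctilde_sigma v : {mpoly k[n]} -> {mpoly k[n]} :=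
  mshift (fun e => - (Ctilde_gamma e v)%:~R).
Definition Ctilde_sigmaV v : {mpoly k[n]} -> {mpoly k[n]} :=
  mshift (fun e => (Ctilde_gamma e v)%:~R).

Definition Ctilde_t i : {mpoly k[n]} :=
  if (insub i.+1 : option 'I_n) is Some j then 'X_i * ('X_j - 1)
  else 'X_i * ('X_i + 1).

Lemma mshift_linear c : linear (mshift c).
Proof. by move=> a p q; rewrite /mshift linearP. Qed.

Lemma mshift_morph c : monoid_morphism (mshift c).
Proof. by split=> [|p q]; rewrite /mshift ?rmorph1 ?rmorphM. Qed.

Lemma mshiftX c e : mshift c 'X_e = 'X_e + (c e)%:MP.
Proof. by rewrite /mshift comp_mpolyXU -tnth_nth tnth_mktuple. Qed.

Lemma mshift_ext c d p : c =1 d -> mshift c p = mshift d p.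
Proof.
move=> cd; rewrite /mshift; congr (_ \mPo _); apply: eq_from_tnth => e.
by rewrite !tnth_mktuple cd.
Qed.

Lemma mshift0 p : mshift (fun=> 0) p = p.
Proof.
rewrite -[RHS]comp_mpoly_id /mshift; congr (_ \mPo _); apply: eq_from_tnth => e.
by rewrite !tnth_mktuple mpolyC0 addr0.
Qed.

Lemma mshiftD c d p : mshift d (mshift c p) = mshift (fun e => c e + d e) p.
Proof.
elim/mpolyind: p => [|a m p _ _ IHp]; first by rewrite /mshift !linear0.
rewrite !mshift_linear IHp; congr (_ *: _ + _).
rewrite mpolyXE_id /mshift !rmorph_prod; apply: eq_bigr => e _.
rewrite !rmorphXn /=; congr (_ ^+ _); rewrite -!/(mshift _ _) !mshiftX.
by rewrite /mshift rmorphD /= comp_mpolyC -/(mshift d _) mshiftX rmorphD addrAC addrA.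
Qed.

Lemma Ctilde_sigmaK v : cancel (Ctilde_sigma v) (Ctilde_sigmaV v).
Proof.
move=> p; rewrite /Ctilde_sigmaV mshiftD -[RHS]mshift0.
by apply: mshift_ext => e; rewrite addNr.
Qed.

Lemma Ctilde_sigmaVK v : cancel (Ctilde_sigmaV v) (Ctilde_sigma v).
Proof.
move=> p; rewrite /Ctilde_sigma mshiftD -[RHS]mshift0.
by apply: mshift_ext => e; rewrite subrr.
Qed.

Lemma Ctilde_sigmaC v w p :
  Ctilde_sigma v (Ctilde_sigma w p) = Ctilde_sigma w (Ctilde_sigma v p).
Proof.
by rewrite /Ctilde_sigma !mshiftD; apply: mshift_ext => e; rewrite addrC.
Qed.

Lemma Ctilde_t_neq0 i : Ctilde_t i != 0.
Proof.
have evP (w : 'I_n -> k) p : p.@[w] != 0 -> p != 0.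
  by apply: contraNneq => ->; rewrite meval0.
have X0 : 'X_i != 0 :> {mpoly k[n]}.
  by apply: (evP (fun=> 1)); rewrite mevalXU oner_neq0.
rewrite /Ctilde_t; case: insubP => [j _ _|_]; rewrite mulf_neq0 //.
  by apply: (evP (fun=> 0)); rewrite mevalB mevalXU meval1 sub0r oppr_eq0 oner_neq0.
by apply: (evP (fun=> 0)); rewrite mevalD mevalXU meval1 add0r oner_neq0.
Qed.

Definition Ctilde_datum : tgw_datum {mpoly k[n]} 'I_n :=
  TGWDatum (fun v => mshift_linear _) (fun v => mshift_morph _)
    Ctilde_sigmaK Ctilde_sigmaVK Ctilde_sigmaC
    Ctilde_t_neq0 (fun i r => mulrC _ _).

Definition ACtilde : Type := tgw Ctilde_datum.
HB.instance Definition _ := GRing.PzRing.on ACtilde.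

Definition AX (i : 'I_n) : ACtilde := tgw_X Ctilde_datum i.
Definition AY (i : 'I_n) : ACtilde := tgw_Y Ctilde_datum i.
Definition AR (p : {mpoly k[n]}) : ACtilde := tgw_R Ctilde_datum p.
Definition Ascal (c : k) : ACtilde := tgw_scal Ctilde_datum c.
Definition Acomp : {ffun 'I_n -> int} -> ACtilde -> Prop :=
  tgw_comp (D := Ctilde_datum).
Definition Astar : ACtilde -> ACtilde := tgw_star (D := Ctilde_datum).

(* im is the chosen square root of -1. *)
Definition psi_spec (im : k) (psi : {rmorphism Usp k n -> ACtilde}) : Prop :=
  [/\ forall c, psi (Uscal _ c) = Ascal c,
      forall i j : 'I_n, j = i.+1 :> nat ->
        [/\ psi (Ue k i) = AX i, psi (Uf k i) = AY i &
            psi (Uh k i) = AR ('X_i - 'X_j)] &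
      forall i : 'I_n, i.+1 = n ->
        [/\ psi (Ue k i) = Ascal (im / 2%:R) * AX i,
            psi (Uf k i) = Ascal (im / 2%:R) * AY i &
            psi (Uh k i) = AR ('X_i - (2%:R^-1)%:MP)]].

End CTilde.

(* Main.v *)
Require Import Defs.
From HB Require Import structures.
From mathcomp Require Import all_boot all_order all_algebra.
From mathcomp Require Import ring boolp.
From mathcomp.multinomials Require Import mpoly.

Set Implicit Arguments.
Unset Strict Implicit.
Unset Printing Implicit Defensive.

Import GRing.Theory.
Local Open Scope ring_scope.

(** Write [T(a, b)] for the element [c |-> a w(b, c) + b w(a, c)] of [sp_2n]; these span
    it, and in the oscillator representation on polynomials [T(a, b)] becomes the
    symmetrised product of two generators of the Weyl algebra, twisted by [sqrt(-1)].

    The TGW algebra acts on any weight module of [sp_2n] on which [f_i e_i] acts as (a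
    multiple of) [t_i].  The oscillator module is one of them.  The kernel of the action on
    it is graded and meets the degree zero part [R] trivially, so it is contained in the
    radical: the algebra acts faithfully, and [psi] sends [u] to the unique element acting
    as [u] there.

    Let [M] be infinite-dimensional, simple and completely pointed.  All elements of degree
    zero act on [M] by commuting scalars.  For the long root vectors [e = T(p, p)] and
    [f = T(q, q)] of index [i] let [z] be the Casimir value, so that
    [f e v = ((l + 1)^2 - z) v].  For [A = T(p_1, p_2)], commuting [f e] past [A] gives
    [(z' - z - 1)^2 = 4 z] where [z'] is the value at [A v], and [e_1 e_2 v] is a multiple
    of [A^2 v] expressed through second differences of [z]; comparing two consecutive steps
    shows that [A^3 v <> 0] forces [e_1 e_2 v = 0] or [z = 1/4].  If every long root vector
    is locally nilpotent, [z] is the square of an integer, and the first alternative bounds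
    the weights, so [M] is finite-dimensional.  Otherwise some long root vector is
    injective, then one for each index is, and [z = 1/4] everywhere; this determines
    [f_i e_i] to be [t_i].  Hence [M] is a module over the TGW algebra and [ker psi] kills
    it.  Conversely, the injective long root vectors make the support of [M] Zariski dense,
    so the annihilator meets [R] trivially; as it is graded, it is contained in [ker psi]. *)

(** * Quadratic elements of the symplectic Lie algebra *)

Section SpQuadratic.
Variables (k : fieldType) (n : nat).
Local Notation vec := 'cV[k]_(n + n).
Implicit Types (a b c d : vec).

(** Writing [z = r ^ 2], the relation between consecutive Casimir values says that a step along [A]
    turns [r] into [r + 1] or [r - 1] up to sign, as for the tensor product with the two-dimensional
    representation of sl_2. The value [1/4] is the only one that such a step can leave unchanged,
    and it is not the square of an integer; local nilpotency and the value [1/4] therefore exclude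
    each other. For the radical to act by zero, a homogeneous element that acts nontrivially must be
    brought back to degree zero without losing this property. Two mechanisms serve: the polynomial
    module is not simple, but in its monomial basis the reversed word, with [X_i] and [Y_i]
    exchanged, undoes a word up to a nonzero factor; in [M] simplicity provides the element that
    returns. *)

Definition omega a b : k := - ((a^T *m sp_form k n *m b) 0 0).

Lemma sp_formT : (sp_form k n)^T = - sp_form k n.
Proof.
by rewrite /sp_form tr_block_mx !trmx0 linearN /= trmx1 opp_block_mx opprK !oppr0.
Qed.

(** With [G = x *m sp_form] one has [x = - G *m sp_form], so the Lie algebra is a copy of the
    symmetric matrices; [G] later serves as the coefficient matrix of [x] in the elements [sp_quad]
    and in its quadratic operator. *)
Lemma sp_form_sym (x : sp k n) :
  ((x : 'M_(n + n)) *m sp_form k n)^T = (x : 'M_(n + n)) *m sp_form k n.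
Proof.
have /sp_predP h := sp_valP x; rewrite trmx_mul sp_formT.
have := congr1 (fun Z => Z *m sp_form k n) h.
rewrite mulNmx => /(congr1 (mulmx (sp_form k n))).
rewrite -mulmxA sp_formK !(mulmxN, mulNmx) mulmx1 !mulmxA sp_formK !mulNmx mul1mx opprK.
by move=> ->.
Qed.

Lemma omegaE a b : a^T *m sp_form k n *m b = (- omega a b)%:M.
Proof. by rewrite [LHS]mx11_scalar /omega opprK. Qed.

Lemma omegaC a b : omega b a = - omega a b.
Proof.
rewrite /omega.
have -> : b^T *m sp_form k n *m a = - (a^T *m sp_form k n *m b)^T.
  by rewrite !trmx_mul trmxK sp_formT mulmxA mulmxN mulNmx opprK.
by rewrite !mxE opprK.
Qed.

Fact sp_quad_subproof a b :
  - (a *m b^T + b *m a^T) *m sp_form k n \in @sp_pred k n.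
Proof.
apply/sp_predP; rewrite trmx_mul linearN linearD /= !trmx_mul !trmxK sp_formT.
by rewrite [b *m a^T + _]addrC mulmxA mulNmx !mulmxN !mulNmx.
Qed.
Definition sp_quad a b : sp k n := Sp (sp_quad_subproof a b).

Lemma sp_quadC a b : sp_quad a b = sp_quad b a.
Proof. by apply: val_inj; rewrite /= addrC. Qed.

Lemma sp_quadP x a b c : sp_quad (x *: a + b) c = x *: sp_quad a c + sp_quad b c.
Proof.
apply: val_inj => /=; rewrite [(_ + _)^T]linearP /= !mulmxDl !mulmxDr.
rewrite -!scalemxAl -!scalemxAr addrACA -!scalerDr opprD mulmxDl.
by rewrite -!scalerN -scalemxAl.
Qed.

Lemma sp_quadDl a b c : sp_quad (a + b) c = sp_quad a c + sp_quad b c.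
Proof. by rewrite -[a]scale1r sp_quadP !scale1r. Qed.
Lemma sp_quad0l c : sp_quad 0 c = 0.
Proof. by apply: (addrI (sp_quad 0 c)); rewrite -sp_quadDl !addr0. Qed.
Lemma sp_quadZl x a c : sp_quad (x *: a) c = x *: sp_quad a c.
Proof. by rewrite -[x *: a]addr0 sp_quadP sp_quad0l addr0. Qed.
Lemma sp_quadNl a c : sp_quad (- a) c = - sp_quad a c.
Proof. by rewrite -scaleN1r sp_quadZl scaleN1r. Qed.
Lemma sp_quadNr a c : sp_quad a (- c) = - sp_quad a c.
Proof. by rewrite sp_quadC sp_quadNl sp_quadC. Qed.

Lemma form_rank1 a b c d :
  (a *m b^T *m sp_form k n) *m (c *m d^T *m sp_form k n) =
  - omega b c *: (a *m d^T *m sp_form k n).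
Proof.
rewrite -!mulmxA (mulmxA b^T) (mulmxA _ c) omegaE.
by rewrite mul_scalar_mx -scalemxAr.
Qed.

(** The adjoint representation is the symmetric square of the natural one: [sp_quad a b] acts as a
    derivation on the pair [c], [d]. *)
Lemma sp_br_quad a b c d :
  sp_br (sp_quad a b) (sp_quad c d) =
  omega b c *: sp_quad a d + omega a c *: sp_quad b d +
  (omega b d *: sp_quad a c + omega a d *: sp_quad b c).
Proof.
apply: val_inj; rewrite /= !mulNmx !mulmxN !opprK !mulmxDl !mulmxDr !form_rank1.
rewrite (omegaC a c) (omegaC a d) (omegaC b c) (omegaC b d).
do 8![move: (_ *m sp_form k n) => ?]; apply/matrixP=> i j; rewrite !mxE; ring.
Qed.

End SpQuadratic.

(** * The symplectic basis and its Weyl conjugates *)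

Section SpBasis.
Variables (k : fieldType) (n : nat).
Implicit Types (i j : 'I_n) (s : bool).

Definition xvec i : 'cV[k]_(n + n) := col_mx (delta_mx i 0) 0.
Definition yvec i : 'cV[k]_(n + n) := col_mx 0 (delta_mx i 0).

Lemma omega_col (a b c d : 'cV[k]_n) :
  omega (col_mx a b) (col_mx c d) = (b^T *m c) 0 0 - (a^T *m d) 0 0.
Proof.
rewrite /omega /sp_form tr_col_mx mul_row_block !mulmx0 add0r addr0 mulmx1.
by rewrite mulmxN mulmx1 mul_row_col mulNmx !mxE opprD opprK.
Qed.

Lemma delta_dot i j :
  ((delta_mx i 0 : 'cV[k]_n)^T *m (delta_mx j 0 : 'cV[k]_n)) 0 0 = (i == j)%:R.
Proof. by rewrite trmx_delta mul_delta_mx_cond mulmxnE mxE !eqxx /=. Qed.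

Lemma omega_xx i j : omega (xvec i) (xvec j) = 0.
Proof. by rewrite omega_col trmx0 mul0mx mulmx0 !mxE subrr. Qed.
Lemma omega_yy i j : omega (yvec i) (yvec j) = 0.
Proof. by rewrite omega_col trmx0 mul0mx mulmx0 !mxE subrr. Qed.
Lemma omega_yx i j : omega (yvec i) (xvec j) = (i == j)%:R.
Proof. by rewrite omega_col delta_dot trmx0 mul0mx !mxE subr0. Qed.
Lemma omega_xy i j : omega (xvec i) (yvec j) = - (i == j)%:R.
Proof. by rewrite omegaC omega_yx eq_sym. Qed.

Lemma sp_quad_xy i j : sp_quad (xvec i) (yvec j) = sp_levi (delta_mx i j).
Proof.
apply: val_inj; rewrite /= /sp_form /xvec /yvec !tr_col_mx !mul_col_row !trmx_delta.
rewrite !trmx0 !mulmx0 !mul0mx add_block_mx !addr0 !add0r opp_block_mx mulmx_block.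
rewrite !oppr0 !mul0mx !mulmx0 !mulmx1 !mulmxN !mulmx1 !addr0 !add0r opprK.
by rewrite !mul_delta_mx.
Qed.

Lemma sp_quad_xx i j : (sp_quad (xvec i) (xvec j) : 'M_(n + n)) =
  block_mx 0 (- (delta_mx i j + delta_mx j i)) 0 0.
Proof.
rewrite /= /sp_form /xvec !tr_col_mx !mul_col_row !trmx_delta.
rewrite !trmx0 !mulmx0 !mul0mx add_block_mx !addr0 opp_block_mx mulmx_block.
by rewrite ?(oppr0, mul0mx, mulmx0, mulmx1, mul_delta_mx, addr0, add0r).
Qed.

Lemma sp_quad_yy i j : (sp_quad (yvec i) (yvec j) : 'M_(n + n)) =
  block_mx 0 0 (delta_mx i j + delta_mx j i) 0.
Proof.
rewrite /= /sp_form /yvec !tr_col_mx !mul_col_row !trmx_delta.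
rewrite !trmx0 !mulmx0 !mul0mx add_block_mx !addr0 opp_block_mx mulmx_block.
rewrite ?(oppr0, mul0mx, mulmx0, mulmx1, mul_delta_mx, addr0, add0r).
by rewrite mulmxN mulmx1 opprK.
Qed.

Lemma sp_cartan_quad i : sp_cartan (delta_mx 0 i) = sp_quad (xvec i) (yvec i).
Proof.
rewrite sp_quad_xy /sp_cartan; congr sp_levi; apply/matrixP=> a b.
rewrite !mxE eqxx /=; case: (eqVneq a b) => [<-|ab]; first by rewrite andbb.
by case: (eqVneq a i) => [<-|//]; rewrite eq_sym (negbTE ab).
Qed.

Lemma sp_leviD (a : k) (A B : 'M[k]_n) : sp_levi (a *: A + B) = a *: sp_levi A + sp_levi B.
Proof.
apply: val_inj; rewrite /= scale_block_mx add_block_mx !scaler0 !addr0.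
by rewrite linearP /= opprD scalerN.
Qed.

Lemma sp_e_short i j : j = i.+1 :> nat -> sp_e k i = sp_quad (xvec i) (yvec j).
Proof.
move=> ij; rewrite /sp_e -ij ltn_eqF // sp_quad_xy; congr sp_levi.
by apply/matrixP=> a b; rewrite !mxE -ij.
Qed.

Lemma sp_f_short i j : j = i.+1 :> nat -> sp_f k i = sp_quad (xvec j) (yvec i).
Proof.
move=> ij; rewrite /sp_f -ij ltn_eqF // sp_quad_xy; congr sp_levi.
by apply/matrixP=> a b; rewrite !mxE -ij andbC.
Qed.

(** The 2 arises because [sp_quad] symmetrises two equal arguments, the sign from the lower left
    block of [sp_form]. *)
Lemma sp_e_long i : i.+1 = n -> -2%:R *: sp_e k i = sp_quad (xvec i) (xvec i).
Proof.
move=> iE; apply: val_inj; rewrite -[RHS]/(sp_val _) sp_quad_xx /sp_e iE eqxx /=.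
by rewrite scale_block_mx !scaler0 trmx0 oppr0 scaler0 -mulr2n scaleNr scaler_nat.
Qed.

Lemma sp_f_long i : i.+1 = n -> 2%:R *: sp_f k i = sp_quad (yvec i) (yvec i).
Proof.
move=> iE; apply: val_inj; rewrite -[RHS]/(sp_val _) sp_quad_yy /sp_f iE eqxx /=.
by rewrite scale_block_mx !scaler0 trmx0 oppr0 scaler0 -mulr2n scaler_nat.
Qed.

Lemma sp_h_short i j : j = i.+1 :> nat ->
  sp_h k i = sp_quad (xvec i) (yvec i) - sp_quad (xvec j) (yvec j).
Proof.
move=> ij; rewrite -!sp_cartan_quad -scaleN1r addrC -sp_leviD; congr sp_levi.
apply/matrixP=> a b; rewrite !mxE -ij !eqxx /=.
by case: (a == b); rewrite ?mulr1n ?mulr0n ?mulr0 ?addr0 // mulN1r addrC.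
Qed.

Lemma sp_h_long i : i.+1 = n -> sp_h k i = sp_quad (xvec i) (yvec i).
Proof.
move=> iE; rewrite -!sp_cartan_quad; congr sp_levi; congr diag_mx.
by apply/rowP=> a; rewrite !mxE iE (ltn_eqF (ltn_ord a)) subr0 eqxx.
Qed.

(* The orientation [s] chooses [p = x_i, q = y_i] or [p = y_i, q = - x_i]; in both cases
   [omega q p = 1], so a statement about [p] and [q] is one about all Weyl conjugates. *)
Definition pvec s i := if s then xvec i else yvec i.
Definition qvec s i := if s then yvec i else - xvec i.

Lemma omegaNl (a b : 'cV[k]_(n + n)) : omega (- a) b = - omega a b.
Proof. by rewrite /omega linearN /= !mulNmx !mxE. Qed.
Lemma omegaNr (a b : 'cV[k]_(n + n)) : omega a (- b) = - omega a b.
Proof. by rewrite omegaC omegaNl opprK omegaC. Qed.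

Definition omegaB := (omegaNl, omegaNr, omega_xx, omega_yy, omega_xy, omega_yx,
  @opprK k, @oppr0 k).

Lemma omega_pp s i : omega (pvec s i) (pvec s i) = 0.
Proof. by case: s; rewrite /pvec /qvec ?omegaB. Qed.
Lemma omega_qq s i : omega (qvec s i) (qvec s i) = 0.
Proof. by case: s; rewrite /pvec /qvec ?omegaB. Qed.
Lemma omega_qp s i : omega (qvec s i) (pvec s i) = 1.
Proof. by case: s; rewrite /pvec /qvec ?omegaB eqxx. Qed.
Lemma omega_pq s i : omega (pvec s i) (qvec s i) = - 1.
Proof. by rewrite omegaC omega_qp. Qed.

Lemma omega_neq s t i j (ij : i != j) :
  ((omega (pvec s i) (pvec t j) = 0) * (omega (qvec s i) (pvec t j) = 0)) *
  ((omega (pvec s i) (qvec t j) = 0) * (omega (qvec s i) (qvec t j) = 0)).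
Proof. by case: s; case: t; rewrite /pvec /qvec ?omegaB ?(negbTE ij) ?oppr0. Qed.

Lemma sp_quad_pq s i : sp_quad (pvec s i) (qvec s i) =
  (-1) ^+ (~~ s) *: sp_quad (xvec i) (yvec i).
Proof.
by case: s; rewrite /= ?scale1r ?expr1 ?scaleN1r // sp_quadNr sp_quadC.
Qed.

End SpBasis.

(** * Weight vectors and long root vectors *)

Section Operators.
Variables (k : fieldType) (n : nat) (M : lmodType k).
Variable rho : lie_module (@sp_br k n) M.
Implicit Types (a b c d : 'cV[k]_(n + n)) (i j : 'I_n) (s t : bool) (m v : M).
Implicit Types (l : {ffun 'I_n -> k}).

Definition quad_op a b m : M := rho (sp_quad a b) m.
HB.instance Definition _ a b := GRing.isLinear.Build k M M *:%R (quad_op a b)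
  (lact_linearr rho (sp_quad a b)).

Local Notation op := quad_op.

Lemma lact0 m : rho 0 m = 0.
Proof.
have := lact_linearl rho m (-1) 0 0.
by rewrite scaler0 addr0 scaleN1r addNr.
Qed.
Lemma lact_scale x (c : k) m : rho (c *: x) m = c *: rho x m.
Proof.
by rewrite -{1}[c *: x]addr0 [LHS](lact_linearl rho m c) /= lact0 addr0.
Qed.
Lemma lact_add x y m : rho (x + y) m = rho x m + rho y m.
Proof. by rewrite -{1}[x]scale1r [LHS](lact_linearl rho m 1) scale1r. Qed.
Lemma lact_opp x m : rho (- x) m = - rho x m.
Proof. by rewrite -scaleN1r lact_scale scaleN1r. Qed.
Lemma lact_sum (I : Type) (r : seq I) (P : pred I) (F : I -> sp k n) m :
  rho (\sum_(i <- r | P i) F i) m = \sum_(i <- r | P i) rho (F i) m.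
Proof. by apply: (big_morph (rho^~ m)) => [x y|]; rewrite ?lact_add ?lact0. Qed.

Lemma quad_opC a b m : op a b m = op b a m.
Proof. by rewrite /op sp_quadC. Qed.
Lemma quad_opZl (c : k) a b m : op (c *: a) b m = c *: op a b m.
Proof. by rewrite /op sp_quadZl lact_scale. Qed.
Lemma quad_opNl a b m : op (- a) b m = - op a b m.
Proof. by rewrite /op sp_quadNl lact_opp. Qed.
Lemma quad_opNr a b m : op a (- b) m = - op a b m.
Proof. by rewrite quad_opC quad_opNl quad_opC. Qed.

Lemma quad_op_comm a b c d m : op a b (op c d m) = op c d (op a b m) +
  (omega b c *: op a d m + omega a c *: op b d m +
  (omega b d *: op a c m + omega a d *: op b c m)).
Proof.
have := lact_br rho (sp_quad a b) (sp_quad c d) m.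
by rewrite sp_br_quad !lact_add !lact_scale => ->; rewrite addrC subrK.
Qed.

Definition weightv l m : Prop := forall i, op (xvec k i) (yvec k i) m = l i *: m.

(** [a] has weight [l] in the natural representation: the left side is the image of [a] under
    [sp_quad (xvec k i) (yvec k i)]. *)
Definition homv a l : Prop := forall i,
  omega (yvec k i) a *: xvec k i + omega (xvec k i) a *: yvec k i = l i *: a.

Lemma weightv_op a b la lb l m : homv a la -> homv b lb -> weightv l m ->
  weightv (l + la + lb) (op a b m).
Proof.
move=> ha hb hm i; rewrite quad_op_comm hm.
have E u (u' : 'cV_(n + n)) w x y : x *: op u w m + y *: op u' w m = op (x *: u + y *: u') w m.
  by rewrite /quad_op sp_quadP sp_quadZl lact_add !lact_scale.
rewrite E; have := E (xvec k i) (yvec k i) a (omega (yvec k i) b) (omega (xvec k i) b) => ->.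
rewrite ha hb !quad_opZl (quad_opC b a) linearZ /= -!scalerDl.
by rewrite !ffunE addrA.
Qed.

Definition sgn_delta s i : {ffun 'I_n -> k} := [ffun j => (-1) ^+ (~~ s) * (j == i)%:R].
(** The eigenvalue of [sp_quad p q]; in either orientation a factor [p] raises it by one. *)
Definition ocoord s i l : k := (-1) ^+ (~~ s) * l i.

Lemma ocoordD s i l l' : ocoord s i (l + l') = ocoord s i l + ocoord s i l'.
Proof. by rewrite /ocoord ffunE mulrDr. Qed.
Lemma ocoordN s i l : ocoord s i (- l) = - ocoord s i l.
Proof. by rewrite /ocoord ffunE mulrN. Qed.
Lemma ocoord_delta s i : ocoord s i (sgn_delta s i) = 1.
Proof. by rewrite /ocoord ffunE eqxx mulr1 -expr2 sqrr_sign. Qed.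
Lemma ocoord_neq s t i j : i != j -> ocoord s i (sgn_delta t j) = 0.
Proof. by rewrite /ocoord ffunE => /negbTE->; rewrite !mulr0. Qed.
Lemma ocoord_neg s i l : ocoord (~~ s) i l = - ocoord s i l.
Proof. by rewrite /ocoord; case: s; rewrite /= ?expr0 ?expr1 ?mulN1r ?mul1r ?opprK. Qed.

Lemma homvN a l : homv a l -> homv (- a) l.
Proof. by move=> h i; rewrite !omegaNr scalerN -h opprD !scaleNr. Qed.

Lemma homv_x i : homv (xvec k i) (sgn_delta true i).
Proof.
by move=> j; rewrite omega_yx omega_xx scale0r addr0 ffunE mul1r; case: eqP => [->|]//;
  rewrite !scale0r.
Qed.
Lemma homv_y i : homv (yvec k i) (sgn_delta false i).
Proof.
move=> j; rewrite omega_yy omega_xy scale0r add0r ffunE expr1 mulN1r.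
by case: eqP => [->|]//; rewrite !oppr0 !scale0r.
Qed.

Lemma sgn_deltaN s i : sgn_delta (~~ s) i = - sgn_delta s i.
Proof.
by apply/ffunP=> j; rewrite !ffunE; case: s; rewrite /= ?expr1 ?expr0 ?mulN1r ?mul1r ?opprK.
Qed.

Lemma homv_p s i : homv (pvec k s i) (sgn_delta s i).
Proof. by case: s; [apply: homv_x | apply: homv_y]. Qed.
Lemma homv_q s i : homv (qvec k s i) (- sgn_delta s i).
Proof.
by rewrite -sgn_deltaN; case: s; [apply: homv_y | apply: homvN; apply: homv_x].
Qed.

Lemma weightv_pq s i l m : weightv l m ->
  op (pvec k s i) (qvec k s i) m = ocoord s i l *: m.
Proof.
by move=> h; rewrite /quad_op sp_quad_pq lact_scale -/(op _ _ m) h scalerA.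
Qed.

Lemma weightv_pp s i t j l m : weightv l m ->
  weightv (l + sgn_delta s i + sgn_delta t j) (op (pvec k s i) (pvec k t j) m).
Proof. by apply: weightv_op; apply: homv_p. Qed.
Lemma weightv_qq s i t j l m : weightv l m ->
  weightv (l - sgn_delta s i - sgn_delta t j) (op (qvec k s i) (qvec k t j) m).
Proof. by apply: weightv_op; apply: homv_q. Qed.

Lemma weightv0 l : weightv l 0.
Proof. by move=> i; rewrite linear0 scaler0. Qed.
Lemma weightvZ (c : k) l m : weightv l m -> weightv l (c *: m).
Proof. by move=> h i; rewrite linearZ /= h !scalerA mulrC. Qed.
Lemma weightvD l m m' : weightv l m -> weightv l m' -> weightv l (m + m').
Proof. by move=> h h' i; rewrite linearD /= h h' scalerDr. Qed.

End Operators.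

Section LongRoots.
Variables (k : fieldType) (n : nat) (M : lmodType k).
Variable rho : lie_module (@sp_br k n) M.
Implicit Types (i j : 'I_n) (s t : bool) (m v : M) (l : {ffun 'I_n -> k}) (z : k).
Local Notation op := (quad_op rho).
Local Notation p := (pvec k).
Local Notation q := (qvec k).
Local Notation E s i := (op (p s i) (p s i)).
Local Notation F s i := (op (q s i) (q s i)).

Definition commE := (omega_pp, omega_qq, omega_pq, omega_qp).
Definition comm0 := (@scale0r k M, @scale1r k M, @scaleN1r k M, @addr0 M, @add0r M).

Lemma opF_opE s i l m : weightv rho l m ->
  F s i (E s i m) = E s i (F s i m) + (4%:R * ocoord s i l) *: m.
Proof.
move=> hm; rewrite quad_op_comm !commE !comm0 (quad_opC _ (q s i)) (weightv_pq s i hm).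
by rewrite -!scalerDl; congr (_ + _ *: _); ring.
Qed.

Lemma opF_E s i m : F s i m = E (~~ s) i m.
Proof. by case: s; rewrite //= /qvec quad_opNl quad_opNr opprK. Qed.

(* [z] is the shifted Casimir value of the long-root sl_2 of index [i]; it does not depend
   on the orientation. *)
Definition casimir i z l m : Prop :=
  forall s, F s i (E s i m) = ((ocoord s i l + 1) ^+ 2 - z) *: m.

Lemma casimirEF i z l m s : weightv rho l m -> casimir i z l m ->
  E s i (F s i m) = ((ocoord s i l - 1) ^+ 2 - z) *: m.
Proof.
move=> hm /(_ s); rewrite (opF_opE s i hm) => /(canRL (addrK _)) ->.
by rewrite -scalerBl; congr (_ *: _); ring.
Qed.

(** Reversing the orientation exchanges [E] and [F] and negates the coordinate [c]. Since [[F, E] =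
    4 c], the values [(c + 1) ^ 2 - z] of [F E] and [(c - 1) ^ 2 - z] of [E F] determine each
    other. *)
Lemma casimirI i z l m s : weightv rho l m ->
  F s i (E s i m) = ((ocoord s i l + 1) ^+ 2 - z) *: m -> casimir i z l m.
Proof.
move=> hm h t; have [->//|ts] := eqVneq t s.
have {ts} -> : t = ~~ s by clear h; case: t s ts => -[].
rewrite -(opF_E s) opF_E negbK ocoord_neg.
move: h; rewrite (opF_opE s i hm) => /(canRL (addrK _)) ->.
by rewrite -scalerBl; congr (_ *: _); ring.
Qed.

Lemma casimir0 i z l : casimir i z l 0.
Proof. by move=> s; rewrite !linear0. Qed.

(** [E F] on [E m] is [E] applied to [F E m], and the coordinate of [E m] is larger by 2, so the
    same [z] fits: [(c + 2) - 1 = c + 1]. *)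
Lemma casimirE i z s l m : weightv rho l m -> casimir i z l m ->
  casimir i z (l + sgn_delta k s i + sgn_delta k s i) (E s i m).
Proof.
move=> hm hz; apply: (casimirI (s := ~~ s)); first exact: weightv_pp.
rewrite ocoord_neg !ocoordD !ocoord_delta.
rewrite opF_E negbK -(opF_E s) hz linearZ /=; congr (_ *: _); ring.
Qed.

Section Pair.
Variables (i j : 'I_n) (ij : i != j).
Let ji : j != i. Proof. by rewrite eq_sym. Qed.
Variables (s t : bool).
Local Notation p1 := (p s i).
Local Notation q1 := (q s i).
Local Notation p2 := (p t j).
Local Notation q2 := (q t j).
Local Notation E1 := (op p1 p1).
Local Notation F1 := (op q1 q1).
Local Notation E2 := (op p2 p2).
Local Notation F2 := (op q2 q2).
Local Notation A := (op p1 p2).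
Local Notation C1 := (op q1 p2).
Local Notation C2 := (op p1 q2).
Local Notation B := (op q1 q2).
Local Notation x0 := (omega_neq k _ _ ij).
Local Notation y0 := (omega_neq k _ _ ji).
Ltac comm := rewrite quad_op_comm ?x0 ?y0 ?commE ?comm0.

Lemma opE1_A m : E1 (A m) = A (E1 m). Proof. by comm. Qed.
Lemma opE2_A m : E2 (A m) = A (E2 m). Proof. by comm. Qed.
Lemma opE1_E2 m : E1 (E2 m) = E2 (E1 m). Proof. by comm. Qed.
Lemma opE1_F2 m : E1 (F2 m) = F2 (E1 m). Proof. by comm. Qed.
Lemma opF1_A m : F1 (A m) = A (F1 m) + 2%:R *: C1 m.
Proof. by comm; rewrite -mulr2n scaler_nat. Qed.
Lemma opF2_A m : F2 (A m) = A (F2 m) + 2%:R *: C2 m.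
Proof. by comm; rewrite (quad_opC _ q2) -mulr2n scaler_nat. Qed.
(** [A] and [C1] form a doublet under the long-root sl_2 of index [i]. *)
Lemma opC1_E1 m : C1 (E1 m) = E1 (C1 m) + 2%:R *: A m.
Proof. by comm; rewrite (quad_opC _ p2) -mulr2n scaler_nat. Qed.
Lemma opF1_C1 m : F1 (C1 m) = C1 (F1 m). Proof. by comm. Qed.
Lemma opC1_A m : C1 (A m) = A (C1 m) + E2 m. Proof. by comm. Qed.
Lemma opC2_A m : C2 (A m) = A (C2 m) + E1 m. Proof. by comm. Qed.
Lemma opA_B l m : weightv rho l m ->
  A (B m) = B (A m) - (ocoord s i l + ocoord t j l) *: m.
Proof.
move=> hm; comm; rewrite (weightv_pq t j hm) (weightv_pq s i hm).
by rewrite -opprD addrC -scalerDl [_ + ocoord t j l]addrC addrC.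
Qed.
Lemma opE1_B m : E1 (B m) = B (E1 m) - 2%:R *: C2 m.
Proof. by comm; rewrite -opprD -mulr2n scaler_nat. Qed.

End Pair.
End LongRoots.

(** * Casimir values along short roots *)

Section Pointed.
Variables (k : fieldType) (n : nat) (M : lmodType k).
Variable rho : lie_module (@sp_br k n) M.
Hypothesis char0 : [pchar k] =i pred0.
Hypothesis pointed : forall l, exists v, forall m, weightv rho l m -> exists c : k, m = c *: v.
Implicit Types (i j : 'I_n) (s t : bool) (m v : M) (l : {ffun 'I_n -> k}) (z : k).
Local Notation op := (quad_op rho).
Local Notation p := (pvec k).
Local Notation q := (qvec k).
Local Notation E s i := (op (p s i) (p s i)).
Local Notation F s i := (op (q s i) (q s i)).
Local Notation A s i t j := (op (p s i) (p t j)).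
Local Notation C1 s i t j := (op (q s i) (p t j)).

Lemma natr0 (a : nat) : (a%:R == 0 :> k) = (a == 0%N).
Proof. by have /pcharf0P -> := char0. Qed.

Lemma pointed_scal l m m' : weightv rho l m -> weightv rho l m' -> m != 0 ->
  exists c : k, m' = c *: m.
Proof.
move=> hm hm' m0; have [v hv] := pointed l.
have [c cE] := hv _ hm; have [c' c'E] := hv _ hm'.
exists (c' / c); rewrite c'E cE scalerA divfK //.
by apply: contra_neq m0 => c0; rewrite cE c0 scale0r.
Qed.

(** [F E] preserves a weight space of dimension at most one, so it is a scalar on [m]; [casimirI]
    takes care of the other orientation. *)
Lemma ex_casimir i l m : weightv rho l m -> exists z, casimir rho i z l m.
Proof.
move=> hm; have [->|m0] := eqVneq m 0; first by exists 0; apply: casimir0.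
have h : weightv rho l (F true i (E true i m)).
  have := weightv_qq true i true i (weightv_pp true i true i hm).
  by rewrite !addrK.
have [c cE] := pointed_scal hm h m0.
exists ((ocoord true i l + 1) ^+ 2 - c); apply: (casimirI (s := true)) => //.
by rewrite cE; congr (_ *: _); ring.
Qed.

(** Compute [F E A m] in two ways: from the Casimir value of [A m], and by moving [A] to the left,
    which produces [2 C1 E m] besides [A F E m]. *)
Lemma doublet i j s t z z' l m : i != j -> weightv rho l m ->
  casimir rho i z l m ->
  casimir rho i z' (l + sgn_delta k s i + sgn_delta k t j) (A s i t j m) ->
  2%:R *: C1 s i t j (E s i m) = (2%:R * ocoord s i l + 3%:R + z - z') *: A s i t j m.
Proof.
move=> ij hm hz /(_ s); rewrite opE1_A // opF1_A // hz linearZ /=.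
rewrite !ocoordD ocoord_delta ocoord_neq // addr0 => /(canRL (addKr _)) ->.
by rewrite -scaleNr -scalerDl; congr (_ *: _); ring.
Qed.

(** Apply [E F] to both sides of [doublet]. On the left [F] passes through [C1], and moving [E] past
    [C1] brings [doublet] back. In the resulting equation between multiples of [A m] the coordinate
    of the weight cancels. *)
Lemma doublet_eq i j s t z z' l m : i != j -> weightv rho l m ->
  casimir rho i z l m ->
  casimir rho i z' (l + sgn_delta k s i + sgn_delta k t j) (A s i t j m) ->
  A s i t j m != 0 -> (z' - z - 1) ^+ 2 = 4%:R * z.
Proof.
move=> ij hm hz hz' m0; have D := doublet ij hm hz hz'.
have hA := weightv_pp s i t j hm.
have := congr1 (fun x => E s i (F s i x)) D; rewrite !linearZ /=.
rewrite (casimirEF s hA hz') opF1_C1 // hz !linearZ /=.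
have EC : 2%:R *: E s i (C1 s i t j m) =
    (2%:R * ocoord s i l - 1 + z - z') *: A s i t j m.
  rewrite -[E s i _](addrK (2%:R *: A s i t j m)) -opC1_E1 // scalerBr D.
  by rewrite scalerA -scalerBl; congr (_ *: _); ring.
rewrite !ocoordD ocoord_delta ocoord_neq // addr0 EC.
rewrite !scalerA => /eqP; rewrite -subr_eq0 -scalerBl.
rewrite scaler_eq0 (negbTE m0) orbF => /eqP h; apply/eqP; rewrite -subr_eq0; apply/eqP.
by rewrite -[RHS]oppr0 -h; ring.
Qed.

(** [doublet] at [A m] minus [A] applied to [doublet] at [m]: the left sides differ by [2 [C1, A] E
    m], and [[C1, A]] is the long root vector of index [j]. *)
Lemma kappa i j s t z0 z1 z2 l m : i != j -> weightv rho l m ->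
  casimir rho i z0 l m ->
  casimir rho i z1 (l + sgn_delta k s i + sgn_delta k t j) (A s i t j m) ->
  casimir rho i z2 (l + sgn_delta k s i + sgn_delta k t j + sgn_delta k s i + sgn_delta k t j)
     (A s i t j (A s i t j m)) ->
  2%:R *: E s i (E t j m) = (2%:R - (z2 - z1) + (z1 - z0)) *: A s i t j (A s i t j m).
Proof.
move=> ij hm h0 h1 h2; have hA := weightv_pp s i t j hm.
have := doublet ij hA h1 h2; have := doublet ij hm h0 h1.
move=> D0; rewrite opE1_A // opC1_A // scalerDr -linearZ /= D0 linearZ /=.
rewrite -opE1_E2 // => /(canRL (addKr _)) ->.
rewrite -scaleNr -scalerDl !ocoordD ocoord_delta ocoord_neq // addr0.
by congr (_ *: _); ring.
Qed.

Lemma kappa_ex i j s t l m : i != j -> weightv rho l m ->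
  exists c : k, E s i (E t j m) = c *: A s i t j (A s i t j m).
Proof.
move=> ij hm; have hA := weightv_pp s i t j hm; have hAA := weightv_pp s i t j hA.
have [z0 h0] := ex_casimir i hm; have [z1 h1] := ex_casimir i hA.
have [z2 h2] := ex_casimir i hAA; have := kappa ij hm h0 h1 h2.
move/(congr1 ( *:%R (2%:R^-1 : k))); rewrite !scalerA mulVf ?natr0 // scale1r => ->.
by eexists.
Qed.

Lemma casimir_dichotomy i j s t z l m : i != j -> weightv rho l m ->
  casimir rho i z l m ->
  A s i t j (A s i t j (A s i t j m)) != 0 ->
  E s i (E t j m) = 0 \/ 4%:R * z = 1.
Proof.
move=> ij hm h0 n3.
have n2 : A s i t j (A s i t j m) != 0 by apply: contra_neq n3 => ->; rewrite linear0.
have n1 : A s i t j m != 0 by apply: contra_neq n2 => ->; rewrite linear0.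
have hA := weightv_pp s i t j hm; have hAA := weightv_pp s i t j hA.
have hAAA := weightv_pp s i t j hAA.
have [z1 h1] := ex_casimir i hA.
have [z2 h2] := ex_casimir i hAA; have [z3 h3] := ex_casimir i hAAA.
have K0 := kappa ij hm h0 h1 h2; have K1 := kappa ij hA h1 h2 h3.
have e0 := doublet_eq ij hm h0 h1 n1; have e1 := doublet_eq ij hA h1 h2 n2.
(* Both long root vectors commute with [A], so the coefficients of [kappa] at [m] and at [A m]
   coincide: the two second differences of the Casimir values are equal. *)
have := congr1 (A s i t j) K0; rewrite !linearZ /= -opE1_A // -opE2_A // K1.
move/eqP; rewrite -subr_eq0 -scalerBl scaler_eq0 (negbTE n3) orbF => /eqP e2.
have two0 : (2%:R : k) != 0 by rewrite natr0.
set d0 := z1 - z; set d1 := z2 - z1; set d2 := z3 - z2.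
have ed : d2 - d1 = d1 - d0.
  by apply/eqP; rewrite -subr_eq0; apply/eqP; rewrite -[RHS]oppr0 -e2 /d0 /d1 /d2; ring.
(* A second difference of 2 is exactly what makes the coefficient in [kappa] vanish. *)
have [dd|dd] := eqVneq (d1 - d0) 2%:R.
  left; apply: (scalerI two0); rewrite K0 scaler0.
  have -> : 2%:R - (z2 - z1) + (z1 - z) = 0 by rewrite -/d0 -/d1 -dd; ring.
  by rewrite scale0r.
right.
(* Consecutive instances of [doublet_eq] subtract to [(d0 + d1) (d1 - d0 - 2) = 0]. *)
have s1 : d0 + d1 = 0.
  apply/eqP; have : (d0 + d1) * (d1 - d0 - 2%:R) = 0.
    have : (z2 - z1 - 1) ^+ 2 - ((z1 - z - 1) ^+ 2 + 4%:R * (z1 - z)) = 0.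
      by rewrite e0 e1; ring.
    by move=> <-; rewrite /d0 /d1; ring.
  by move/eqP; rewrite mulf_eq0 subr_eq0 (negbTE dd) orbF.
have e3 := doublet_eq ij hAA h2 h3 n3.
have s2 : d1 + d2 = 0.
  apply/eqP; have : (d1 + d2) * (d2 - d1 - 2%:R) = 0.
    have : (z3 - z2 - 1) ^+ 2 - ((z2 - z1 - 1) ^+ 2 + 4%:R * (z2 - z1)) = 0.
      by rewrite e1 e3; ring.
    by move=> <-; rewrite /d1 /d2; ring.
  by move/eqP; rewrite mulf_eq0 subr_eq0 ed (negbTE dd) orbF.
(* Two vanishing sums and equal second differences leave only [d0 = 0], and then [doublet_eq] reads
   [1 = 4 z]. *)
have d00 : d0 = 0.
  have : 4%:R * d0 = 0.
    have -> : 4%:R * d0 = 3%:R * (d0 + d1) - (d1 + d2) + ((d2 - d1) - (d1 - d0)) by ring.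
    by rewrite ed s1 s2; ring.
  by move/eqP; rewrite mulf_eq0 natr0 => /eqP.
by rewrite -e0 -/d0 d00; ring.
Qed.

End Pointed.

(** * Local nilpotency and strings of the long-root sl_2 *)

Section Nilpotent.
Variables (k : fieldType) (n : nat) (M : lmodType k).
Variable rho : lie_module (@sp_br k n) M.
Implicit Types (x y : sp k n) (m : M).

Definition injective_at (f : M -> M) : Prop := forall m, f m = 0 -> m = 0.
Definition loc_nilpotent (f : M -> M) : Prop := forall m, exists r, iter r f m = 0.

Lemma iter_lact_linear x r : linear (iter r (rho x)).
Proof. by elim: r => [|r IHr] c m m' //=; rewrite IHr lact_linearr. Qed.
Lemma lactr0 x : rho x 0 = 0.
Proof.
by have := lact_linearr rho x (-1) 0 0; rewrite scaler0 addr0 scaleN1r addNr.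
Qed.
Lemma iter_lact0 x r : iter r (rho x) 0 = 0.
Proof. by elim: r => //= r ->; apply: lactr0. Qed.
Lemma iter_lactD x r m m' : iter r (rho x) (m + m') = iter r (rho x) m + iter r (rho x) m'.
Proof. by have := iter_lact_linear x r 1 m m'; rewrite !scale1r. Qed.

Lemma iter_lact_nil x r r' m : (r <= r')%N -> iter r (rho x) m = 0 -> iter r' (rho x) m = 0.
Proof. by move=> /subnK <- h; rewrite iterD h iter_lact0. Qed.

Lemma lact_comm x y m : rho x (rho y m) = rho y (rho x m) + rho (sp_br x y) m.
Proof. by rewrite lact_br addrC subrK. Qed.

Lemma iter_lact_br0 x y r m : sp_br x y = 0 ->
  iter r (rho x) (rho y m) = rho y (iter r (rho x) m).
Proof.
by move=> xy; elim: r => //= r ->; rewrite lact_comm xy lact0 addr0.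
Qed.

Lemma iter_lact_br1 x y r m : sp_br x (sp_br x y) = 0 ->
  iter r (rho x) m = 0 -> iter r.+1 (rho x) (rho y m) = 0.
Proof.
move=> xxy; elim: r m => [|r IHr] m hm; first by rewrite /= in hm *; rewrite hm !lactr0.
rewrite iterSr lact_comm iter_lactD IHr -?iterSr // add0r iter_lact_br0 //.
by rewrite hm lactr0.
Qed.

Lemma iter_lact_br2 x y r m : sp_br x (sp_br x (sp_br x y)) = 0 ->
  iter r (rho x) m = 0 -> iter r.+2 (rho x) (rho y m) = 0.
Proof.
move=> xxy; elim: r m => [|r IHr] m hm; first by rewrite /= in hm *; rewrite hm !lactr0.
by rewrite iterSr lact_comm iter_lactD IHr -?iterSr // add0r iter_lact_br1.
Qed.

(** A matrix with [x ^ 2 = 0] has [ad x ^ 3 = 0], so by the Leibniz rule the vectors killed by some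
    power of [x] form a submodule, to which simplicity applies. *)
Lemma inj_or_nil x : simple_module rho -> (x : 'M_(n + n)) *m x = 0 ->
  injective_at (rho x) \/ loc_nilpotent (rho x).
Proof.
move=> [_ simple] xx.
have br3 y : sp_br x (sp_br x (sp_br x y)) = 0.
  have L (Z : 'M_(n + n)) : (x : 'M_(n + n)) *m (x *m Z) = 0.
    by rewrite mulmxA xx mul0mx.
  apply: val_inj; rewrite /= !(mulmxBl, mulmxBr) -!mulmxA !L xx ?mulmx0.
  by rewrite ?(subr0, sub0r, oppr0, opprK, addr0).
case: (simple (fun m => exists r, iter r (rho x) m = 0)).
- by exists 0%N.
- move=> c m m' [r hr] [r' hr']; exists (r + r')%N.
  rewrite iter_lact_linear (iter_lact_nil _ hr) ?leq_addr // scaler0 add0r.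
  by rewrite (iter_lact_nil _ hr') ?leq_addl.
- by move=> y m [r hr]; exists r.+2; apply: iter_lact_br2.
- by move=> h; left=> m hm; apply: h; exists 1%N.
- by right.
Qed.

End Nilpotent.

Section Strings.
Variables (k : fieldType) (n : nat) (M : lmodType k).
Variable rho : lie_module (@sp_br k n) M.
Hypothesis char0 : [pchar k] =i pred0.
Hypothesis pointed : forall l, exists v, forall m, weightv rho l m -> exists c : k, m = c *: v.
Implicit Types (i j : 'I_n) (s t : bool) (m v : M) (l : {ffun 'I_n -> k}) (z : k).
Local Notation op := (quad_op rho).
Local Notation p := (pvec k).
Local Notation E s i := (op (p s i) (p s i)).

Lemma natr_inj (a b : nat) : a%:R = b%:R :> k -> a = b.
Proof.
wlog ab : a b / (a <= b)%N => [W h|/eqP].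
  by case/orP: (leq_total a b) => ab; [apply: W | apply/esym/W].
rewrite eq_sym -subr_eq0 -natrB // natr0 // subn_eq0 => ba.
by apply/eqP; rewrite eqn_leq ab.
Qed.

Lemma opE_inj_or_nil s i : simple_module rho ->
  injective_at (E s i) \/ loc_nilpotent (E s i).
Proof.
move=> simple; apply: inj_or_nil => //=.
rewrite !mulNmx !mulmxN opprK !mulmxDl !mulmxDr !form_rank1 omega_pp.
by rewrite oppr0 scale0r !addr0.
Qed.

(** [z] is constant along the string, and at its last nonzero vector [F E = 0] expresses it by the
    coordinate there; [r] counts the steps to that vector, each adding 2. *)
Lemma nil_top s i l m z : loc_nilpotent (E s i) -> weightv rho l m -> m != 0 ->
  casimir rho i z l m -> exists r : nat, z = (ocoord s i l + r.*2%:R + 1) ^+ 2.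
Proof.
move=> /(_ m)[r]; elim: r l m => [|r IHr] l m; first by move=> /= -> _; rewrite eqxx.
rewrite iterSr => hr hm m0 hz; have [E0|E0] := eqVneq (E s i m) 0.
  exists 0%N; rewrite addr0; have := hz s; rewrite E0 linear0 => /esym/eqP.
  by rewrite scaler_eq0 (negbTE m0) orbF subr_eq0 => /eqP.
have [r' ->] := IHr _ _ hr (weightv_pp s i s i hm) E0 (casimirE s hm hz).
by exists r'.+1; rewrite !ocoordD !ocoord_delta -!muln2 !natrM -natr1; ring.
Qed.

(** [a] and [b] count the steps to the lower and to the upper end of the string, so [a + b] is its
    highest weight. *)
Lemma nil_weight i l m z : (forall s, loc_nilpotent (E s i)) -> weightv rho l m ->
  m != 0 -> casimir rho i z l m ->
  exists a b : nat, ocoord true i l = a%:R - b%:R /\ z = (a + b).+1%:R ^+ 2.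
Proof.
move=> hn hm m0 hz; have [a ha] := nil_top (hn true) hm m0 hz.
have [b hb] := nil_top (hn false) hm m0 hz.
rewrite -[false]/(~~ true) ocoord_neg in hb.
set c := ocoord true i l in ha hb *; have two0 : (2%:R : k) != 0 by rewrite natr0.
(* The two expressions for [z], from the two ends, differ by the product of [2 (c - (b - a))] and
   [2 (a + b + 1)]; the second factor is nonzero in characteristic zero. *)
have cE : c = b%:R - a%:R.
  have : (2%:R * (c - (b%:R - a%:R))) * (2%:R * (a + b).+1%:R) = 0.
    have <- : (c + a.*2%:R + 1) ^+ 2 - (- c + b.*2%:R + 1) ^+ 2 = 0.
      by rewrite -ha -hb subrr.
    by rewrite -!muln2 !natrM -addn1 !natrD; ring.
  move/eqP; rewrite !mulf_eq0 (negbTE two0) natr0 //= orbF subr_eq0 => /eqP //.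
exists b, a; split=> //.
by rewrite ha cE -natr1 natrD -muln2 natrM; ring.
Qed.

Lemma sq_top s i l m z : E s i (E s i m) = 0 -> weightv rho l m -> m != 0 ->
  casimir rho i z l m ->
  z = (ocoord s i l + 1) ^+ 2 \/ z = (ocoord s i l + 3%:R) ^+ 2.
Proof.
have top l' m' : E s i m' = 0 -> m' != 0 -> casimir rho i z l' m' ->
    z = (ocoord s i l' + 1) ^+ 2.
  move=> E0 m0 /(_ s); rewrite E0 linear0 => /esym/eqP.
  by rewrite scaler_eq0 (negbTE m0) orbF subr_eq0 => /eqP.
move=> EE hm m0 hz; have [E0|E0] := eqVneq (E s i m) 0; first by left; apply: top hz.
right; rewrite (top _ _ EE E0 (casimirE s hm hz)) !ocoordD !ocoord_delta; ring.
Qed.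

(* [c] is -1, 0 or 1. *)
Definition small (c : k) : Prop := exists2 e : nat, (e <= 2)%N & c = e%:R - 1.

Lemma small_neg c : small c -> small (- c).
Proof.
move=> [e he ->]; exists (2 - e)%N; first exact: leq_subr.
by rewrite natrB //; ring.
Qed.

Lemma sq_small i l m : weightv rho l m -> m != 0 ->
  (forall s, E s i (E s i m) = 0) -> forall s, small (ocoord s i l).
Proof.
move=> hm m0 hE; have [z hz] := ex_casimir pointed i hm.
suff : small (ocoord true i l) => [h [|]//|].
  by rewrite -[false]/(~~ true) ocoord_neg; apply: small_neg.
have := sq_top (hE false) hm m0 hz; have := sq_top (hE true) hm m0 hz.
rewrite -[false]/(~~ true) ocoord_neg; set c := ocoord true i l.
(* Of the four comparisons of squares two reduce to [4 c = 0] and [12 c = 0], whence the arguments 3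
   and 11 below; the other two give [c = 1] and [c = -1]. *)
have aux (d : nat) (a b : k) : a = b -> (d.+1)%:R * c - (a - b) = 0 -> c = 0.
  move=> -> /eqP; rewrite subrr subr0 mulf_eq0 natr0 // => /eqP //.
case=> -> [|] h.
- exists 1%N => //; rewrite subrr; apply: (aux 3 _ _ h); ring.
- exists 2%N => //; apply/eqP; rewrite -subr_eq0; apply/eqP.
  have : 8%:R * (c - 1) = 0.
    have -> : 8%:R * (c - 1) = (c + 1) ^+ 2 - (- c + 3%:R) ^+ 2 by ring.
    by rewrite h subrr.
  move/eqP; rewrite mulf_eq0 natr0 //= => /eqP <-; ring.
- exists 0%N => //; apply/eqP; rewrite -subr_eq0; apply/eqP.
  have : 8%:R * (c + 1) = 0.
    have -> : 8%:R * (c + 1) = (c + 3%:R) ^+ 2 - (- c + 1) ^+ 2 by ring.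
    by rewrite h subrr.
  move/eqP; rewrite mulf_eq0 natr0 //= => /eqP <-; ring.
- exists 1%N => //; rewrite subrr; apply: (aux 11 _ _ h); ring.
Qed.

End Strings.

(** * Bounding a coordinate by short-root strings *)

Section StringBound.
Variables (k : fieldType) (n : nat) (M : lmodType k).
Variable rho : lie_module (@sp_br k n) M.
Hypothesis char0 : [pchar k] =i pred0.
Implicit Types (i j : 'I_n) (s t : bool) (m v : M) (l : {ffun 'I_n -> k}) (z : k).
Local Notation op := (quad_op rho).
Local Notation p := (pvec k).
Local Notation q := (qvec k).
Local Notation A s i t j := (op (p s i) (p t j)).
Local Notation B s i t j := (op (q s i) (q t j)).
Local Notation dl s i := (sgn_delta k s i).

Lemma small_shift (c : k) (e : nat) : small c -> small (c + e%:R) -> (e <= 2)%N.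
Proof.
move=> [a ha ->] [b hb] h; have : (a + e)%:R = b%:R :> k.
  by apply: (addIr (-1)); rewrite natrD addrAC h.
by move/(natr_inj char0) => ab; apply: leq_trans hb; rewrite -ab leq_addl.
Qed.

(* [A = T(p_i, p_j)] and [B = T(q_i, q_j)] span an sl_2 with their bracket: a highest vector
   of large weight has a long [B]-string, along which the [j]-th coordinate varies. *)
Lemma sl2_string_bound i j s t l m : i != j -> weightv rho l m -> m != 0 ->
  (forall l' m' (a b : nat), (a <= 3)%N -> (b <= 3)%N ->
     ocoord s i l' = ocoord s i l + a%:R - b%:R ->
     weightv rho l' m' -> m' != 0 -> small (ocoord t j l')) ->
  exists a b : nat, [/\ (a <= 9)%N, (b <= 9)%N & ocoord s i l = a%:R - b%:R].
Proof.
move=> ij hm m0 hs; have ji : j != i by rewrite eq_sym.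
have [r [w [lw [hw w0 Aw oi oj]]]] : exists r w lw,
    [/\ weightv rho lw w, w != 0, A s i t j w = 0,
        ocoord s i lw = ocoord s i l + r%:R & (r <= 2)%N /\ ocoord t j lw = ocoord t j l + r%:R].
  (* Each application of [A] raises both coordinates by one. The second one has to stay in {-1, 0,
     1}, so [A ^ 3 m = 0], and [w] is the last nonzero vector. *)
  have str r l' m' : weightv rho l' m' -> m' != 0 ->
      ocoord s i l' = ocoord s i l + r%:R -> ocoord t j l' = ocoord t j l + r%:R -> (r <= 2)%N ->
      A s i t j m' != 0 -> exists l'', [/\ weightv rho l'' (A s i t j m'),
         ocoord s i l'' = ocoord s i l + r.+1%:R, ocoord t j l'' = ocoord t j l + r.+1%:R
         & (r.+1 <= 2)%N].
    move=> h1 h2 h3 h4 h5 h6; exists (l' + dl s i + dl t j).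
    have o1 : ocoord s i (l' + dl s i + dl t j) = ocoord s i l + r.+1%:R.
      by rewrite !ocoordD ocoord_delta ocoord_neq // h3 -natr1; ring.
    have o2 : ocoord t j (l' + dl s i + dl t j) = ocoord t j l + r.+1%:R.
      by rewrite !ocoordD ocoord_delta ocoord_neq // h4 -natr1; ring.
    have hA := weightv_pp s i t j h1; split=> //.
    have sm0 : small (ocoord t j l) by apply: (hs l m 0%N 0%N) => //; rewrite addr0 subr0.
    apply: (small_shift sm0); rewrite -o2; apply: (hs _ _ r.+1 0%N _ _ _ hA h6) => //.
    by rewrite subr0.
  have [A1|A1] := eqVneq (A s i t j m) 0; first by exists 0%N, m, l; rewrite !addr0.
  have [|||l1 [h1 o1 o1' _]] := str 0%N l m hm m0 _ _ _ A1; rewrite ?addr0 //.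
  have [A2|A2] := eqVneq (A s i t j (A s i t j m)) 0.
    by exists 1%N, (A s i t j m), l1.
  have [l2 [h2 o2 o2' _]] := str 1%N _ _ h1 A1 o1 o1' isT A2.
  have [A3|A3] := eqVneq (A s i t j (A s i t j (A s i t j m))) 0.
    by exists 2%N, (A s i t j (A s i t j m)), l2.
  by have [l3 []] := str 2%N _ _ h2 A2 o2 o2' isT A3.
case: oj => r2 oj.
have smw : small (ocoord t j lw).
  apply: (hs lw w r 0%N) => //; last by rewrite subr0.
  exact: leq_trans r2 _.
set h := ocoord s i lw + ocoord t j lw.
have hB1 := weightv_qq s i t j hw; have hB2 := weightv_qq s i t j hB1.
have hB3 := weightv_qq s i t j hB2.
(* The usual sl_2 computation from a highest vector: [A B ^ r w = - r (h - r + 1) B ^ (r - 1) w],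
   needed for [r] up to 3. *)
have AB1 : A s i t j (B s i t j w) = - h *: w.
  by rewrite (opA_B ij s t hw) Aw linear0 sub0r scaleNr.
have AB2 : A s i t j (B s i t j (B s i t j w)) = - (2%:R * (h - 1)) *: B s i t j w.
  rewrite (opA_B ij s t hB1) AB1 linearZ /= -scalerBl; congr (_ *: _).
  rewrite /h !ocoordD !ocoordN !ocoord_delta !ocoord_neq //; ring.
have AB3 : A s i t j (B s i t j (B s i t j (B s i t j w))) =
    - (3%:R * (h - 2%:R)) *: B s i t j (B s i t j w).
  rewrite (opA_B ij s t hB2) AB2 linearZ /= -scalerBl; congr (_ *: _).
  rewrite /h !ocoordD !ocoordN !ocoord_delta !ocoord_neq //; ring.
have B3 : B s i t j (B s i t j (B s i t j w)) = 0.
  apply/eqP/negPn/negP => n3.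
  have : small (ocoord t j lw - 3%:R).
    have := hs _ _ r 3%N (leq_trans r2 _) isT _ hB3 n3.
    rewrite !ocoordD !ocoordN !ocoord_delta !ocoord_neq // oi => /(_ isT) h'.
    have -> : ocoord t j lw - 3%:R = ocoord t j lw - 0 - 1 - 0 - 1 - 0 - 1 by ring.
    by apply: h'; ring.
  by move=> sm3; have := @small_shift _ 3 sm3; rewrite subrK => /(_ smw).
(* If [B ^ r w] is the first power to vanish, the coefficient [r (h - r + 1)] is zero, so
   [h = r - 1]. *)
have [e e2 he] : exists2 e : nat, (e <= 2)%N & h = e%:R.
  have aux (c : k) (u v : M) : u = c *: v -> u = 0 -> v != 0 -> c = 0.
    by move=> -> /eqP; rewrite scaler_eq0 => /orP[/eqP//|/eqP->]; rewrite eqxx.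
  have [B1|B1] := eqVneq (B s i t j w) 0.
    exists 0%N => //; apply: oppr_inj; rewrite oppr0; apply: (aux _ _ _ AB1) => //.
    by rewrite B1 linear0.
  have [B2|B2] := eqVneq (B s i t j (B s i t j w)) 0.
    have /eqP := aux _ _ _ AB2 (etrans (congr1 _ B2) (linear0 _)) B1.
    rewrite oppr_eq0 mulf_eq0 natr0 //= subr_eq0 => /eqP hE.
    by exists 1%N.
  have /eqP := aux _ _ _ AB3 (etrans (congr1 _ B3) (linear0 _)) B2.
  rewrite oppr_eq0 mulf_eq0 natr0 //= subr_eq0 => /eqP hE.
  by exists 2%N.
have [f f2 hf] := smw.
(* The coordinate of [l] is [h] minus the second coordinate [f - 1] of [w], minus the [r] steps
   made. The common bound 9 is a round figure that covers both numbers. *)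
exists (e + 1)%N, (f + r)%N; split.
- by rewrite addn1; apply: leq_trans (_ : 3 <= 9)%N.
- by apply: leq_trans (leq_add f2 r2) _.
have -> : ocoord s i l = h - ocoord t j lw - r%:R by rewrite /h oi; ring.
by rewrite he hf !natrD; ring.
Qed.

End StringBound.

(** * The two cases: some long root vector injective, or all locally nilpotent *)

Section Cases.
Variables (k : fieldType) (n : nat) (M : lmodType k).
Variable rho : lie_module (@sp_br k n) M.
Hypothesis char0 : [pchar k] =i pred0.
Hypothesis pointed : forall l, exists v, forall m, weightv rho l m -> exists c : k, m = c *: v.
Hypothesis simple : simple_module rho.
Implicit Types (i j : 'I_n) (s t : bool) (m v : M) (l : {ffun 'I_n -> k}) (z : k).
Local Notation op := (quad_op rho).
Local Notation p := (pvec k).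
Local Notation q := (qvec k).
Local Notation E s i := (op (p s i) (p s i)).
Local Notation F s i := (op (q s i) (q s i)).
Local Notation A s i t j := (op (p s i) (p t j)).
Local Notation B s i t j := (op (q s i) (q t j)).
Local Notation dl s i := (sgn_delta k s i).

Lemma opEE_AAAA i j s t l m : i != j -> weightv rho l m -> exists c : k,
  E s i (E t j m) = c *: A s i t j (A s i t j m) /\
  E s i (E s i (E t j (E t j m))) = c ^+ 2 *: A s i t j (A s i t j (A s i t j (A s i t j m))).
Proof.
move=> ij hm; have [c hc] := kappa_ex char0 pointed s t ij hm.
exists c; split=> //; rewrite [E s i (E t j (E t j m))]opE1_E2 // hc !linearZ /=.
by rewrite !(opE2_A rho ij s t) !(opE1_A rho ij s t) hc !linearZ /= scalerA expr2.
Qed.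

(** By [opEE_AAAA] the hypothesis gives [A ^ 3 m <> 0], and it gives [E_i E_j m <> 0], which
    excludes the first alternative of [casimir_dichotomy]. *)
Lemma opEE_casimir i j s t l m z : i != j -> weightv rho l m ->
  E s i (E s i (E t j (E t j m))) != 0 -> casimir rho i z l m -> 4%:R * z = 1.
Proof.
move=> ij hm n0 hz; have [c [h1 h2]] := opEE_AAAA s t ij hm.
have n2 : E s i (E t j m) != 0.
  by apply: contra_neq n0 => e0; rewrite [E s i (E t j (E t j m))]opE1_E2 // e0 !linear0.
have n3 : A s i t j (A s i t j (A s i t j m)) != 0.
  by apply: contra_neq n0 => e0; rewrite h2 e0 linear0 scaler0.
by case: (casimir_dichotomy char0 pointed ij hm hz n3) => // /eqP; rewrite (negbTE n2).
Qed.

Lemma opEE_sym i j s t m : i != j ->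
  E s i (E s i (E t j (E t j m))) = E t j (E t j (E s i (E s i m))).
Proof. by move=> ij; rewrite !(opE1_E2 rho ij s t). Qed.

Lemma quarter_not_sq (a : nat) : 4%:R * (a.+1%:R ^+ 2) != 1 :> k.
Proof.
rewrite -natrX -natrM; apply/eqP => h.
by have := natr_inj char0 (h : _ = 1%:R); rewrite expnS mulnA; case: a {h} => //= a; rewrite !mulnS.
Qed.

Section Injective.
Variables (i : 'I_n) (s : bool).
Hypothesis inj : injective_at (E s i).

Let injn m : m != 0 -> E s i m != 0.
Proof. by apply: contra_neq => /inj. Qed.

Lemma inj_casimir j t l m : i != j -> weightv rho l m -> E t j (E t j m) != 0 ->
  (forall z, casimir rho i z l m -> 4%:R * z = 1) /\
  (forall z, casimir rho j z l m -> 4%:R * z = 1).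
Proof.
move=> ij hm n0; have n1 := injn (injn n0); split=> z hz.
  exact: opEE_casimir ij hm n1 hz.
have ji : j != i by rewrite eq_sym.
by apply: (opEE_casimir ji hm _ hz (s := t) (t := s)); rewrite -opEE_sym.
Qed.

(** Otherwise [sq_small] makes the coordinate [j] of every weight small, and [sl2_string_bound] then
    confines the coordinate [i] to a bounded range; but the injective [E s i] moves it without
    limit. *)
Lemma inj_ex_sq j l m : i != j -> weightv rho l m -> m != 0 ->
  exists t l' m', weightv rho l' m' /\ E t j (E t j m') != 0.
Proof.
move=> ij hm m0; apply: contrapT => no.
have sm t l' m' : weightv rho l' m' -> m' != 0 -> small (ocoord t j l').
  move=> h' n'; apply: (sq_small char0 pointed h' n') => u.
  apply/eqP/negPn/negP => n2; apply: no; by exists u, l', m'.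
have bd l' m' : weightv rho l' m' -> m' != 0 ->
    exists a b : nat, [/\ (a <= 9)%N, (b <= 9)%N & ocoord s i l' = a%:R - b%:R].
  move=> h' n'; apply: (sl2_string_bound (t := true) char0 ij h' n').
  by move=> l'' m'' a b _ _ _; apply: sm.
have itE r : exists l', [/\ weightv rho l' (iter r (E s i) m), iter r (E s i) m != 0
    & ocoord s i l' = ocoord s i l + r.*2%:R].
  elim: r => [|r [l' [h' n' o']]]; first by exists l; rewrite addr0.
  exists (l' + dl s i + dl s i); split; first exact: weightv_pp.
    exact: injn.
  by rewrite !ocoordD ocoord_delta o' -!muln2 !natrM -natr1; ring.
(* Twenty steps shift the coordinate by 40, more than the 18 that two numbers bounded by 9 allow. *)
have [l' [h' n' o']] := itE 20.
have [a [b [a9 b9 hab]]] := bd _ _ hm m0; have [a' [b' [a9' b9' hab']]] := bd _ _ h' n'.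
have : (a + b' + 20.*2)%:R = (a' + b)%:R :> k.
  rewrite !natrD; have -> : a%:R = ocoord s i l + b%:R :> k by rewrite hab subrK.
  have -> : a'%:R = ocoord s i l' + b'%:R :> k by rewrite hab' subrK.
  by rewrite o'; ring.
move/(natr_inj char0) => e; have := leq_add a9' b9; rewrite -e => /(leq_trans (leq_addl _ _)).
by [].
Qed.

(** If both orientations at [j] were locally nilpotent, the Casimir value would be the square of a
    positive integer, whereas the vector found by [inj_ex_sq] has [4 z = 1]. *)
Lemma inj_all j l m : weightv rho l m -> m != 0 -> exists t, injective_at (E t j).
Proof.
move=> hm m0; have [<-|ij] := eqVneq i j; first by exists s.
have [t [l' [m' [h' n2]]]] := inj_ex_sq ij hm m0.
apply: contrapT => no; have [z hz] := ex_casimir pointed j h'.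
have [_ /(_ _ hz) z1] := inj_casimir ij h' n2.
have n' : m' != 0 by apply: contra_neq n2 => ->; rewrite !linear0.
have [|a [b [_ zE]]] := nil_weight char0 _ h' n' hz.
  by move=> u; case: (opE_inj_or_nil u j simple) => // hi; case: no; exists u.
by have := quarter_not_sq (a + b); rewrite -zE z1 eqxx.
Qed.

Lemma inj_casimir_quarter j l m : (exists j, i != j) ->
  weightv rho l m -> casimir rho j (4%:R^-1) l m.
Proof.
move=> [j0 ij0] hm; have [->|m0] := eqVneq m 0; first exact: casimir0.
have q4 z : 4%:R * z = 1 -> z = 4%:R^-1.
  move=> h; apply: (mulfI (_ : (4%:R : k) != 0)); first by rewrite natr0.
  by rewrite h divff // natr0.
have sq j' : exists t, E t j' (E t j' m) != 0.
  have [t it] := inj_all j' hm m0; exists t.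
  by apply: contra_neq m0 => /it/it.
have [z hz] := ex_casimir pointed j hm; rewrite -(q4 z) //.
move: hz; have [<-|ij] := eqVneq i j => hz.
  by have [t h2] := sq j0; have [h _] := inj_casimir ij0 hm h2; apply: h hz.
by have [t h2] := sq j; have [_ h] := inj_casimir ij hm h2; apply: h hz.
Qed.

Hypothesis quarter : forall j l m, weightv rho l m -> casimir rho j (4%:R^-1) l m.

(** For constant Casimir value [kappa] becomes [E_i E_j = A ^ 2]. This determines the image of [A m]
    under [T(p_i, q_j)], then [E_i B A m], and [E_i] can be cancelled since it is injective. *)
Lemma inj_BA j t l m : i != j -> weightv rho l m ->
  B s i t j (A s i t j m) =
  ((ocoord s i l + 2%:R^-1) * (ocoord t j l + 2%:R^-1)) *: m.
Proof.
move=> ij hm; have ji : j != i by rewrite eq_sym.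
have two0 : (2%:R : k) != 0 by rewrite natr0.
have four0 : (4%:R : k) != 0 by rewrite natr0.
have EE l' m' : weightv rho l' m' -> E s i (E t j m') = A s i t j (A s i t j m').
  move=> h'; have hA := weightv_pp s i t j h'; have hAA := weightv_pp s i t j hA.
  have := kappa ij h' (quarter i h') (quarter i hA) (quarter i hAA).
  by rewrite !subrr subr0 addr0 => /(scalerI two0).
have hF := weightv_qq t j t j hm.
(* Apply [F_j] to [E_i E_j m = A ^ 2 m] and commute it to the right on both sides. *)
have C2A : op (p s i) (q t j) (A s i t j m) = (ocoord t j l + 2%:R^-1) *: E s i m.
  have := congr1 (F t j) (EE _ _ hm).
  rewrite -opE1_F2 // (quarter j hm) linearZ /= !opF2_A // linearD linearZ /=.
  rewrite -(EE _ _ hF) (casimirEF t hm (quarter j hm)).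
  rewrite linearZ /= opC2_A // => h; apply: (scalerI four0).
  move: (A s i t j _) (E s i m) h => u v h.
  have {}h : 4%:R *: u + 2%:R *: v = (4%:R * ocoord t j l) *: v.
    pose a := (ocoord t j l + 1) ^+ 2 - 4%:R^-1 : k.
    pose b := (ocoord t j l - 1) ^+ 2 - 4%:R^-1 : k.
    have -> : 4%:R * ocoord t j l = a - b by rewrite /a /b; ring.
    rewrite scalerBl h -/b -[b *: v + _ + _]addrA [RHS]addrC addKr scalerDr addrA -scalerDl.
    by congr (_ *: _ + _); ring.
  rewrite scalerDr -[4%:R *: u](addrK (2%:R *: v)) h -scalerBl -scalerDl scalerA.
  by congr (_ *: _); field.
have hA := weightv_pp s i t j hm.
(* This is [doublet] with the orientation of [j] reversed; there [p] is [q] up to a sign that occurs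
   on both sides. *)
have D l' m' : weightv rho l' m' ->
    2%:R *: B s i t j (E s i m') = (2%:R * ocoord s i l' + 3%:R) *: op (p s i) (q t j) m'.
  move=> h'; have h2 := weightv_pp s i (~~ t) j h'.
  have := doublet ij h' (quarter i h') (quarter i h2); rewrite addrK.
  by case: (t) => //= h; rewrite !quad_opNr !scalerN h.
apply/eqP; rewrite -subr_eq0; apply/eqP/inj; rewrite linearB linearZ /=.
apply: (scalerI two0); rewrite scaler0 scalerBr opE1_B // scalerBr (D _ _ hA) C2A.
rewrite !scalerA -!scalerBl !ocoordD ocoord_delta ocoord_neq //.
by rewrite [X in X *: _](_ : _ = 0) ?scale0r //; field.
Qed.

End Injective.

Section AllNilpotent.
Hypothesis nil : forall s i, loc_nilpotent (E s i).

(** A nonzero value would give [4 z = 1], while local nilpotency makes [z] the square of a positive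
    integer. *)
Lemma nil_EE0 i j s t l m : i != j -> weightv rho l m ->
  E s i (E s i (E t j (E t j m))) = 0.
Proof.
move=> ij hm; apply/eqP/negPn/negP => n0.
have [z hz] := ex_casimir pointed i hm; have z4 := opEE_casimir ij hm n0 hz.
have m0 : m != 0 by apply: contra_neq n0 => ->; rewrite !linear0.
have [a [b [_ zE]]] := nil_weight char0 (fun u => nil u i) hm m0 hz.
by have := quarter_not_sq (a + b); rewrite -zE z4 eqxx.
Qed.

(** In a locally finite representation of sl_2 a vector of weight [N >= 2] survives two lowering
    steps. As [nil_EE0] kills [F_i ^ 2 E_j ^ 2 m], already [E_j ^ 2 m = 0] in both orientations of
    [j], and [sq_small] applies. *)
Lemma nil_small i j s t l m (N : nat) : i != j -> weightv rho l m -> m != 0 ->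
  ocoord s i l = N%:R -> (2 <= N)%N -> small (ocoord t j l).
Proof.
move=> ij hm m0 oN N2; apply: (sq_small char0 pointed hm m0) => u.
apply/eqP/negPn/negP => n0.
have hw := weightv_pp u j u j (weightv_pp u j u j hm).
have [z hz] := ex_casimir pointed i hw.
have [r zr] := nil_top (nil s i) hw n0 hz.
have zs := sq_top (nil_EE0 (~~ s) u ij hm) hw n0 hz.
move: zr zs; rewrite ocoord_neg !ocoordD !ocoord_neq // !addr0 oN => -> [] /eqP.
  rewrite -subr_eq0; have -> : (N%:R + r.*2%:R + 1) ^+ 2 - (- N%:R + 1) ^+ 2 =
      (4%:R * r.+1 * (N + r))%:R :> k.
    by rewrite -muln2 !natrM natrD -natr1; ring.
  by rewrite natr0 // !muln_eq0 addn_eq0; case: N N2 {oN}.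
rewrite -subr_eq0; have -> : (N%:R + r.*2%:R + 1) ^+ 2 - (- N%:R + 3%:R) ^+ 2 =
    (4%:R * r.+2 * (N.-1 + r))%:R :> k.
  case: N N2 {oN} => // N _.
  by rewrite -muln2 !natrM natrD -!natr1; ring.
by rewrite natr0 // !muln_eq0 addn_eq0; case: N N2 {oN} => // -[].
Qed.

(** If the coordinate exceeded 9, it would still be at least 7 at every weight within distance 3.
    Then [nil_small] supplies the hypothesis of [sl2_string_bound], whose conclusion contradicts the
    assumption. *)
Lemma nil_bounded i l m : (exists j, i != j) -> weightv rho l m -> m != 0 ->
  exists a b : nat, [/\ (a <= 9)%N, (b <= 9)%N & l i = a%:R - b%:R].
Proof.
move=> [j ij] hm m0; have [z hz] := ex_casimir pointed i hm.
have [a [b [ab _]]] := nil_weight char0 (fun u => nil u i) hm m0 hz.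
have bd s (N : nat) : ocoord s i l = N%:R -> (N <= 9)%N.
  move=> oN; rewrite leqNgt; apply/negP => N9.
  have [|c [d [c9 d9 cd]]] :=
      sl2_string_bound (i := i) (j := j) (s := s) (t := true) char0 ij hm m0.
    move=> l' m' c d c3 d3 o' h' n'.
    apply: (nil_small (N := N + c - d) (s := s) true ij h' n').
      rewrite o' oN natrB ?natrD //; apply: leq_trans (leq_addr _ _).
      exact: leq_trans (leq_trans d3 _) N9.
    have d2 : (d + 2 <= N + c)%N.
      apply: leq_trans (leq_addr _ _); apply: leq_trans N9.
      exact: leq_trans (leq_add d3 (leqnn 2)) _.
    by rewrite leq_subRL //; apply: leq_trans d2; apply: leq_addr.
  have : (N + d)%:R = c%:R :> k by rewrite natrD -oN cd subrK.
  move/(natr_inj char0) => e; have := leq_trans N9 (leq_addr d N); rewrite e.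
  by rewrite ltnNge c9.
have l1 : l i = ocoord true i l by rewrite /ocoord mul1r.
have [ba|ab'] := leqP b a.
  have e : ocoord true i l = (a - b)%:R by rewrite natrB.
  by exists (a - b)%N, 0%N; rewrite (bd _ _ e) subr0 l1.
have e : ocoord false i l = (b - a)%:R.
  by rewrite -[false]/(~~ true) ocoord_neg natrB 1?ltnW // ab opprB.
exists 0%N, (b - a)%N; rewrite (bd _ _ e) l1 ab natrB 1?ltnW //.
by rewrite sub0r opprB.
Qed.

End AllNilpotent.
End Cases.

(** * Completely pointed modules *)

Section WeightConversion.
Variables (k : fieldType) (n : nat) (M : lmodType k).
Variable rho : lie_module (@sp_br k n) M.
Implicit Types (m : M) (l : {ffun 'I_n -> k}) (d : 'rV[k]_n).

Lemma sp_cartanP (a : k) d d' : sp_cartan (a *: d + d') = a *: sp_cartan d + sp_cartan d'.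
Proof. by rewrite /sp_cartan linearP sp_leviD. Qed.

Lemma sp_cartan_sum d :
  sp_cartan d = \sum_i d 0 i *: sp_quad (xvec k i) (yvec k i).
Proof.
have c0 : sp_cartan (0 : 'rV[k]_n) = 0.
  apply: (addrI (sp_cartan 0)); rewrite addr0.
  by have := sp_cartanP 1 0 0; rewrite !scale1r addr0.
have cD : {morph @sp_cartan k n : x y / x + y}.
  by move=> x y; rewrite -{1}[x]scale1r sp_cartanP scale1r.
rewrite {1}[d]row_sum_delta (big_morph _ cD c0); apply: eq_bigr => i _.
by rewrite -[_ *: delta_mx 0 i]addr0 sp_cartanP c0 addr0 sp_cartan_quad.
Qed.

Definition wfun l : 'rV[k]_n -> k^o := fun d => \sum_i d 0 i * l i.
Fact wfun_linear l : linear (wfun l).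
Proof.
move=> a d d'; rewrite /wfun scaler_sumr -big_split /=; apply: eq_bigr => i _.
by rewrite !mxE mulrDl -mulrA.
Qed.
HB.instance Definition _ l := GRing.isLinear.Build k 'rV[k]_n k^o *:%R (wfun l) (wfun_linear l).

Definition weight_of l : weight k n := linfun (wfun l).
Definition coords_of (mu : weight k n) : {ffun 'I_n -> k} := [ffun i => mu (delta_mx 0 i)].

Lemma weight_ofK : cancel weight_of coords_of.
Proof.
move=> l; apply/ffunP=> i; rewrite ffunE lfunE /= /wfun (bigD1 i) //= mxE !eqxx mul1r.
by rewrite big1 ?addr0 // => j ji; rewrite mxE (negbTE ji) andbF mul0r.
Qed.

Lemma weight_space_coords mu m : weight_space rho mu m -> weightv rho (coords_of mu) m.
Proof. by move=> h i; rewrite /quad_op -sp_cartan_quad h ffunE. Qed.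

Lemma weight_space_of l m : weightv rho l m <-> weight_space rho (weight_of l) m.
Proof.
split=> [h d|/weight_space_coords]; last by rewrite weight_ofK.
rewrite sp_cartan_sum lact_sum lfunE /= /wfun scaler_suml; apply: eq_bigr => i _.
by rewrite lact_scale -/(quad_op rho _ _ m) h scalerA.
Qed.

Hypothesis cp : completely_pointed rho.

Lemma cp_pointed l : exists v, forall m, weightv rho l m -> exists c : k, m = c *: v.
Proof.
by have [_ /(_ (weight_of l))[v hv]] := cp; exists v => m /weight_space_of/hv.
Qed.

Lemma cp_span m : exists2 s : seq M,
  forall x, x \in s -> exists l, weightv rho l x & m = \sum_(x <- s) x.
Proof.
have [[/(_ m)[s hs ->] _] _] := cp; exists s => // x /hs[mu hmu].
by exists (coords_of mu); apply: weight_space_coords.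
Qed.

Lemma cp_indep (ls : seq {ffun 'I_n -> k}) (x : {ffun 'I_n -> k} -> M) :
  uniq ls -> (forall l, weightv rho l (x l)) ->
  \sum_(l <- ls) x l = 0 -> forall l, l \in ls -> x l = 0.
Proof.
move=> uls hx sx l lls; have [[_ ind] _] := cp.
(* [y] transports [x] along [weight_of] and is zero off its image. *)
pose y mu := x (coords_of mu) *+ (weight_of (coords_of mu) == mu).
have yE l' : y (weight_of l') = x l' by rewrite /y weight_ofK eqxx.
rewrite -yE; apply: (ind (map weight_of ls)).
- by rewrite map_inj_uniq //; apply: can_inj weight_ofK.
- move=> mu; rewrite /y; case: eqP => [<-|_] /=; last by move=> d; rewrite lactr0 scaler0.
  by rewrite weight_ofK; apply/weight_space_of.
- by rewrite big_map -[RHS]sx; apply: eq_bigr => l' _; apply: yE.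
- exact: map_f.
Qed.

Hypothesis simple : simple_module rho.

Lemma ex_weightv : exists l m, weightv rho l m /\ m != 0.
Proof.
apply: contrapT => no; have [[m m0] _] := simple; apply: m0.
have [s hs ->] := cp_span m; rewrite big_seq big1 // => x /hs[l hx].
by apply/eqP/negPn/negP => x0; apply: no; exists l, x.
Qed.

Hypothesis char0 : [pchar k] =i pred0.
Hypothesis n2 : (2 <= n)%N.
Local Notation op := (quad_op rho).
Local Notation E s i := (op (pvec k s i) (pvec k s i)).

Lemma ex_other (i : 'I_n) : exists j, i != j.
Proof.
case: n n2 i => [|[|N]] // _ i.
by case: (eqVneq i ord0) => [->|i0]; [exists ord_max | exists ord0].
Qed.

(** By [nil_bounded] only finitely many weights occur, coded by a pair in ['I_10] for each
    coordinate; one vector for each code spans [M]. *)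
Lemma nil_finite_dimensional : (forall s i, loc_nilpotent (E s i)) ->
  ~ infinite_dimensional M.
Proof.
move=> nil inf; apply: inf.
pose T := {ffun 'I_n -> 'I_10 * 'I_10}.
pose lT (g : T) : {ffun 'I_n -> k} := [ffun i => (g i).1%:R - (g i).2%:R].
have [v hv] := choice (fun g => cp_pointed (lT g)).
exists [seq v g | g <- index_enum T] => m.
suff [c ->] : exists c : T -> k, m = \sum_g c g *: v g.
  exists [seq c g | g <- index_enum T]; rewrite size_map.
  pose g0 : T := [ffun=> (ord0, ord0)].
  rewrite (big_nth g0) big_mkord; apply: eq_bigr => i _.
  by rewrite !(nth_map g0) ?ltn_ord.
have [s hs ->] := cp_span m; elim: s hs => [|x s IHs] hs.
  by exists (fun=> 0); rewrite big_nil big1 // => g _; rewrite scale0r.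
have [|c cE] := IHs; first by move=> y ys; apply: hs; rewrite inE ys orbT.
rewrite big_cons cE; have [|l hx] := hs x; first by rewrite inE eqxx.
have [->|x0] := eqVneq x 0; first by exists c; rewrite add0r.
have bd i := nil_bounded char0 cp_pointed nil (ex_other i) hx x0.
have /choice[g hg] : forall i, exists ab : 'I_10 * 'I_10, l i = ab.1%:R - ab.2%:R.
  move=> i; have [a [b [a9 b9 ->]]] := bd i.
  by exists (Ordinal (a9 : a < 10)%N, Ordinal (b9 : b < 10)%N).
pose g1 : T := [ffun i => g i].
have lE : lT g1 = l by apply/ffunP=> i; rewrite !ffunE -hg.
have [|e eE] := hv g1 x; first by rewrite lE.
exists (fun g' => c g' + e *+ (g' == g1)).
under [RHS]eq_bigr do rewrite scalerDl.
rewrite big_split /= addrC; congr (_ + _); rewrite (bigD1 g1) //= eqxx mulr1n eE.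
by rewrite big1 ?addr0 // => g' /negbTE->; rewrite mulr0n scale0r.
Qed.

Lemma cp_long_roots : infinite_dimensional M ->
  (forall j l m, weightv rho l m -> casimir rho j (4%:R^-1) l m) /\
  (forall i, exists s, injective_at (E s i)).
Proof.
move=> inf; have [l [m [hm m0]]] := ex_weightv.
have [i [s inj]] : exists i s, injective_at (E s i).
  apply: contrapT => no; apply: nil_finite_dimensional inf => s i.
  by case: (opE_inj_or_nil s i simple) => // h; case: no; exists i, s.
have pt := cp_pointed.
split=> [j l' m' h'|j]; first exact: (inj_casimir_quarter char0 pt simple inj j (ex_other i) h').
exact: (inj_all char0 pt simple inj j hm m0).
Qed.

End WeightConversion.

(** * Generation and gradings *)

Section GradedSpans.
Variables (k : comNzRingType) (A : pzRingType) (c : k -> A) (S : Type).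
Variables (gen : S -> A) (G : zmodType) (deg : S -> G).
Hypothesis c1 : c 1 = 1.
Hypothesis cM : forall a b, c (a * b) = c a * c b.
Hypothesis cC : forall a x, c a * x = x * c a.
Implicit Types (x y : A) (d : G).

Definition gterm (w : k * seq S) : A := c w.1 * \prod_(s <- w.2) gen s.
Definition gspan x : Prop := exists ws, x = \sum_(w <- ws) gterm w.
Local Notation comp := (gcomp c gen deg).

Lemma gcomp0 d : comp d 0.
Proof. by exists [::]; rewrite ?big_nil. Qed.

Lemma gcompD d x y : comp d x -> comp d y -> comp d (x + y).
Proof.
by move=> [ws hw ->] [vs hv ->]; exists (ws ++ vs); rewrite ?all_cat ?hw // big_cat.
Qed.

Lemma gterm_mul w v : gterm (w.1 * v.1, w.2 ++ v.2) = gterm w * gterm v.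
Proof.
by rewrite /gterm /= cM big_cat /= -!mulrA; congr (_ * _); rewrite mulrA cC -!mulrA cC.
Qed.

Lemma sum_gterm_mul ws vs :
  (\sum_(w <- ws) gterm w) * (\sum_(v <- vs) gterm v) =
  \sum_(w <- [seq (w.1 * v.1, w.2 ++ v.2) | w <- ws, v <- vs]) gterm w.
Proof.
elim: ws => [|w ws IHws]; first by rewrite /= !big_nil mul0r.
rewrite /= big_cons mulrDl IHws big_cat /=; congr (_ + _).
rewrite mulr_sumr big_map; apply: eq_bigr => v _; exact: esym (gterm_mul w v).
Qed.

Lemma gcompM d e x y : comp d x -> comp e y -> comp (d + e) (x * y).
Proof.
move=> [ws hw ->] [vs hv ->].
exists [seq (w.1 * v.1, w.2 ++ v.2) | w <- ws, v <- vs]; last exact: sum_gterm_mul.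
elim: ws hw => //= w ws IHws /andP[/eqP hw /IHws]; rewrite all_cat => ->.
rewrite andbT all_map; apply: sub_all hv => v /= /eqP hv.
by rewrite big_cat /= hw hv.
Qed.

Lemma gcomp_c a : comp 0 (c a).
Proof. by exists [:: (a, [::])]; rewrite /= ?big_nil ?eqxx // big_seq1 big_nil mulr1. Qed.
Lemma gcomp_gen s : comp (deg s) (gen s).
Proof.
exists [:: (1, [:: s])]; first by rewrite /= big_seq1 eqxx.
by rewrite big_seq1 /= big_seq1 c1 mul1r.
Qed.
Lemma gspan0 : gspan 0. Proof. by exists [::]; rewrite big_nil. Qed.
Lemma gspanD x y : gspan x -> gspan y -> gspan (x + y).
Proof. by move=> [ws ->] [vs ->]; exists (ws ++ vs); rewrite big_cat. Qed.
Lemma gspanM x y : gspan x -> gspan y -> gspan (x * y).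
Proof. by move=> [ws ->] [vs ->]; eexists; apply: sum_gterm_mul. Qed.
Lemma gspan_c a : gspan (c a).
Proof. by exists [:: (a, [::])]; rewrite big_seq1 /gterm big_nil mulr1. Qed.
Lemma gspan_gen s : gspan (gen s).
Proof. by exists [:: (1, [:: s])]; rewrite big_seq1 /gterm big_seq1 c1 mul1r. Qed.
Lemma gspan_ind (P : A -> Prop) :
  P 0 -> (forall x y, P x -> P y -> P (x + y)) -> (forall x y, P x -> P y -> P (x * y)) ->
  (forall a, P (c a)) -> (forall s, P (gen s)) -> forall x, gspan x -> P x.
Proof.
move=> P0 PD PM Pc Pg x [ws ->]; elim/big_ind: _ => //= w _.
have P1 : P 1 by rewrite -c1.
by apply: (PM) => //; elim/big_ind: _.
Qed.

(** The terms are collected by degree. The family [xs] is defined at every degree, so that a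
    component can be named before its degree is known to lie in [ds]. *)
Lemma gspan_decomp x : gspan x -> exists (ds : seq G) (xs : G -> A),
  [/\ uniq ds, forall d, comp d (xs d) & x = \sum_(d <- ds) xs d].
Proof.
move=> [ws ->]; pose dg (w : k * seq S) := \sum_(s <- w.2) deg s.
exists (undup (map dg ws)), (fun d => \sum_(w <- ws | dg w == d) gterm w); split.
- exact: undup_uniq.
- by move=> d; exists (filter (fun w => dg w == d) ws); rewrite ?filter_all ?big_filter.
have : all (fun w => dg w \in undup (map dg ws)) ws.
  by apply/(all_nthP (0, [::])) => i hi; rewrite mem_undup; apply/(nthP 0);
    exists i; rewrite ?size_map // (nth_map (0, [::])).
move: (undup _) (undup_uniq (map dg ws)) => ds uds.
elim: ws => [|w ws IHws] /=; first by rewrite big_nil big1 // => d _; rewrite big_nil.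
case/andP=> wds /IHws {}IHws; rewrite big_cons IHws.
rewrite (bigD1_seq _ wds uds) [in RHS](bigD1_seq _ wds uds) /= big_cons eqxx addrA.
by congr (_ + _); apply: eq_bigr => d dw; rewrite big_cons eq_sym (negbTE dw).
Qed.

End GradedSpans.

Section EnvelopingBasics.
Variables (k : comNzRingType) (g : lmodType k) (br : g -> g -> g).
Implicit Types (x y : g) (u : Uenv br).
Local Notation Ugen := (Ugen br).
Local Notation Uscal := (Uscal br).

Lemma Uscal1 : Uscal 1 = 1.
Proof. by rewrite /Uscal scale1r (rmorph1 (Upi br)). Qed.
Lemma UscalM a b : Uscal (a * b) = Uscal a * Uscal b.
Proof. by rewrite /Uscal -(rmorphM (Upi br)) -scalerA mulr_algl. Qed.
Lemma UscalN1 : Uscal (-1) = -1.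
Proof. by rewrite /Uscal scaleN1r (rmorphN (Upi br)) (rmorph1 (Upi br)). Qed.
Lemma UscalC a u : Uscal a * u = u * Uscal a.
Proof.
by rewrite -[u]UreprK -!(rmorphM (Upi br)) mulr_algl mulr_algr.
Qed.

Lemma Ugen_lin a x y : Ugen (a *: x + y) = Uscal a * Ugen x + Ugen y.
Proof.
rewrite /Ugen /Uscal -(rmorphM (Upi br)) -(rmorphD (Upi br)) mulr_algl.
by apply/quot_piP; apply: gen_idealW; apply: Urel_lin.
Qed.
Lemma Ugen0 : Ugen 0 = 0.
Proof.
have := Ugen_lin 1 0 0; rewrite scaler0 addr0 Uscal1 mul1r => h.
by apply: (addrI (Ugen 0)); rewrite -h addr0.
Qed.
Lemma UgenD x y : Ugen (x + y) = Ugen x + Ugen y.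
Proof. by rewrite -{1}[x]scale1r Ugen_lin Uscal1 mul1r. Qed.
Lemma Ugen_br x y : Ugen (br x y) = Ugen x * Ugen y - Ugen y * Ugen x.
Proof.
rewrite /Ugen -!(rmorphM (Upi br)) -(rmorphB (Upi br)); apply/esym/quot_piP.
by apply: gen_idealW; apply: Urel_br.
Qed.

Lemma Uenv_ind (P : Uenv br -> Prop) : P 0 ->
  (forall u v, P u -> P v -> P (u + v)) -> (forall u v, P u -> P v -> P (u * v)) ->
  (forall a, P (Uscal a)) -> (forall x, P (Ugen x)) -> forall u, P u.
Proof.
move=> P0 PD PM Pc Pg u; rewrite -[u]UreprK.
elim/freealg_ind: (Urepr u) => [|a w p IHp]; first by rewrite (rmorph0 (Upi br)).
rewrite (rmorphD (Upi br)); apply: PD => //.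
rewrite -mulr_algl (rmorphM (Upi br)); apply: (PM); first exact: Pc.
elim: w => [|x w IHw]; first by rewrite fword_nil (rmorph1 (Upi br)) -Uscal1.
by rewrite -cat1s fword_cat (rmorphM (Upi br)); apply: PM => //; apply: Pg.
Qed.

Variables (M : lmodType k) (rho : lie_module br M).
Implicit Types (m : M).
Lemma Uact_gen x m : Uact rho (Ugen x) m = rho x m.
Proof. by rewrite Uact_pi free_act_word. Qed.
Lemma Uact_scal a m : Uact rho (Uscal a) m = a *: m.
Proof. by rewrite Uact_pi free_actZ -fword_nil free_act_word. Qed.
Lemma Uact_linear u : linear (Uact rho u). Proof. exact: free_act_linear. Qed.
Lemma UactZ u a m : Uact rho u (a *: m) = a *: Uact rho u m.
Proof. by rewrite -[a *: m]addr0 Uact_linear /Uact free_actr0 addr0. Qed.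
Lemma Uact0r u : Uact rho u 0 = 0. Proof. exact: free_actr0. Qed.
Lemma UactDr u m m' : Uact rho u (m + m') = Uact rho u m + Uact rho u m'.
Proof. by rewrite -{1}[m]scale1r Uact_linear scale1r. Qed.
Lemma Uact1 m : Uact rho 1 m = m.
Proof. by rewrite -Uscal1 Uact_scal scale1r. Qed.
Lemma Uact0l m : Uact rho 0 m = 0.
Proof. by rewrite -(rmorph0 (Upi br)) Uact_pi free_act0. Qed.
Lemma Uact_sum (I : Type) (r : seq I) (P : pred I) (F : I -> Uenv br) m :
  Uact rho (\sum_(i <- r | P i) F i) m = \sum_(i <- r | P i) Uact rho (F i) m.
Proof. by apply: (big_morph (fun u => Uact rho u m)) => [u v|]; rewrite ?UactD ?Uact0l. Qed.

End EnvelopingBasics.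

Section Generation.
Variables (k : fieldType) (n : nat).
Hypothesis char0 : [pchar k] =i pred0.
Implicit Types (x y : sp k n) (i j : 'I_n).
Local Notation chev := (gspan (Uscal (@sp_br k n)) (@chevalley_gen k n)).

Let cD := gspanD (c := Uscal (@sp_br k n)) (gen := @chevalley_gen k n).
Let cM := @gspanM k _ (Uscal (@sp_br k n)) _ (@chevalley_gen k n)
  (@UscalM _ _ (@sp_br k n)) (@UscalC _ _ (@sp_br k n)).
Let cs := @gspan_c k _ (Uscal (@sp_br k n)) _ (@chevalley_gen k n).
Let cg := @gspan_gen k _ (Uscal (@sp_br k n)) _ (@chevalley_gen k n)
  (@Uscal1 _ _ (@sp_br k n)).

Definition chev_sp x : Prop := chev (Ugen _ x).

Lemma chev_spP a x y : chev_sp x -> chev_sp y -> chev_sp (a *: x + y).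
Proof. by rewrite /chev_sp Ugen_lin => hx hy; apply: cD => //; apply: cM. Qed.
Lemma chev_sp0 : chev_sp 0.
Proof. by rewrite /chev_sp Ugen0; apply: gspan0. Qed.
Lemma chev_spZ a x : chev_sp x -> chev_sp (a *: x).
Proof. by move=> hx; rewrite -[a *: x]addr0; apply: chev_spP => //; apply: chev_sp0. Qed.
Lemma chev_spD x y : chev_sp x -> chev_sp y -> chev_sp (x + y).
Proof. by rewrite -{2}[x]scale1r; apply: chev_spP. Qed.
Lemma chev_spZ_inv a x : a != 0 -> chev_sp (a *: x) -> chev_sp x.
Proof. by move=> a0 /(chev_spZ a^-1); rewrite scalerA mulVf // scale1r. Qed.
Lemma chev_sp_br x y : chev_sp x -> chev_sp y -> chev_sp (sp_br x y).
Proof.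
move=> hx hy; rewrite /chev_sp Ugen_br; apply: cD; first exact: cM.
rewrite -mulN1r -UscalN1.
by apply: (cM); [apply: cs | apply: cM].
Qed.

Local Notation X := (xvec k).
Local Notation Y := (yvec k).
Local Notation quad := (@sp_quad k n).

Lemma chev_sp_e i : chev_sp (sp_e k i). Proof. exact: (cg (ChevE i)). Qed.
Lemma chev_sp_f i : chev_sp (sp_f k i). Proof. exact: (cg (ChevF i)). Qed.
Lemma chev_sp_h i : chev_sp (sp_h k i). Proof. exact: (cg (ChevH i)). Qed.

(** The element is [h_i + ... + h_n], so the induction descends from the last index; [r] bounds
    [n - i]. *)
Lemma chev_sp_xy i : chev_sp (quad (X i) (Y i)).
Proof.
move: {2}(n - i)%N (leqnn (n - i)) => r; elim: r i => [|r IHr] i.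
  by rewrite leqn0 subn_eq0 leqNgt ltn_ord.
move=> hr; have [/eqP iE|iE] := boolP (i.+1 == n).
  by rewrite -sp_h_long //; apply: chev_sp_h.
have lt_i : (i.+1 < n)%N by rewrite ltn_neqAle iE ltn_ord.
rewrite -[quad _ _](subrK (quad (X (Ordinal lt_i)) (Y (Ordinal lt_i)))).
rewrite -sp_h_short //; apply: chev_spD; first exact: chev_sp_h.
by apply: IHr; rewrite /= subnS -ltnS prednK // subn_gt0.
Qed.

(** The coefficient matrix [G] is symmetric, so symmetrising each term doubles it, whence the
    inverse of 2. *)
Lemma sp_quad_sum x : x = 2%:R^-1 *: \sum_a \sum_b
  ((x : 'M_(n + n)) *m sp_form k n) a b *: quad (delta_mx a 0) (delta_mx b 0).
Proof.
set G := _ *m _; have GT : G^T = G := sp_form_sym x.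
have vD : {morph @sp_val k n : u v / u + v} by [].
have v0 : sp_val (0 : sp k n) = 0 by [].
apply: val_inj; rewrite -[RHS]/(2%:R^-1 *: sp_val _) (big_morph _ vD v0).
have -> : \sum_a sp_val (\sum_b G a b *: quad (delta_mx a 0) (delta_mx b 0)) =
    - (G + G^T) *m sp_form k n.
  have -> : G + G^T = \sum_a \sum_b G a b *: (delta_mx a b + delta_mx b a).
    rewrite {1}[G]matrix_sum_delta [X in _ + X^T = _]matrix_sum_delta linear_sum /=.
    rewrite -big_split /=; apply: eq_bigr => a _; rewrite linear_sum -big_split /=.
    by apply: eq_bigr => b _; rewrite linearZ /= trmx_delta -scalerDr.
  rewrite mulNmx mulmx_suml -sumrN; apply: eq_bigr => a _.
  rewrite (big_morph _ vD v0) mulmx_suml -sumrN; apply: eq_bigr => b _ /=.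
  by rewrite !trmx_delta !mul_delta_mx -scalemxAl -scalerN mulNmx.
rewrite GT -mulr2n mulNmx -scaler_nat -scalemxAl -scalerN scalerA mulVf ?natr0 //.
by rewrite scale1r /G -mulmxA sp_formK mulmxN mulmx1 opprK.
Qed.

Lemma delta_lshift i : delta_mx (lshift n i) 0 = X i.
Proof.
apply/matrixP=> a b; rewrite !mxE; case: splitP => c cE; rewrite !mxE.
  by rewrite -(inj_eq val_inj) /= cE.
by rewrite -(inj_eq val_inj) /= cE gtn_eqF // ltn_addr.
Qed.
Lemma delta_rshift i : delta_mx (rshift n i) 0 = Y i.
Proof.
apply/matrixP=> a b; rewrite !mxE; case: splitP => c cE; rewrite !mxE.
  by rewrite -(inj_eq val_inj) /= cE ltn_eqF // ltn_addr.
by rewrite -(inj_eq val_inj) /= cE eqn_add2l.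
Qed.

Lemma sp_ind (P : sp k n -> Prop) :
  (forall a x y, P x -> P y -> P (a *: x + y)) -> P 0 ->
  (forall i j, P (quad (X i) (X j))) -> (forall i j, P (quad (X i) (Y j))) ->
  (forall i j, P (quad (Y i) (Y j))) -> forall x, P x.
Proof.
move=> PP P0 PXX PXY PYY x.
have PZ a y : P y -> P (a *: y) by rewrite -[a *: y]addr0 => h; apply: PP.
have PD y z : P y -> P z -> P (y + z) by rewrite -{2}[y]scale1r; apply: PP.
rewrite [x]sp_quad_sum; apply: (PZ); elim/big_ind: _ => // a _.
elim/big_ind: _ => // b _; apply: PZ.
case: (split_ordP a) => {}a ->; case: (split_ordP b) => {}b ->;
  by rewrite ?delta_lshift ?delta_rshift // sp_quadC.
Qed.

Lemma chev_sp_xy_lt i j : (i < j)%N ->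
  chev_sp (quad (X i) (Y j)) /\ chev_sp (quad (X j) (Y i)).
Proof.
case: j => j jn /=; elim: j jn => [|j IHj] // jn; rewrite ltnS leq_eqVlt => /orP[/eqP ij|ij].
  have e : Ordinal jn = i.+1 :> nat by rewrite /= ij.
  by rewrite -(sp_e_short k e) -(sp_f_short k e); split; [apply: chev_sp_e | apply: chev_sp_f].
have jn' : (j < n)%N by apply: ltnW.
have e : Ordinal jn = (Ordinal jn').+1 :> nat by [].
have [h1 h2] := IHj jn' ij.
have nij : (i == Ordinal jn) = false by rewrite -(inj_eq val_inj) /= ltn_eqF // ltnS ltnW.
have nij' : (i == Ordinal jn') = false by rewrite -(inj_eq val_inj) /= ltn_eqF.
have nji := nij; rewrite eq_sym in nji; have nji' := nij'; rewrite eq_sym in nji'.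
have := chev_sp_br h1 (chev_sp_e (Ordinal jn')).
rewrite (sp_e_short k e) sp_br_quad ?omegaB ?eqxx ?nij ?nij' ?nji ?nji'.
rewrite ?oppr0 ?scale0r ?scale1r ?(addr0, add0r) => ?; split=> //.
have := chev_sp_br (chev_sp_f (Ordinal jn')) h2.
rewrite (sp_f_short k e) sp_br_quad ?omegaB ?eqxx ?nij ?nij' ?nji ?nji'.
by rewrite ?oppr0 ?scale0r ?scale1r ?(addr0, add0r).
Qed.

Lemma chev_sp_xy_all i j : chev_sp (quad (X i) (Y j)).
Proof.
have [ij|ji|/val_inj ->] := ltngtP i j; last exact: chev_sp_xy.
  by have [] := chev_sp_xy_lt ij.
by have [] := chev_sp_xy_lt ji.
Qed.

Lemma ex_last i : exists j : 'I_n, j.+1 = n.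
Proof.
have h : (n.-1 < n)%N by case: n i => [[]|].
by exists (Ordinal h); rewrite /= prednK //; apply: leq_ltn_trans (ltn_ord i).
Qed.

(** Starting from the long simple root of last index [t], brackets with [sp_quad (X a) (Y t)]
    replace the two indices [t] one at a time. *)
Lemma chev_sp_xx_all i j : chev_sp (quad (X i) (X j)).
Proof.
have [t tE] := ex_last i.
have tt : chev_sp (quad (X t) (X t)).
  by rewrite -(sp_e_long k tE); apply: chev_spZ; apply: chev_sp_e.
have it a : chev_sp (quad (X a) (X t)).
  have := chev_sp_br (chev_sp_xy_all a t) tt.
  rewrite sp_br_quad ?omegaB eqxx ?scale0r ?scale1r ?(addr0, add0r).
  by rewrite -mulr2n -scaler_nat; apply: chev_spZ_inv; rewrite natr0.
have [->|nt] := eqVneq i t; first by rewrite sp_quadC.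
rewrite eq_sym in nt; have := chev_sp_br (chev_sp_xy_all j t) (it i).
rewrite sp_br_quad ?omegaB eqxx (negbTE nt) ?scale0r ?scale1r ?(addr0, add0r).
by rewrite sp_quadC.
Qed.

Lemma chev_sp_yy_all i j : chev_sp (quad (Y i) (Y j)).
Proof.
have [t tE] := ex_last i.
have tt : chev_sp (quad (Y t) (Y t)).
  by rewrite -(sp_f_long k tE); apply: chev_spZ; apply: chev_sp_f.
have n1 : (-1 : k) != 0 by rewrite oppr_eq0 oner_neq0.
have it a : chev_sp (quad (Y a) (Y t)).
  have := chev_sp_br (chev_sp_xy_all t a) tt.
  rewrite sp_br_quad ?omegaB eqxx ?scale0r ?scaleN1r ?(addr0, add0r).
  rewrite -opprD -mulr2n -scaler_nat -scaleN1r => /(chev_spZ_inv n1).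
  by apply: chev_spZ_inv; rewrite natr0.
have [->|nt] := eqVneq i t; first by rewrite sp_quadC.
rewrite eq_sym in nt; have := chev_sp_br (chev_sp_xy_all t j) (it i).
rewrite sp_br_quad ?omegaB eqxx (negbTE nt) ?oppr0 ?scale0r ?(addr0, add0r).
by move/(chev_spZ_inv n1); rewrite sp_quadC.
Qed.

Lemma chev_all u : chev u.
Proof.
apply: (@Uenv_ind _ _ (@sp_br k n) chev) u => //; first exact: gspan0.
move=> x; apply: (@sp_ind chev_sp) x.
- exact: chev_spP.
- exact: chev_sp0.
- exact: chev_sp_xx_all.
- exact: chev_sp_xy_all.
- exact: chev_sp_yy_all.
Qed.

Lemma Usp_chev_ind (P : Usp k n -> Prop) : P 0 ->
  (forall u v, P u -> P v -> P (u + v)) -> (forall u v, P u -> P v -> P (u * v)) ->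
  (forall a, P (Uscal _ a)) -> (forall i, P (Ue k i)) -> (forall i, P (Uf k i)) ->
  (forall i, P (Uh k i)) -> forall u, P u.
Proof.
move=> P0 PD PM Pc Pe Pf Ph u.
apply: (@gspan_ind k _ (Uscal (@sp_br k n)) _ (@chevalley_gen k n)
  (@Uscal1 _ _ (@sp_br k n)) P) (chev_all u) => //.
by case=> i; [apply: Pe | apply: Pf | apply: Ph].
Qed.

End Generation.

(** * Modules over the TGW construction *)

Section Weights.
Variables (k : fieldType) (n : nat).
Hypothesis char0 : [pchar k] =i pred0.
Implicit Types (i j e : 'I_n) (l : {ffun 'I_n -> k}) (p : {mpoly k[n]}) (d : {ffun 'I_n -> int}).

(** The values of the variables [u_i] on the weight [l]; the shift is that of [u_n = h_n + 1/2]. *)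
Definition uval l : 'I_n -> k := fun i => l i + 2%:R^-1.

Lemma Usp_RX_quad i :
  Usp_R 'X_i = Ugen (@sp_br k n) (sp_quad (xvec k i) (yvec k i)) + Uscal _ 2%:R^-1.
Proof.
move: {2}(n - i)%N (leqnn (n - i)) => r; elim: r i => [|r IHr] i.
  by rewrite leqn0 subn_eq0 leqNgt ltn_ord.
move=> hr; have [/eqP iE|iE] := boolP (i.+1 == n).
  by rewrite -sp_h_long // -[Ugen _ _](Usp_R_hn k iE) Usp_RB Usp_RC subrK.
have lt_i : (i.+1 < n)%N by rewrite ltn_neqAle iE ltn_ord.
rewrite -[sp_quad _ _](subrK (sp_quad (xvec k (Ordinal lt_i)) (yvec k (Ordinal lt_i)))).
rewrite -sp_h_short // UgenD -addrA -IHr.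
  by rewrite -[Ugen _ _](@Usp_R_h k n i (Ordinal lt_i)) // Usp_RB subrK.
by rewrite /= subnS -ltnS prednK // subn_gt0.
Qed.

(** The simple root of index [i], read off as a column of the incidence matrix; [wdeg] extends it to
    the root lattice. *)
Definition alpha i : {ffun 'I_n -> k} := [ffun e => (Ctilde_gamma e i)%:~R].
Definition wdeg d : {ffun 'I_n -> k} := \sum_i alpha i *~ d i.

Lemma wdegD d d' : wdeg (d + d') = wdeg d + wdeg d'.
Proof.
rewrite /wdeg -big_split; apply: eq_bigr => i _ /=.
by rewrite ffunE mulrzDr.
Qed.
Lemma wdegN d : wdeg (- d) = - wdeg d.
Proof. by rewrite /wdeg -sumrN; apply: eq_bigr => i _; rewrite ffunE mulrNz. Qed.
Lemma wdeg0 : wdeg 0 = 0.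
Proof. by rewrite /wdeg big1 // => i _; rewrite ffunE. Qed.
Lemma wdeg_delta i : wdeg [ffun j => (j == i)%:R] = alpha i.
Proof.
rewrite /wdeg (bigD1 i) //= ffunE eqxx big1 ?addr0 // => j ji.
by rewrite ffunE (negbTE ji).
Qed.

Lemma intr0 (z : int) : (z%:~R == 0 :> k) = (z == 0).
Proof.
by case: z => a; rewrite ?NegzE ?mulrNz ?oppr_eq0 -pmulrn natr0.
Qed.

Lemma ffunMzE (f : {ffun 'I_n -> k}) (z : int) e : (f *~ z) e = f e *~ z.
Proof.
by case: z => a; rewrite ?NegzE ?mulrNz -!pmulrn ?ffunE ffunMnE.
Qed.

(** The incidence matrix is lower bidiagonal with nonzero diagonal, so the coordinates of [d] vanish
    one after another. *)
Lemma wdeg_eq0 d : wdeg d = 0 -> d = 0.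
Proof.
move=> h; suff : forall r e, (e < r)%N -> d e = 0.
  by move=> h'; apply/ffunP=> e; rewrite (h' e.+1 e) // ffunE.
have coord e : \sum_i (Ctilde_gamma e i * d i) = 0.
  apply/eqP; rewrite -intr0 rmorph_sum /=; have := congr1 (fun f : {ffun 'I_n -> k} => f e) h.
  rewrite /= sum_ffunE ffunE => he; apply/eqP; rewrite -[RHS]he; apply: eq_bigr => i _.
  by rewrite ffunMzE ffunE rmorphM /= mulrzr.
elim=> [|r IHr] e // er; have := coord e; rewrite (bigD1 e) //= big1 ?addr0.
  by move/eqP; rewrite mulf_eq0 /Ctilde_gamma eqxx => /orP[|/eqP//]; case: ifP.
move=> i ie; have [lt_ie|lt_ei|/val_inj ei] := ltngtP i e.
- by rewrite IHr ?mulr0 //; apply: leq_trans lt_ie _.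
- rewrite /Ctilde_gamma eq_sym (negbTE ie) (ltn_eqF (_ : e < i.+1)%N) ?mul0r //.
  exact: ltnW.
- by rewrite ei eqxx in ie.
Qed.

Lemma wdeg_inj : injective wdeg.
Proof.
move=> d d' h; apply/eqP; rewrite -subr_eq0; apply/eqP/wdeg_eq0.
by rewrite wdegD wdegN h subrr.
Qed.

Lemma alpha_short i j : j = i.+1 :> nat -> alpha i = sgn_delta k true i + sgn_delta k false j.
Proof.
move=> ij; apply/ffunP=> e; rewrite !ffunE /= expr0 expr1 mul1r mulN1r /Ctilde_gamma -ij.
rewrite ltn_eqF // -[e == j :> nat]/(e == j).
have [->|_] := eqVneq e i; first by rewrite -(inj_eq val_inj) /= ij ltn_eqF // subr0.
by case: (e == j); rewrite ?oppr0 ?addr0 ?add0r.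
Qed.
Lemma alpha_long i : i.+1 = n -> alpha i = sgn_delta k true i + sgn_delta k true i.
Proof.
move=> iE; apply/ffunP=> e; rewrite !ffunE /= expr0 !mul1r /Ctilde_gamma iE eqxx.
by rewrite (ltn_eqF (ltn_ord e)); case: (e == i); rewrite ?addr0.
Qed.

Lemma short_or_long i : (exists j, j = i.+1 :> nat) \/ i.+1 = n.
Proof.
have [/eqP->|iE] := boolP (i.+1 == n); [by right | left].
have lt_i : (i.+1 < n)%N by rewrite ltn_neqAle iE ltn_ord.
by exists (Ordinal lt_i).
Qed.

Lemma meval_sigma i l p : (Ctilde_sigma i p).@[uval (l + alpha i)] = p.@[uval l].
Proof.
rewrite /Ctilde_sigma /mshift comp_mpoly_meval; apply: meval_eq => e.
by rewrite tnth_mktuple mevalD mevalXU mevalC /uval !ffunE; ring.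
Qed.
Lemma meval_sigmaV i l p : (Ctilde_sigmaV i p).@[uval (l - alpha i)] = p.@[uval l].
Proof.
rewrite /Ctilde_sigmaV /mshift comp_mpoly_meval; apply: meval_eq => e.
by rewrite tnth_mktuple mevalD mevalXU mevalC /uval !ffunE; ring.
Qed.

Section Module.
Variables (M : lmodType k) (rho : lie_module (@sp_br k n) M).
Implicit Types (m : M).

Lemma Uact_R p l m : weightv rho l m -> Uact rho (Usp_R p) m = p.@[uval l] *: m.
Proof.
move=> hm; pose P q := Uact rho (Usp_R q) m = q.@[uval l] *: m.
have PC c : P c%:MP by rewrite /P Usp_RC Uact_scal mevalC.
have PM q r : P q -> P r -> P (q * r).
  by rewrite /P Usp_RM UactM => hq ->; rewrite UactZ hq mevalM scalerA mulrC.
have PD q r : P q -> P r -> P (q + r).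
  by rewrite /P Usp_RD UactD => -> ->; rewrite mevalD scalerDl.
have PX i : P 'X_i.
  rewrite /P Usp_RX_quad UactD Uact_gen Uact_scal mevalXU scalerDl.
  by rewrite -[rho _ m]/(quad_op rho _ _ m) hm.
elim/mpolyind: p => [|c q p _ _ IHp]; first by rewrite -mpolyC0; apply: PC.
apply: (PD) => //; rewrite -mul_mpolyC; apply: (PM) => //.
rewrite mpolyXE_id; elim/big_ind: _ => //; first by rewrite -mpolyC1; apply: PC.
by move=> i _; elim: (q i) => [|a IHa]; rewrite ?expr0 -?mpolyC1 // exprS; apply: PM.
Qed.

Lemma weightv_e i l m : weightv rho l m -> weightv rho (l + alpha i) (rho (sp_e k i) m).
Proof.
move=> hm; have [[j ij]|iE] := short_or_long i.
  rewrite (sp_e_short k ij) (alpha_short ij) addrA.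
  exact: (weightv_op (homv_x _ _) (homv_y _ _) hm).
have two0 : (-2%:R : k) != 0 by rewrite oppr_eq0 natr0.
have -> : sp_e k i = (-2%:R)^-1 *: sp_quad (xvec k i) (xvec k i).
  by rewrite -(sp_e_long k iE) scalerA mulVf // scale1r.
rewrite lact_scale (alpha_long iE) addrA; apply: weightvZ.
exact: (weightv_op (homv_x _ _) (homv_x _ _) hm).
Qed.

Lemma weightv_f i l m : weightv rho l m -> weightv rho (l - alpha i) (rho (sp_f k i) m).
Proof.
move=> hm; have [[j ij]|iE] := short_or_long i.
  rewrite (sp_f_short k ij) (alpha_short ij) opprD -!sgn_deltaN addrA addrAC /=.
  exact: (weightv_op (homv_x _ _) (homv_y _ _) hm).
have two0 : (2%:R : k) != 0 by rewrite natr0.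
have -> : sp_f k i = (2%:R)^-1 *: sp_quad (yvec k i) (yvec k i).
  by rewrite -(sp_f_long k iE) scalerA mulVf // scale1r.
rewrite lact_scale (alpha_long iE) opprD -!sgn_deltaN addrA /=; apply: weightvZ.
exact: (weightv_op (homv_y _ _) (homv_y _ _) hm).
Qed.

Lemma weightv_h i l m : weightv rho l m -> weightv rho l (rho (sp_h k i) m).
Proof.
move=> hm; have [[j ij]|iE] := short_or_long i.
  rewrite (sp_h_short k ij) lact_add lact_opp -!/(quad_op rho _ _ _) !hm -scalerBl.
  exact: weightvZ.
by rewrite (sp_h_long k iE) -!/(quad_op rho _ _ _) hm; apply: weightvZ.
Qed.

Lemma weightv_comp d u l m : Usp_comp d u -> weightv rho l m ->
  weightv rho (l + wdeg d) (Uact rho u m).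
Proof.
move=> [ws hw ->] hm; elim: ws hw => [_|w ws IHws] /=.
  by rewrite big_nil Uact0l; apply: weightv0.
case/andP=> /eqP wd hws; have {}IHws := IHws hws; rewrite big_cons UactD -wd.
rewrite -wd in IHws; apply: weightvD => //; clear hws IHws wd.
rewrite UactM Uact_scal; apply: weightvZ.
elim: w.2 => [|s v IHv]; first by rewrite !big_nil wdeg0 addr0 Uact1.
rewrite !big_cons UactM wdegD addrCA addrC; case: s => i /=; rewrite Uact_gen.
- by rewrite wdeg_delta; apply: weightv_e.
- by rewrite wdegN wdeg_delta; apply: weightv_f.
- by rewrite wdeg0 addr0; apply: weightv_h.
Qed.

End Module.
End Weights.

Section WordAction.
Variables (k : comNzRingType) (S : choiceType) (M : lmodType k) (act : S -> M -> M).
Hypothesis act_linear : forall s, linear (act s).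
Implicit Types (p q : freealg k S) (m : M).

Definition word_act p m : M := fext (foldr act m) p.

Lemma word_act0 m : word_act 0 m = 0. Proof. exact: linear0. Qed.
Lemma word_actD p q m : word_act (p + q) m = word_act p m + word_act q m.
Proof. exact: linearD. Qed.
Lemma word_actB p q m : word_act (p - q) m = word_act p m - word_act q m.
Proof. exact: linearB. Qed.
Lemma word_actZ c p m : word_act (c *: p) m = c *: word_act p m.
Proof. exact: linearZ. Qed.
Lemma word_act_word w m : word_act (fword k w) m = foldr act m w.
Proof. exact: fext_word. Qed.
Lemma word_act_gen s m : word_act (fgen k s) m = act s m.
Proof. exact: word_act_word. Qed.
Lemma word_act1 m : word_act 1 m = m.
Proof. by rewrite -fword_nil word_act_word. Qed.

Lemma foldr_act_linear w : linear (fun m => foldr act m w).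
Proof. by move=> c x y; elim: w => //= s w ->; rewrite act_linear. Qed.

Lemma word_act_linear p : linear (word_act p).
Proof.
elim/freealg_ind: p => [|a w p IHp] c x y.
  by rewrite !word_act0 scaler0 addr0.
rewrite !word_actD !word_actZ !word_act_word IHp foldr_act_linear.
by rewrite !scalerDr !scalerA mulrC addrACA.
Qed.

Lemma word_actr0 p : word_act p 0 = 0.
Proof.
have := word_act_linear p (-1) 0 0.
by rewrite scaleN1r oppr0 addr0 scaleN1r addNr.
Qed.

Lemma word_actM p q m : word_act (p * q) m = word_act p (word_act q m).
Proof.
elim/freealg_ind: p => [|a w p IHp]; first by rewrite mul0r !word_act0.
rewrite mulrDl !word_actD IHp -scalerAl !word_actZ; congr (_ *: _ + _).
rewrite {IHp p} word_act_word; elim/freealg_ind: q => [|b v q IHq].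
  by rewrite mulr0 !word_act0 -word_act_word word_actr0.
rewrite mulrDr !word_actD IHq -scalerAr !word_actZ -fword_cat.
by rewrite !word_act_word foldr_cat foldr_act_linear.
Qed.

Lemma word_act_gen_ideal (P : freealg k S -> Prop) :
  (forall p, P p -> forall m, word_act p m = 0) ->
  forall p, gen_ideal P p -> forall m, word_act p m = 0.
Proof.
move=> PP p Ip; apply: (Ip (fun q => forall m, word_act q m = 0)) => //.
split=> [m|x y Ix Iy m|a x Ix m|a x Ix m].
- exact: word_act0.
- by rewrite word_actD Ix Iy addr0.
- by rewrite word_actM Ix word_actr0.
- by rewrite word_actM.
Qed.

End WordAction.

Section CtildeAction.
Variables (k : fieldType) (n : nat) (im : k).
Hypothesis char0 : [pchar k] =i pred0.
Hypothesis im2 : im ^+ 2 = -1.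
Implicit Types (i j e : 'I_n) (l : {ffun 'I_n -> k}) (p : {mpoly k[n]}).
Local Notation D := (Ctilde_datum k n).
Local Notation sym := (tgw_sym {mpoly k[n]} 'I_n).

(* The homomorphism psi sends e_i and f_i to psi_coef i times X_i and Y_i. *)
Definition psi_coef i : k := if i.+1 == n then im / 2%:R else 1.

Lemma im_neq0 : im != 0.
Proof.
apply/eqP => h; have /eqP := im2; rewrite h expr0n /= eq_sym oppr_eq0.
by rewrite oner_eq0.
Qed.
Lemma psi_coef_neq0 i : psi_coef i != 0.
Proof.
rewrite /psi_coef; case: ifP => _; rewrite ?oner_neq0 //.
by rewrite mulf_neq0 ?im_neq0 // invr_eq0 natr0.
Qed.

Lemma meval_t_short i j l : j = i.+1 :> nat ->
  (Ctilde_t k i).@[uval l] = (l i + 2%:R^-1) * (l j - 2%:R^-1).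
Proof.
move=> ij; have h2 : (2%:R : k) != 0 by rewrite natr0.
rewrite /Ctilde_t; case: insubP => [j' _ j'E|]; last by rewrite -ij ltn_ord.
have -> : j' = j by apply: val_inj; apply: etrans j'E (esym ij).
by rewrite mevalM mevalB !mevalXU meval1 /uval; field.
Qed.
Lemma meval_t_long i l : i.+1 = n ->
  (Ctilde_t k i).@[uval l] = (l i + 2%:R^-1) * (l i + 3%:R / 2%:R).
Proof.
move=> iE; have h2 : (2%:R : k) != 0 by rewrite natr0.
rewrite /Ctilde_t; case: insubP => [j' j'1 _|_]; first by rewrite iE ltnn in j'1.
by rewrite mevalM mevalD !mevalXU meval1 /uval; field.
Qed.

Lemma sp_br_ef0 i j : i != j -> sp_br (sp_e k i) (sp_f k j) = 0.
Proof.
move=> ij; have ji : (j == i) = false by rewrite eq_sym (negbTE ij).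
have two0 : (2%:R : k) != 0 by rewrite natr0.
have brZ a b x y : sp_br (a *: x) (b *: y) = a *: (b *: sp_br x y) :> sp k n.
  apply: val_inj; rewrite /= -!scalemxAl -!scalemxAr !scalerBr !scalerA.
  by rewrite [b * a]mulrC.
have [[i' ii']|iE] := short_or_long i; have [[j' jj']|jE] := short_or_long j.
- rewrite (sp_e_short k ii') (sp_f_short k jj') sp_br_quad ?omegaB.
  have -> : (i' == j') = false.
    by apply: contraNF ij => /eqP h; apply/eqP/val_inj/succn_inj; rewrite -ii' -jj' h.
  by rewrite (negbTE ij) ?oppr0 !scale0r !addr0.
- apply: (scalerI two0); rewrite scaler0 -[LHS]scale1r -brZ scale1r.
  rewrite (sp_f_long k jE) (sp_e_short k ii') sp_br_quad ?omegaB.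
  by rewrite (negbTE ij) ?oppr0 !scale0r !addr0.
- have m20 : (-2%:R : k) != 0 by rewrite oppr_eq0.
  apply: (scalerI m20); rewrite scaler0 -[sp_br _ _]scale1r -brZ scale1r.
  rewrite (sp_e_long k iE) (sp_f_short k jj') sp_br_quad ?omegaB.
  by rewrite (negbTE ij) ?oppr0 !scale0r !addr0.
- by case/eqP: ij; apply: val_inj; apply: succn_inj; rewrite iE jE.
Qed.

Section Module.
Variables (M : lmodType k) (rho : lie_module (@sp_br k n) M).
Implicit Types (m : M).
Hypothesis span : forall m, exists2 s : seq M,
  forall x, x \in s -> exists l, weightv rho l x & m = \sum_(x <- s) x.
Hypothesis osc : forall i l m, weightv rho l m ->
  rho (sp_f k i) (rho (sp_e k i) m) = (psi_coef i ^+ 2 * (Ctilde_t k i).@[uval l]) *: m.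

(** The factors are forced: [psi_coef i] times [X_i] has to act as [e_i], and [psi_coef i] times
    [Y_i] as [f_i]. *)
Definition sym_act (s : sym) m : M :=
  match s with
  | inl r => Uact rho (Usp_R r) m
  | inr (inl i) => (psi_coef i)^-1 *: rho (sp_e k i) m
  | inr (inr i) => (psi_coef i)^-1 *: rho (sp_f k i) m
  end.

Lemma sym_act_linear s : linear (sym_act s).
Proof.
case: s => [r|[i|i]] c x y /=; first exact: Uact_linear.
  by rewrite lact_linearr scalerDr !scalerA mulrC.
by rewrite lact_linearr scalerDr !scalerA mulrC.
Qed.

Lemma weightv_sym s l m : weightv rho l m -> weightv rho (l + wdeg k (tgw_deg s)) (sym_act s m).
Proof.
move=> hm; case: s => [r|[i|i]] /=.
- by rewrite wdeg0 addr0 (Uact_R r hm); apply: weightvZ.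
- by rewrite wdeg_delta; apply: weightvZ; apply: weightv_e.
- by rewrite wdegN wdeg_delta; apply: weightvZ; apply: weightv_f.
Qed.

(** The value of [[e_i, f_i]] that the TGW relations predict; it turns the relation for [Y_i X_i]
    into the one for [X_i Y_i]. At the long root it rests on [psi_coef i ^ 2 = -1/4]. *)
Lemma lact_h i l m : weightv rho l m -> rho (sp_h k i) m =
  (psi_coef i ^+ 2 * ((Ctilde_t k i).@[uval (l - alpha k i)] - (Ctilde_t k i).@[uval l])) *: m.
Proof.
move=> hm; have h2 : (2%:R : k) != 0 by rewrite natr0.
have [[j ij]|iE] := short_or_long i.
  rewrite (sp_h_short k ij) lact_add lact_opp -!/(quad_op rho _ _ _) !hm -scalerBl.
  rewrite !(meval_t_short _ ij) (alpha_short _ ij) !ffunE !eqxx /=.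
  have ji : (j == i) = false by rewrite -(inj_eq val_inj) /= ij gtn_eqF.
  rewrite ji eq_sym ji /psi_coef -ij ltn_eqF //; congr (_ *: _).
  by rewrite expr0 expr1 !mulr0n; field.
rewrite (sp_h_long k iE) -!/(quad_op rho _ _ _) hm !(meval_t_long _ iE) (alpha_long _ iE).
rewrite !ffunE eqxx /psi_coef iE eqxx exprMn im2 /=; congr (_ *: _).
by rewrite expr0; field.
Qed.

Lemma word_act_rel (p : freealg k sym) : tgw_rel D p -> forall m, word_act sym_act p m = 0.
Proof.
move=> rel m; suff W l x : weightv rho l x -> word_act sym_act p x = 0.
  have [s hs ->] := span m; elim: s hs => [|x s IHs] hs.
    by rewrite big_nil word_actr0 //; apply: sym_act_linear.
  rewrite big_cons -[x]scale1r (word_act_linear sym_act_linear) scale1r.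
  have [|l hx] := hs x; first by rewrite inE eqxx.
  rewrite (W _ _ hx) add0r; apply: IHs => y ys; apply: hs; by rewrite inE ys orbT.
move=> {m} hx; have lin := sym_act_linear; case: rel => [a r r'||r r'|i r|i r|i|i|i j ij].
- rewrite word_actB word_actD word_actZ !word_act_gen /= !(Uact_R _ hx) scalerA.
  by rewrite -scalerDl -scalerBl mevalD mevalZ subrr scale0r.
- by rewrite word_actB word_act1 word_act_gen /= (Uact_R _ hx) meval1 scale1r subrr.
- rewrite word_actB word_actM // !word_act_gen /= !(Uact_R _ hx) UactZ (Uact_R _ hx).
  by rewrite scalerA mulrC mevalM -scalerBl subrr scale0r.
- rewrite word_actB !word_actM // !word_act_gen /= (Uact_R _ hx) UactZ.
  rewrite (Uact_R _ (weightv_e char0 i hx)) meval_sigma.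
  have := lact_linearr rho (sp_e k i) r.@[uval l] x 0.
  by rewrite addr0 lactr0 addr0 => ->; rewrite !scalerA mulrC subrr.
- rewrite word_actB !word_actM // !word_act_gen /= (Uact_R _ hx) UactZ.
  rewrite (Uact_R _ (weightv_f char0 i hx)) meval_sigmaV.
  have := lact_linearr rho (sp_f k i) r.@[uval l] x 0.
  by rewrite addr0 lactr0 addr0 => ->; rewrite !scalerA mulrC subrr.
- rewrite word_actB !word_actM // !word_act_gen /= (Uact_R _ hx).
  have := lact_linearr rho (sp_f k i) (psi_coef i)^-1 (rho (sp_e k i) x) 0.
  rewrite addr0 lactr0 addr0 => ->; rewrite (osc i hx) !scalerA -scalerBl.
  by rewrite [X in X *: _](_ : _ = 0) ?scale0r //; field; apply: psi_coef_neq0.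
- rewrite word_actB !word_actM // !word_act_gen /= (Uact_R _ hx).
  have := lact_linearr rho (sp_e k i) (psi_coef i)^-1 (rho (sp_f k i) x) 0.
  rewrite addr0 lactr0 addr0 => ->; rewrite lact_comm sp_br_ef (osc i hx) (lact_h i hx).
  have -> : (Ctilde_sigma i (Ctilde_t k i)).@[uval l] = (Ctilde_t k i).@[uval (l - alpha k i)].
    by rewrite -{1}[l](subrK (alpha k i)) meval_sigma.
  rewrite -scalerDl !scalerA -scalerBl.
  by rewrite [X in X *: _](_ : _ = 0) ?scale0r //; field; apply: psi_coef_neq0.
- rewrite word_actB !word_actM // !word_act_gen /=.
  have := lact_linearr rho (sp_e k i) (psi_coef j)^-1 (rho (sp_f k j) x) 0.
  have := lact_linearr rho (sp_f k j) (psi_coef i)^-1 (rho (sp_e k i) x) 0.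
  rewrite !addr0 !lactr0 !addr0 => -> ->.
  by rewrite lact_comm sp_br_ef0 // lact0 addr0 !scalerA mulrC subrr.
Qed.

End Module.
End CtildeAction.

(** * The degree zero part of the TGW construction *)

Section TGWDegreeZero.
Variables (k : comNzRingType) (R : algType k) (I : finType) (D : tgw_datum R I).
Implicit Types (r : R) (i j : I) (xs ys : seq I).
Local Notation cons := (tgw_cons D).
Local Notation pi := (tgw_cons_pi D).
Local Notation g s := (tgw_cons_pi D (fgen k s)).
Local Notation cR r := (tgw_cons_pi D (fgen k (@sym_R k R I r))).
Local Notation cX i := (tgw_cons_pi D (fgen k (@sym_X k R I i))).
Local Notation cY i := (tgw_cons_pi D (fgen k (@sym_Y k R I i))).

Lemma cons_rel p : tgw_rel D p -> pi p = 0.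
Proof. by move=> h; apply/quot_pi_eq0; apply: gen_idealW. Qed.

Let relE p q : tgw_rel D (p - q) -> pi p = pi q.
Proof. by move/cons_rel/eqP; rewrite (rmorphB pi) subr_eq0 => /eqP. Qed.

Lemma cons_lin a r r' : cR (a *: r + r') = pi a%:A * cR r + cR r'.
Proof. by rewrite -rmorphM -rmorphD mulr_algl; apply: relE; apply: tgw_rel_lin. Qed.
Lemma cons_1 : cR 1 = 1.
Proof. by rewrite -(rmorph1 pi); apply: relE; apply: tgw_rel_one. Qed.
Lemma cons_RM r r' : cR (r * r') = cR r * cR r'.
Proof. by rewrite -rmorphM; apply: relE; apply: tgw_rel_mul. Qed.
Lemma cons_XR i r : cX i * cR r = cR (tgw_sigma D i r) * cX i.
Proof. by rewrite -!rmorphM; apply: relE; apply: tgw_rel_Xr. Qed.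
Lemma cons_YR i r : cY i * cR r = cR (tgw_sigmaV D i r) * cY i.
Proof. by rewrite -!rmorphM; apply: relE; apply: tgw_rel_Yr. Qed.
Lemma cons_YX i : cY i * cX i = cR (tgw_t D i).
Proof. by rewrite -!rmorphM; apply: relE; apply: tgw_rel_YX. Qed.
Lemma cons_XY i : cX i * cY i = cR (tgw_sigma D i (tgw_t D i)).
Proof. by rewrite -!rmorphM; apply: relE; apply: tgw_rel_XY. Qed.
Lemma cons_XYC i j : i != j -> cX i * cY j = cY j * cX i.
Proof. by move=> ij; rewrite -!rmorphM; apply: relE; apply: tgw_rel_XYC. Qed.

Lemma cons_R0 : cR 0 = 0.
Proof.
have := cons_lin (-1) 0 0; rewrite scaler0 addr0 scaleN1r rmorphN rmorph1 mulN1r.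
by rewrite addNr.
Qed.
Lemma cons_RA a : cR a%:A = pi a%:A.
Proof. by have := cons_lin a 1 0; rewrite addr0 cons_1 mulr1 cons_R0 addr0. Qed.
Lemma cons_RD r r' : cR (r + r') = cR r + cR r'.
Proof. by have := cons_lin 1 r r'; rewrite scale1r scale1r rmorph1 mul1r. Qed.

Local Notation PX xs := (\prod_(i <- xs) cX i).
Local Notation PY ys := (\prod_(i <- ys) cY i).
Definition delta_deg i : {ffun I -> int} := [ffun j => (j == i)%:R].
Local Notation dg xs := (\sum_(i <- xs) delta_deg i).

Lemma prodX_R xs r : exists r', PX xs * cR r = cR r' * PX xs.
Proof.
elim: xs r => [|i xs IHxs] r; first by exists r; rewrite !big_nil mul1r mulr1.
have [r' h] := IHxs r; exists (tgw_sigma D i r').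
by rewrite !big_cons -mulrA h mulrA cons_XR mulrA.
Qed.
Lemma prodY_R ys r : exists r', PY ys * cR r = cR r' * PY ys.
Proof.
elim: ys r => [|i ys IHys] r; first by exists r; rewrite !big_nil mul1r mulr1.
have [r' h] := IHys r; exists (tgw_sigmaV D i r').
by rewrite !big_cons -mulrA h mulrA cons_YR mulrA.
Qed.

(** No relation lets the [X_i] change places, but [Y_j] can move left until it meets some [X_j],
    with which it merges into an element of [R]; that element then moves to the front. *)
Lemma prodX_Y xs j : PX xs * cY j = cY j * PX xs \/
  exists r xs', PX xs * cY j = cR r * PX xs' /\ dg xs = dg xs' + delta_deg j.
Proof.
elim: xs => [|i xs [IHxs|[r [xs' [h1 h2]]]]]; first by left; rewrite big_nil mul1r mulr1.
- rewrite !big_cons -mulrA IHxs mulrA.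
  have [->|ij] := eqVneq i j; last by left; rewrite cons_XYC // mulrA.
  by right; exists (tgw_sigma D j (tgw_t D j)), xs; rewrite cons_XY addrC.
- right; exists (tgw_sigma D i r), (i :: xs'); rewrite !big_cons -mulrA h1 mulrA.
  by rewrite cons_XR h2 mulrA addrA.
Qed.

Lemma Y_prodX xs j : j \notin xs \/
  exists r xs', cY j * PX xs = cR r * PX xs' /\ dg xs = dg xs' + delta_deg j.
Proof.
elim: xs => [|i xs IHxs]; first by left.
have [->|ij] := eqVneq i j.
  by right; exists (tgw_t D j), xs; rewrite !big_cons mulrA cons_YX addrC.
case: IHxs => [jxs|[r [xs' [h1 h2]]]].
  by left; rewrite inE negb_or eq_sym ij.
right; exists (tgw_sigma D i r), (i :: xs').
by rewrite !big_cons mulrA -cons_XYC // -mulrA h1 mulrA cons_XR h2 mulrA addrA.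
Qed.

Lemma word_YX (w : seq (tgw_sym R I)) : exists r ys xs,
  \prod_(s <- w) g s = cR r * PY ys * PX xs /\ \sum_(s <- w) tgw_deg s = dg xs - dg ys.
Proof.
elim/last_ind: w => [|w s [r [ys [xs [h1 h2]]]]].
  by exists 1, [::], [::]; rewrite !big_nil cons_1 !mulr1 subrr.
rewrite -cats1 !big_cat !big_seq1 /= h1 h2; case: s => [r'|[j|j]] /=.
- have [r1 e1] := prodX_R xs r'; have [r2 e2] := prodY_R ys r1.
  exists (r * r2), ys, xs; rewrite addr0 cons_RM; split=> //.
  by rewrite -mulrA e1 !mulrA -[_ * cR r1]mulrA e2 !mulrA.
- exists r, ys, (rcons xs j); rewrite -!cats1 !big_cat !big_seq1 /= -!mulrA; split=> //.
  by rewrite addrAC.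
- have [e|[r1 [xs' [e1 e2]]]] := prodX_Y xs j.
    exists r, (rcons ys j), xs; rewrite -!cats1 !big_cat !big_seq1 /= -!mulrA e; split=> //.
    by rewrite opprD addrA.
  have [r2 e3] := prodY_R ys r1.
  exists (r * r2), ys, xs'; rewrite cons_RM -!mulrA e1 e2; split; last first.
    by rewrite addrAC addrK.
  by rewrite [PY ys * (cR r1 * _)]mulrA e3 !mulrA.
Qed.

Lemma dg_count xs j : dg xs j = (count_mem j xs)%:R.
Proof.
elim: xs => [|i xs IHxs]; first by rewrite big_nil ffunE.
by rewrite big_cons ffunE IHxs ffunE /= natrD eq_sym.
Qed.

(** The last [Y_j] is adjacent to the product of the [X_i]. Equality of degrees puts an [X_j] among
    these, and the pair collapses into [R]. *)
Lemma YX_degree0 ys xs : dg xs = dg ys -> exists r, PY ys * PX xs = cR r.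
Proof.
elim/last_ind: ys xs => [|ys j IHys] xs.
  case: xs => [_|i xs]; first by exists 1; rewrite !big_nil mulr1 cons_1.
  by move=> /ffunP/(_ i); rewrite !dg_count /= eqxx !natz.
move=> h; case: (Y_prodX xs j) => [jxs|[r [xs' [h1 h2]]]].
  move/ffunP/(_ j): h; rewrite !dg_count (count_memPn jxs) -cats1 count_cat /= eqxx.
  by rewrite addnC !natz.
have [|r' hr'] := IHys xs'.
  move: h; rewrite h2 -cats1 big_cat big_seq1 /=; exact: addIr.
have [r2 h3] := prodY_R ys r.
exists (r2 * r'); rewrite -cats1 big_cat big_seq1 /= -mulrA h1 mulrA h3 -mulrA hr'.
by rewrite cons_RM.
Qed.

(** It reduces questions in degree zero to polynomials, which are decided by their values on
    weights. *)
Lemma cons_degree0 x : tgw_cons_comp 0 x -> exists r, x = cR r.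
Proof.
move=> [ws hw ->]; elim: ws hw => [_|w ws IHws /= /andP[/eqP w0 /IHws[r' e]]].
  by exists 0; rewrite big_nil cons_R0.
have [r [ys [xs [h1 h2]]]] := word_YX w.2.
have [|r1 hr1] := @YX_degree0 ys xs.
  by apply/eqP; rewrite -subr_eq0 -h2 w0.
exists (w.1%:A * (r * r1) + r'); rewrite cons_RD big_cons e; congr (_ + _).
by rewrite h1 -mulrA hr1 -cons_RM -cons_RA -cons_RM.
Qed.

Lemma cons_scal1 : pi (1%:A) = 1. Proof. by rewrite scale1r rmorph1. Qed.
Lemma cons_scalM (a b : k) : pi ((a * b)%:A) = pi a%:A * pi b%:A.
Proof. by rewrite -rmorphM -scalerA mulr_algl. Qed.
Lemma cons_scalC (a : k) (x : cons) : pi a%:A * x = x * pi a%:A.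
Proof.
by rewrite -[x]tgw_cons_reprK -!rmorphM mulr_algl mulr_algr.
Qed.

Lemma cons_comp_gen (s : tgw_sym R I) : @tgw_cons_comp k R I D (tgw_deg s) (g s).
Proof.
exact: (@gcomp_gen k cons (fun a => pi a%:A) _ (fun s => g s) _ (@tgw_deg k R I) cons_scal1).
Qed.
Lemma cons_compM d e (x y : cons) :
  tgw_cons_comp d x -> tgw_cons_comp e y -> tgw_cons_comp (d + e) (x * y).
Proof. exact: (gcompM cons_scalM cons_scalC). Qed.
Lemma cons_comp_scal (a : k) : @tgw_cons_comp k R I D 0 (pi a%:A).
Proof. exact: (@gcomp_c k cons (fun a => pi a%:A)). Qed.
Lemma cons_comp_scalM d (a : k) (x : cons) :
  tgw_cons_comp d x -> tgw_cons_comp d (pi a%:A * x).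
Proof. by rewrite -[X in _ -> tgw_cons_comp X _]add0r; apply/cons_compM/cons_comp_scal. Qed.
Lemma cons_comp_prod (w : seq (tgw_sym R I)) :
  @tgw_cons_comp k R I D (\sum_(s <- w) tgw_deg s) (\prod_(s <- w) g s).
Proof.
elim: w => [|s w IHw]; first by rewrite !big_nil -cons_scal1; apply: cons_comp_scal.
by rewrite !big_cons; apply: cons_compM => //; apply: cons_comp_gen.
Qed.

Lemma cons_span (x : cons) :
  gspan (fun a : k => pi a%:A) (fun s => g s) x.
Proof.
rewrite -[x]tgw_cons_reprK; elim/freealg_ind: (tgw_cons_repr x) => [|a w p IHp].
  by rewrite rmorph0; apply: gspan0.
rewrite rmorphD; apply: gspanD => //; exists [:: (a, w)]; rewrite big_seq1 /gterm /=.
rewrite -[a *: fword k w]mulr_algl rmorphM; congr (_ * _); elim: w => [|s w IHw].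
  by rewrite fword_nil rmorph1 big_nil.
by rewrite -cat1s fword_cat rmorphM IHw big_cons.
Qed.

End TGWDegreeZero.

(** * The action of the TGW construction and of its quotient *)

Section ConsAction.
Variables (k : fieldType) (n : nat) (im : k).
Hypothesis char0 : [pchar k] =i pred0.
Hypothesis im2 : im ^+ 2 = -1.
Implicit Types (i j e : 'I_n) (l : {ffun 'I_n -> k}) (d : {ffun 'I_n -> int}).
Local Notation D := (Ctilde_datum k n).
Local Notation cons := (tgw_cons D).
Local Notation pi := (tgw_cons_pi D).
Local Notation sym := (tgw_sym {mpoly k[n]} 'I_n).
Variables (M : lmodType k) (rho : lie_module (@sp_br k n) M).
Implicit Types (m : M) (x y : cons).
Hypothesis span : forall m, exists2 s : seq M,
  forall v : M, v \in s -> exists l, weightv rho l v & m = \sum_(v <- s) v.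
Hypothesis indep : forall (ls : seq {ffun 'I_n -> k}) (x : {ffun 'I_n -> k} -> M),
  uniq ls -> (forall l, weightv rho l (x l)) ->
  \sum_(l <- ls) x l = 0 -> forall l, l \in ls -> x l = 0.
Hypothesis osc : forall i l m, weightv rho l m ->
  rho (sp_f k i) (rho (sp_e k i) m) = (psi_coef im i ^+ 2 * (Ctilde_t k i).@[uval l]) *: m.

Let lin := sym_act_linear im rho.

Lemma span_ind (P : M -> Prop) : P 0 -> (forall m m', P m -> P m' -> P (m + m')) ->
  (forall l m, weightv rho l m -> P m) -> forall m, P m.
Proof.
move=> P0 PD Pw m; have [s hs ->] := span m; elim: s hs => [|x s IHs] hs.
  by rewrite big_nil.
rewrite big_cons; apply: (PD); last by apply: IHs => y ys; apply: hs; rewrite inE ys orbT.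
by have [|l hx] := hs x; [rewrite inE eqxx | apply: Pw hx].
Qed.

(** By injectivity of [wdeg], distinct degrees shift [l] to distinct weights. *)
Lemma indep_wdeg (ds : seq {ffun 'I_n -> int}) (y : {ffun 'I_n -> int} -> M) l :
  uniq ds -> (forall d, weightv rho (l + wdeg k d) (y d)) ->
  \sum_(d <- ds) y d = 0 -> forall d, d \in ds -> y d = 0.
Proof.
move=> uds hy sy d dds; pose f d := l + wdeg k d.
have f_inj : injective f by move=> d1 d2 /addrI/(wdeg_inj char0).
pose x l' := \sum_(d <- ds | f d == l') y d.
have xE d' : d' \in ds -> x (f d') = y d'.
  move=> d'ds; rewrite /x -big_filter; have -> : [seq d0 <- ds | f d0 == f d'] = [:: d'].
    rewrite (eq_filter (_ : _ =1 pred1 d')); first by rewrite filter_pred1_uniq.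
    by move=> d0 /=; rewrite (inj_eq f_inj).
  by rewrite big_seq1.
rewrite -xE //; apply: (indep (ls := map f ds)).
- by rewrite map_inj_uniq.
- move=> l'; rewrite /x; elim/big_ind: _ => //; first exact: weightv0.
    by move=> *; apply: weightvD.
  by move=> d' /eqP <-; apply: hy.
- by rewrite big_map -[RHS]sy big_seq [RHS]big_seq; apply: eq_bigr => d' /xE.
- exact: map_f.
Qed.

Definition cons_act x m : M := word_act (sym_act im rho) (tgw_cons_repr x) m.

Lemma cons_act_pi p m : cons_act (pi p) m = word_act (sym_act im rho) p m.
Proof.
apply/eqP; rewrite -subr_eq0 -word_actB; apply/eqP.
apply: (word_act_gen_ideal lin (word_act_rel char0 im2 span osc)).
exact: quot_repr_pi.
Qed.

Lemma cons_actD x y m : cons_act (x + y) m = cons_act x m + cons_act y m.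
Proof. by rewrite -{1}[x]tgw_cons_reprK -{1}[y]tgw_cons_reprK -rmorphD cons_act_pi word_actD. Qed.
Lemma cons_actM x y m : cons_act (x * y) m = cons_act x (cons_act y m).
Proof. by rewrite -{1}[x]tgw_cons_reprK -{1}[y]tgw_cons_reprK -rmorphM cons_act_pi word_actM. Qed.
Lemma cons_act0 m : cons_act 0 m = 0.
Proof. by rewrite -(rmorph0 pi) cons_act_pi word_act0. Qed.
Lemma cons_actB x y m : cons_act (x - y) m = cons_act x m - cons_act y m.
Proof. by apply: (addIr (cons_act y m)); rewrite -cons_actD !subrK. Qed.
Lemma cons_act1 m : cons_act 1 m = m.
Proof. by rewrite -(rmorph1 pi) cons_act_pi word_act1. Qed.
Lemma cons_act_scal (a : k) m : cons_act (pi a%:A) m = a *: m.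
Proof. by rewrite cons_act_pi word_actZ word_act1. Qed.
Lemma cons_act_gen s m : cons_act (pi (fgen k s)) m = sym_act im rho s m.
Proof. by rewrite cons_act_pi word_act_gen. Qed.
Lemma cons_act_linear x : linear (cons_act x). Proof. exact: word_act_linear. Qed.
Lemma cons_actr0 x : cons_act x 0 = 0. Proof. exact: word_actr0. Qed.
Lemma cons_actZ x (a : k) m : cons_act x (a *: m) = a *: cons_act x m.
Proof. by rewrite -[a *: m]addr0 cons_act_linear cons_actr0 addr0. Qed.
Lemma cons_actDr x m m' : cons_act x (m + m') = cons_act x m + cons_act x m'.
Proof. by rewrite -{1}[m]scale1r cons_act_linear scale1r. Qed.
Lemma cons_act_sum (I : Type) (r : seq I) (F : I -> cons) m :
  cons_act (\sum_(i <- r) F i) m = \sum_(i <- r) cons_act (F i) m.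
Proof. by apply: (big_morph (fun x => cons_act x m)) => [u v|]; rewrite ?cons_actD ?cons_act0. Qed.
Lemma cons_act_word (w : seq sym) m :
  cons_act (\prod_(s <- w) pi (fgen k s)) m = foldr (sym_act im rho) m w.
Proof.
elim: w => [|s w IHw]; first by rewrite big_nil cons_act1.
by rewrite big_cons cons_actM IHw cons_act_gen.
Qed.

Lemma weightv_word (w : seq sym) l m : weightv rho l m ->
  weightv rho (l + wdeg k (\sum_(s <- w) tgw_deg s)) (foldr (sym_act im rho) m w).
Proof.
move=> hm; elim: w => [|s w IHw]; first by rewrite big_nil wdeg0 addr0.
by rewrite big_cons wdegD addrCA addrC; apply: weightv_sym.
Qed.

Lemma weightv_cons d x l m : tgw_cons_comp d x -> weightv rho l m ->
  weightv rho (l + wdeg k d) (cons_act x m).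
Proof.
move=> [ws hw ->] hm; rewrite cons_act_sum.
elim: ws hw => [_|w ws IHws /= /andP[/eqP wd hws]].
  by rewrite big_nil; apply: weightv0.
rewrite big_cons; apply: weightvD; last exact: IHws.
rewrite cons_actM cons_act_scal; apply: weightvZ.
by rewrite cons_act_word -wd; apply: weightv_word.
Qed.

(** This makes the kernel of the action a graded ideal. *)
Lemma cons_act_decomp (ds : seq {ffun 'I_n -> int}) (xs : {ffun 'I_n -> int} -> cons) :
  uniq ds -> (forall d, tgw_cons_comp d (xs d)) ->
  (forall m, cons_act (\sum_(d <- ds) xs d) m = 0) ->
  forall d, d \in ds -> forall m, cons_act (xs d) m = 0.
Proof.
move=> uds hxs h d dds; apply: span_ind; first exact: cons_actr0.
  by move=> m m' hm hm'; rewrite cons_actDr hm hm' addr0.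
move=> l m hm; apply: (indep_wdeg (l := l) (y := fun d => cons_act (xs d) m) uds) dds.
  by move=> d'; apply: weightv_cons.
by rewrite -cons_act_sum h.
Qed.

Lemma cons_act_R r l m : weightv rho l m ->
  cons_act (pi (fgen k (sym_R 'I_n r))) m = r.@[uval l] *: m.
Proof. by move=> hm; rewrite cons_act_gen /= (Uact_R _ hm). Qed.

(** The effect of [psi] on operators, stated before the quotient by the radical and before [psi] is
    known to exist. *)
Lemma Uact_cons d u : Usp_comp d u -> exists2 x, tgw_cons_comp d x &
  forall m, Uact rho u m = cons_act x m.
Proof.
move=> [ws hw ->]; elim: ws hw => [_|w ws IHws /= /andP[/eqP wd /IHws[x hx xE]]].
  exists 0; first exact: gcomp0.
  by move=> m; rewrite big_nil Uact0l cons_act0.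
have [y hy yE] : exists2 y, tgw_cons_comp (\sum_(s <- w.2) chevalley_deg s) y &
    forall m, Uact rho (\prod_(s <- w.2) chevalley_gen k s) m = cons_act y m.
  elim: w.2 => [|s v [y hy yE]].
    exists 1; first by rewrite big_nil -(cons_scal1 D); apply: cons_comp_scal.
    by move=> m; rewrite big_nil Uact1 cons_act1.
  have [z hz zE] : exists2 z, tgw_cons_comp (chevalley_deg s) z &
      forall m, Uact rho (chevalley_gen k s) m = cons_act z m.
    case: s => i /=.
    - exists (pi (psi_coef im i)%:A * pi (fgen k (sym_X _ i))).
        apply: cons_comp_scalM; exact: (cons_comp_gen D (sym_X _ i)).
      move=> m; rewrite cons_actM cons_act_scal cons_act_gen /= scalerA divff ?psi_coef_neq0 //.
      by rewrite scale1r Uact_gen.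
    - exists (pi (psi_coef im i)%:A * pi (fgen k (sym_Y _ i))).
        apply: cons_comp_scalM; exact: (cons_comp_gen D (sym_Y _ i)).
      move=> m; rewrite cons_actM cons_act_scal cons_act_gen /= scalerA divff ?psi_coef_neq0 //.
      by rewrite scale1r Uact_gen.
    - have [p pE] : exists p, Usp_R p = Uh k i.
        have [[j ij]|iE] := short_or_long i; first by eexists; apply: Usp_R_h ij.
        by eexists; apply: Usp_R_hn iE.
      exists (pi (fgen k (sym_R _ p))); first exact: (cons_comp_gen D (sym_R _ p)).
      by move=> m; rewrite cons_act_gen /= pE.
  exists (z * y); first by rewrite big_cons; apply: cons_compM.
  by move=> m; rewrite big_cons UactM yE zE cons_actM.
rewrite wd in hy; exists (pi w.1%:A * y + x).
  by apply: gcompD => //; apply: cons_comp_scalM.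
by move=> m; rewrite big_cons UactD xE UactM Uact_scal yE cons_actD cons_actM cons_act_scal.
Qed.

(* What makes negligible ideals act by zero: an element of degree [d] acting nontrivially
   can be brought back to a nontrivial action in degree zero. *)
Hypothesis ret : forall l m d x, weightv rho l m -> tgw_cons_comp d x ->
  cons_act x m <> 0 -> exists2 y, tgw_cons_comp (- d) y & cons_act y (cons_act x m) <> 0.

Lemma negligible_act J x m : tgw_negligible J -> J x -> cons_act x m = 0.
Proof.
move=> [[tJ gJ] J0] Jx; have [s hs ->] := gJ _ Jx; rewrite cons_act_sum.
rewrite big_seq big1 // => y /hs[Jy [d yd]]; move: m.
apply: span_ind; first exact: cons_actr0.
  by move=> m m' hm hm'; rewrite cons_actDr hm hm' addr0.
move=> l m hm; apply: contrapT => nz; have [z hz] := ret hm yd nz; apply.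
rewrite -cons_actM (J0 (z * y)) ?cons_act0 //; first exact: (two_sidedMl tJ).
by rewrite -(addNr d); apply: cons_compM.
Qed.

Lemma rad_act x m : tgw_rad D x -> cons_act x m = 0.
Proof.
move=> [s hs ->]; rewrite cons_act_sum big_seq big1 // => y /hs[J nJ Jy].
exact: negligible_act nJ Jy.
Qed.

Definition A_act (a : ACtilde k n) m : M := cons_act (tgw_repr a) m.

Lemma A_act_pi x m : A_act (tgw_pi x) m = cons_act x m.
Proof.
apply/eqP; rewrite -subr_eq0 /A_act -cons_actB; apply/eqP/rad_act.
exact: quot_repr_pi.
Qed.

Lemma A_actD a b m : A_act (a + b) m = A_act a m + A_act b m.
Proof. by rewrite -{1}[a]tgw_reprK -{1}[b]tgw_reprK -rmorphD A_act_pi cons_actD. Qed.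
Lemma A_actM a b m : A_act (a * b) m = A_act a (A_act b m).
Proof. by rewrite -{1}[a]tgw_reprK -{1}[b]tgw_reprK -rmorphM A_act_pi cons_actM. Qed.
Lemma A_act0 m : A_act 0 m = 0.
Proof. by rewrite -(rmorph0 (@tgw_pi _ _ _ D)) A_act_pi cons_act0. Qed.

End ConsAction.

(** * The oscillator representation *)

Section QuadraticOperators.
Variables (k : fieldType) (n : nat) (im : k) (V : lmodType k).
Variable w : 'I_(n + n) -> V -> V.
Hypothesis w_linear : forall a, linear (w a).
Hypothesis w_comm : forall a b f, w a (w b f) = w b (w a f) - (im * sp_form k n a b) *: f.
Hypothesis im2 : im ^+ 2 = -1.
Hypothesis two0 : (2%:R : k) != 0.
Implicit Types (f : V) (G : 'M[k]_(n + n)) (X Y : sp k n).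

Let w0 a : w a 0 = 0.
Proof. by have := w_linear a (-1) 0 0; rewrite scaler0 addr0 scaleN1r addNr. Qed.
Let wZ a c f : w a (c *: f) = c *: w a f.
Proof. by rewrite -[c *: f]addr0 w_linear w0 addr0. Qed.
Let wD a f f' : w a (f + f') = w a f + w a f'.
Proof. by rewrite -{1}[f]scale1r w_linear scale1r. Qed.
Let w_sum a (I : finType) (F : I -> V) : w a (\sum_i F i) = \sum_i w a (F i).
Proof. by apply: (big_morph (w a)) => [x y|]; rewrite ?wD ?w0. Qed.

Definition quad_sum G f : V := \sum_a \sum_b G a b *: w a (w b f).

Lemma quad_sum_linearl f : linear (quad_sum^~ f).
Proof.
move=> c G H; rewrite /quad_sum scaler_sumr -big_split; apply: eq_bigr => a _ /=.
rewrite scaler_sumr -big_split; apply: eq_bigr => b _ /=.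
by rewrite !mxE scalerDl scalerA.
Qed.
Lemma quad_sum_linearr G : linear (quad_sum G).
Proof.
move=> c f f'; rewrite /quad_sum scaler_sumr -big_split; apply: eq_bigr => a _ /=.
rewrite scaler_sumr -big_split; apply: eq_bigr => b _ /=.
by rewrite !w_linear scalerDr !scalerA mulrC.
Qed.

(** The symmetric matrix of [x], read as a quadratic form in the operators [w a]. The scalar factor
    is the one that makes [osc_op_w] hold. *)
Definition osc_op (x : sp k n) f : V :=
  - (im / 2%:R) *: quad_sum ((x : 'M_(n + n)) *m sp_form k n) f.

(** Under commutators with [osc_op x] the operators [w c] transform as the basis of the natural
    representation. *)
Lemma osc_op_w (x : sp k n) c f : osc_op x (w c f) =
  w c (osc_op x f) + \sum_a (x : 'M_(n + n)) a c *: w a f.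
Proof.
pose G := (x : 'M_(n + n)) *m sp_form k n.
have E : quad_sum G (w c f) = w c (quad_sum G f) - (2%:R * im) *:
    \sum_a (G *m sp_form k n) a c *: w a f.
  rewrite /quad_sum w_sum.
  have -> : \sum_a w c (\sum_b G a b *: w a (w b f)) =
            \sum_a \sum_b G a b *: w c (w a (w b f)).
    by apply: eq_bigr => a _; rewrite w_sum; apply: eq_bigr => b _; rewrite wZ.
  have -> : \sum_a \sum_b G a b *: w a (w b (w c f)) =
      \sum_a \sum_b G a b *: w c (w a (w b f)) -
      (\sum_a \sum_b (im * (G a b * sp_form k n a c)) *: w b f +
       \sum_a \sum_b (im * (G a b * sp_form k n b c)) *: w a f).
    rewrite -big_split -sumrB; apply: eq_bigr => a _ /=.
    rewrite -big_split -sumrB; apply: eq_bigr => b _ /=.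
    rewrite (w_comm b c) -scaleNr wD wZ (w_comm a c) !scalerDr -!scaleNr !scalerA.
    rewrite -addrA; congr (_ + _); rewrite -!scaleN1r !scalerDr !scalerA.
    by congr (_ *: _ + _ *: _); ring.
  congr (_ - _); rewrite exchange_big -big_split scaler_sumr; apply: eq_bigr => a _ /=.
  rewrite -big_split /= scalerA mxE mulr_sumr scaler_suml; apply: eq_bigr => b _.
  have GT : G b a = G a b by have /matrixP/(_ a b) := sp_form_sym x; rewrite mxE.
  by rewrite GT -scalerDl; congr (_ *: _); ring.
rewrite /osc_op -/G E scalerBr wZ; congr (_ + _).
rewrite scalerA -scaleNr.
have -> : G *m sp_form k n = - (x : 'M_(n + n)) by rewrite -mulmxA sp_formK mulmxN mulmx1.
have -> : - (- (im / 2%:R) * (2%:R * im)) = -1 by rewrite -im2; field.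
rewrite scaleN1r -sumrN; apply: eq_bigr => a _; by rewrite mxE scaleNr opprK.
Qed.

Lemma osc_op_br (x y : sp k n) f :
  osc_op (sp_br x y) f = osc_op x (osc_op y f) - osc_op y (osc_op x f).
Proof.
have oD z g g' : osc_op z (g + g') = osc_op z g + osc_op z g'.
  by rewrite /osc_op -{1}[g]scale1r quad_sum_linearr scale1r scalerDr.
have o0 z : osc_op z 0 = 0 by apply: (addrI (osc_op z 0)); rewrite -oD !addr0.
have oZ z c g : osc_op z (c *: g) = c *: osc_op z g.
  rewrite /osc_op -[c *: g]addr0 quad_sum_linearr scalerDr !scalerA mulrC.
  by have := o0 z; rewrite /osc_op => ->; rewrite addr0.
have o_sum z (I : finType) (F : I -> V) : osc_op z (\sum_i F i) = \sum_i osc_op z (F i).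
  by apply: (big_morph (osc_op z)).
pose X := x : 'M_(n + n); pose Y := y : 'M_(n + n).
pose H := Y *m sp_form k n.
(* By [osc_op_w] the operator of [x] acts as a derivation on the products of two [w], which replaces
   the coefficient matrix [H] by [H X^T + X H]. *)
have key : osc_op x (quad_sum H f) = quad_sum H (osc_op x f) + quad_sum (H *m X^T + X *m H) f.
  rewrite {1}/quad_sum o_sum.
  under eq_bigr => a _ do rewrite o_sum.
  under eq_bigr => a _ do under eq_bigr => b _ do
    rewrite oZ osc_op_w osc_op_w wD w_sum !scalerDr -addrA.
  under eq_bigr => a _ do rewrite big_split.
  rewrite big_split /=; congr (_ + _).
  under eq_bigr => a _ do rewrite big_split.
  rewrite big_split /= -[H *m X^T]scale1r quad_sum_linearl scale1r; congr (_ + _).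
    apply: eq_bigr => a _.
    under eq_bigr => b _ do rewrite scaler_sumr.
    rewrite exchange_big; apply: eq_bigr => c _ /=.
    under eq_bigr => b _ do rewrite wZ scalerA.
    by rewrite -scaler_suml mxE; congr (_ *: _); apply: eq_bigr => b _; rewrite [X^T b c]mxE.
  under eq_bigr => a _ do under eq_bigr => b _ do rewrite scaler_sumr.
  rewrite /quad_sum.
  under [RHS]eq_bigr => c _ do under eq_bigr => b _ do rewrite mxE scaler_suml.
  rewrite exchange_big /=; under eq_bigr => b _ do rewrite exchange_big /=.
  rewrite exchange_big /=; apply: eq_bigr => c _; apply: eq_bigr => b _.
  by apply: eq_bigr => a _; rewrite scalerA mulrC.
rewrite {3}/osc_op oZ key.
have -> : H *m X^T + X *m H = (sp_br x y : 'M_(n + n)) *m sp_form k n.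
  have XT : sp_form k n *m X^T = - (X *m sp_form k n).
    by rewrite -[X in - X](sp_form_sym x) trmx_mul sp_formT mulNmx opprK.
  by rewrite /H -mulmxA XT mulmxN addrC mulmxBl !mulmxA.
by rewrite scalerDr [RHS]addrAC subrr add0r.
Qed.

End QuadraticOperators.

Section Oscillator.
Variables (k : fieldType) (n : nat) (im : k).
Hypothesis char0 : [pchar k] =i pred0.
Hypothesis im2 : im ^+ 2 = -1.
Local Notation P := {mpoly k[n]}.
Implicit Types (i j : 'I_n) (f : P) (a b m : 'X_{1..n}).

(** With the factor [im] on the derivatives both [e_n] and [f_n] carry the coefficient [im / 2] that
    [psi] prescribes, so that [X_n] and [Y_n] act as the plain squares of multiplication and of
    differentiation. *)
Definition weyl_op (a : 'I_(n + n)) f : P :=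
  match split a with inl i => 'X_i * f | inr i => im *: f^`M(i) end.

Lemma weyl_opl i f : weyl_op (lshift n i) f = 'X_i * f.
Proof. by rewrite /weyl_op -[lshift n i]/(unsplit (inl i)) unsplitK. Qed.
Lemma weyl_opr i f : weyl_op (rshift n i) f = im *: f^`M(i).
Proof. by rewrite /weyl_op -[rshift n i]/(unsplit (inr i)) unsplitK. Qed.

Lemma weyl_op_linear (a : 'I_(n + n)) : linear (weyl_op a).
Proof.
case: (split_ordP a) => i -> c f g; rewrite ?weyl_opl ?weyl_opr.
  by rewrite mulrDr scalerAr.
by rewrite linearP scalerDr !scalerA mulrC.
Qed.

Lemma mderiv_mulX i j f : ('X_i * f)^`M(j) = (i == j)%:R *: f + 'X_i * f^`M(j).
Proof.
rewrite mderivM mderivX mnm1E; congr (_ + _).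
have [<-|_] := eqVneq i j; last by rewrite !scale0r mul0r.
have -> : (U_(i) - U_(i))%MM = 0%MM :> 'X_{1..n} by apply/mnmP=> e; rewrite mnmBE subnn mnm0E.
by rewrite mpolyX0 !scale1r mul1r.
Qed.

Lemma weyl_op_comm (a b : 'I_(n + n)) f :
  weyl_op a (weyl_op b f) = weyl_op b (weyl_op a f) - (im * sp_form k n a b) *: f.
Proof.
rewrite /sp_form; case: (split_ordP a) => i ->; case: (split_ordP b) => j ->;
  rewrite ?weyl_opl ?weyl_opr ?(block_mxEul, block_mxEur, block_mxEdl, block_mxEdr) !mxE.
- by rewrite mulr0 scale0r subr0 mulrCA.
- by rewrite mderiv_mulX scalerDr scalerA scalerAr [RHS]addrAC subrr add0r.
- rewrite mderiv_mulX scalerDr scalerAr scalerA [j == i]eq_sym.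
  by rewrite mulrN scaleNr opprK addrC.
- by rewrite mulr0 scale0r subr0 !mderivZ mderiv_comm.
Qed.

Local Notation osc0 := (osc_op im weyl_op).

Lemma two_neq0 : (2%:R : k) != 0. Proof. by rewrite natr0. Qed.

Fact osc_linearl f : linear (osc0^~ f).
Proof.
move=> c x y; rewrite /osc_op -[sp_val _]/(c *: sp_val x + sp_val y) mulmxDl -scalemxAl.
by rewrite quad_sum_linearl scalerDr !scalerA mulrC.
Qed.
Fact osc_linearr x : linear (osc0 x).
Proof.
move=> c f g; rewrite /osc_op (quad_sum_linearr weyl_op_linear) scalerDr !scalerA.
by rewrite mulrC.
Qed.
Definition osc_rep : lie_module (@sp_br k n) P :=
  LieModule osc_linearl osc_linearr
    (osc_op_br weyl_op_linear weyl_op_comm im2 two_neq0).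

Lemma osc_rep_quad (a b : 'I_(n + n)) f :
  osc_rep (sp_quad (delta_mx a 0) (delta_mx b 0)) f =
  - (im / 2%:R) *: (weyl_op a (weyl_op b f) + weyl_op b (weyl_op a f)).
Proof.
rewrite -[LHS]/(osc0 _ f) /osc_op; congr (_ *: _).
rewrite [_ *m _](_ : _ = delta_mx a b + delta_mx b a); last first.
  by rewrite /= -mulmxA sp_formK mulmxN mulmx1 opprK !trmx_delta !mul_delta_mx.
have E c d : quad_sum weyl_op (delta_mx c d) f = weyl_op c (weyl_op d f).
  rewrite /quad_sum (bigD1 c) //= (bigD1 d) //= mxE !eqxx scale1r.
  rewrite big1 ?addr0 => [|e ed]; last by rewrite mxE (negbTE ed) andbF scale0r.
  rewrite big1 ?addr0 // => c' cc'; rewrite big1 // => d' _.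
  by rewrite mxE (negbTE cc') scale0r.
by rewrite -[delta_mx a b]scale1r quad_sum_linearl scale1r !E.
Qed.

Lemma osc_xy i j f : osc_rep (sp_quad (xvec k i) (yvec k j)) f =
  'X_i * f^`M(j) + ((i == j)%:R / 2%:R) *: f.
Proof.
have h2 := two_neq0.
rewrite -delta_lshift -delta_rshift osc_rep_quad !weyl_opl !weyl_opr mderiv_mulX.
rewrite -scalerAr -scalerDr scalerA; move: ('X_i * _) => g.
have -> : - (im / 2%:R) * im = 2%:R^-1.
  by transitivity (- im ^+ 2 / 2%:R); [ring | rewrite im2 opprK mul1r].
rewrite [_ *: f + g]addrC addrA -mulr2n scalerDr -scaler_nat !scalerA mulVf // scale1r.
by rewrite mulrC.
Qed.
Lemma osc_xx i f : osc_rep (sp_quad (xvec k i) (xvec k i)) f = - im *: ('X_i * ('X_i * f)).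
Proof.
have h2 := two_neq0.
rewrite -delta_lshift osc_rep_quad !weyl_opl -mulr2n -scaler_nat scalerA.
by congr (_ *: _); field.
Qed.
Lemma osc_yy i f : osc_rep (sp_quad (yvec k i) (yvec k i)) f = im *: f^`M(i)^`M(i).
Proof.
have h2 := two_neq0.
rewrite -delta_rshift osc_rep_quad !weyl_opr mderivZ -mulr2n -scaler_nat !scalerA.
congr (_ *: _); have -> : - (im / 2%:R) * 2%:R * im * im = - im * im ^+ 2 by field.
by rewrite im2 mulrN mulr1 opprK.
Qed.

Lemma osc_e_short i j f : j = i.+1 :> nat -> osc_rep (sp_e k i) f = 'X_i * f^`M(j).
Proof.
move=> ij; rewrite (sp_e_short k ij) osc_xy.
have -> : (i == j) = false by rewrite -(inj_eq val_inj) /= ij ltn_eqF.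
by rewrite mul0r scale0r addr0.
Qed.
Lemma osc_f_short i j f : j = i.+1 :> nat -> osc_rep (sp_f k i) f = 'X_j * f^`M(i).
Proof.
move=> ij; rewrite (sp_f_short k ij) osc_xy.
have -> : (j == i) = false by rewrite -(inj_eq val_inj) /= ij gtn_eqF.
by rewrite mul0r scale0r addr0.
Qed.
Lemma osc_e_long i f : i.+1 = n -> osc_rep (sp_e k i) f = (im / 2%:R) *: ('X_i * ('X_i * f)).
Proof.
move=> iE; have h2 := two_neq0.
have m2 : (- 2%:R : k) != 0 by rewrite oppr_eq0.
apply: (scalerI m2); rewrite -lact_scale (sp_e_long k iE) osc_xx scalerA.
by congr (_ *: _); field.
Qed.
Lemma osc_f_long i f : i.+1 = n -> osc_rep (sp_f k i) f = (im / 2%:R) *: f^`M(i)^`M(i).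
Proof.
move=> iE; have h2 := two_neq0.
apply: (scalerI h2); rewrite -lact_scale (sp_f_long k iE) osc_yy scalerA.
by congr (_ *: _); field.
Qed.

Lemma osc_weightv l f : weightv osc_rep l f <->
  forall i, 'X_i * f^`M(i) = (l i - 2%:R^-1) *: f.
Proof.
split=> h i; have := h i; rewrite /quad_op osc_xy eqxx mul1r.
  by move/(canRL (addrK _)) => ->; rewrite scalerBl.
by move=> ->; rewrite -scalerDl subrK.
Qed.

Lemma osc_condition i l f : weightv osc_rep l f ->
  osc_rep (sp_f k i) (osc_rep (sp_e k i) f) =
  (psi_coef im i ^+ 2 * (Ctilde_t k i).@[uval l]) *: f.
Proof.
move/osc_weightv => h; have h2 := two_neq0.
have [[j ij]|iE] := short_or_long i.
  rewrite (osc_e_short _ ij) (osc_f_short _ ij) mderiv_mulX eqxx scale1r mulrDr.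
  have nij : (i == j) = false by rewrite -(inj_eq val_inj) /= ij ltn_eqF.
  have -> : 'X_j * ('X_i * f^`M(j)^`M(i)) = 'X_j * ('X_i * f^`M(i))^`M(j).
    by rewrite mderiv_mulX nij scale0r add0r mderiv_comm.
  rewrite (h i) mderivZ -scalerAr (h j) scalerA -scalerDl (meval_t_short char0 _ ij).
  by rewrite /psi_coef -ij ltn_eqF // expr1n mul1r; congr (_ *: _); field.
have e1 : ('X_i * f)^`M(i) = (l i + 2%:R^-1) *: f.
  rewrite mderiv_mulX eqxx mulr1n h -scalerDl; congr (_ *: _); by field.
have e2 : ('X_i * ('X_i * f))^`M(i) = (l i + 3%:R / 2%:R) *: ('X_i * f).
  by rewrite mderiv_mulX eqxx mulr1n e1 -scalerAr -scalerDl; congr (_ *: _); field.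
rewrite (osc_e_long _ iE) (osc_f_long _ iE) !mderivZ e2 mderivZ e1 !scalerA.
rewrite (meval_t_long char0 _ iE) /psi_coef iE eqxx; congr (_ *: _); by field.
Qed.

Lemma mulX_deriv_X i j a : i != j ->
  'X_i * 'X_[a]^`M(j) = (a j)%:R *: 'X_[a - U_(j) + U_(i)] :> P.
Proof. by move=> ij; rewrite mderivX -scalerAr -mpolyXD addmC. Qed.

Lemma mulX_derivX i a : 'X_i * 'X_[a]^`M(i) = (a i)%:R *: 'X_[a] :> P.
Proof.
rewrite mderivX -scalerAr -mpolyXD addmC.
have [a0|a0] := posnP (a i); first by rewrite a0 !scale0r.
by rewrite submK // lep1mP -lt0n.
Qed.

(** The half comes from symmetrising [x_i d_i]; hence [u_i] takes the value [a i + 1] on the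
    monomial. *)
Definition mono_weight a : {ffun 'I_n -> k} := [ffun i => (a i)%:R + 2%:R^-1].

Lemma weightv_mono a : weightv osc_rep (mono_weight a) 'X_[a].
Proof. by apply/osc_weightv => i; rewrite mulX_derivX ffunE addrK. Qed.

Lemma mcoeff_euler i a f : ('X_i * f^`M(i))@_a = (a i)%:R * f@_a.
Proof.
elim/mpolyind: f => [|c b f _ _ IHf]; first by rewrite mderiv0 mulr0 !mcoeff0 mulr0.
rewrite mderivD mulrDr !mcoeffD IHf mderivZ -scalerAr mulX_derivX mulrDr; congr (_ + _).
rewrite scalerA !mcoeffZ mcoeffX; case: eqP => [->|]; last by rewrite !mulr0.
by rewrite !mulr1 mulrC.
Qed.

Lemma weightv_coeff l f a : weightv osc_rep l f -> f@_a != 0 -> l = mono_weight a.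
Proof.
move=> /osc_weightv h a0; apply/ffunP=> i; rewrite ffunE.
have := congr1 (mcoeff a) (h i); rewrite mcoeff_euler mcoeffZ => /(mulIf a0) ->.
by rewrite subrK.
Qed.

Lemma osc_span f : exists2 s : seq P,
  forall v, v \in s -> exists l, weightv osc_rep l v & f = \sum_(v <- s) v.
Proof.
exists [seq f@_a *: 'X_[a] | a <- msupp f]; last by rewrite big_map -mpolyE.
by move=> _ /mapP[a _ ->]; exists (mono_weight a); apply/weightvZ/weightv_mono.
Qed.

Lemma osc_indep (ls : seq {ffun 'I_n -> k}) (x : {ffun 'I_n -> k} -> P) :
  uniq ls -> (forall l, weightv osc_rep l (x l)) ->
  \sum_(l <- ls) x l = 0 -> forall l, l \in ls -> x l = 0.
Proof.
move=> uls hx sx l lls; apply/mpolyP=> a; rewrite mcoeff0.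
apply/eqP/negPn/negP => a0; have la := weightv_coeff (hx l) a0.
have := congr1 (mcoeff a) sx; rewrite mcoeff0 raddf_sum /= (bigD1_seq l) //=.
rewrite big1 ?addr0 => [/eqP|l' ll']; first by rewrite (negbTE a0).
apply/eqP/negPn/negP => a0'; case/eqP: ll'.
by rewrite la; apply: weightv_coeff a0'.
Qed.

(** Distinct monomials have distinct weights in characteristic zero, so a weight vector involves
    only one. *)
Lemma weightv_monoE l f : weightv osc_rep l f -> f != 0 ->
  exists a (c : k), f = c *: 'X_[a] /\ c != 0.
Proof.
move=> hf f0; have [a af] : exists a, a \in msupp f.
  case E : (msupp f) => [|a s]; last by exists a; rewrite inE eqxx.
  by case/eqP: f0; rewrite [f]mpolyE E big_nil.
rewrite mcoeff_msupp in af; exists a, f@_a; split=> //; apply/mpolyP=> b.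
rewrite mcoeffZ mcoeffX; have [<-|ab] := eqVneq a b; first by rewrite mulr1.
rewrite mulr0; apply/eqP/negPn/negP => b0; case/eqP: ab.
have := weightv_coeff hf af; rewrite (weightv_coeff hf b0) => /ffunP e.
by apply/mnmP=> i; have := e i; rewrite !ffunE => /addIr/(natr_inj char0).
Qed.

Local Notation sact := (sym_act im osc_rep).
Local Notation sym := (tgw_sym {mpoly k[n]} 'I_n).

(** Elements of [R] are diagonal on monomials. For [X_i] and [Y_i] the opposite generator returns
    with a coefficient built from positive exponents and nonzero constants, which does not vanish in
    characteristic zero. *)
Lemma sym_mono (s : sym) a : exists (c : k) b, sact s 'X_[a] = c *: 'X_[b] /\
  (c != 0 -> exists2 c' : k, c' != 0 & sact (tgw_swap s) 'X_[b] = c' *: 'X_[a]).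
Proof.
have tr i j a' : i != j -> exists (c : k) b, 'X_i * 'X_[a']^`M(j) = c *: 'X_[b] /\
    (c != 0 -> exists2 c' : k, c' != 0 & 'X_j * 'X_[b]^`M(i) = c' *: 'X_[a']).
  move=> ij; have ji : j != i by rewrite eq_sym.
  exists (a' j)%:R, (a' - U_(j) + U_(i))%MM; split; first exact: mulX_deriv_X.
  rewrite natr0 // => aj; rewrite mulX_deriv_X // addmK submK; last by rewrite lep1mP.
  eexists; last by [].
  by rewrite natr0 // mnmDE mnm1E eqxx addn1.
have up i a' : 'X_i * ('X_i * 'X_[a']) = 'X_[a' + U_(i) + U_(i)] :> P.
  by rewrite -!mpolyXD addmC [(U_(i) + a')%MM]addmC.
have dn i a' : 'X_[a' + U_(i) + U_(i)]^`M(i)^`M(i) =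
    ((a' i).+2 * (a' i).+1)%:R *: 'X_[a'] :> P.
  rewrite mderivX mderivZ mderivX scalerA !addmK -natrM !mnmDE !mnm1E !eqxx.
  by rewrite !addn1.
have sR r f : sact (inl r) f = Uact osc_rep (Usp_R r) f by [].
have sX i f : sact (inr (inl i)) f = (psi_coef im i)^-1 *: osc_rep (sp_e k i) f by [].
have sY i f : sact (inr (inr i)) f = (psi_coef im i)^-1 *: osc_rep (sp_f k i) f by [].
case: s => [r|[i|i]]; rewrite /tgw_swap.
- by exists r.@[uval (mono_weight a)], a; rewrite sR (Uact_R r (weightv_mono a)); split=> // c0;
    exists r.@[uval (mono_weight a)].
- have [[j ij]|iE] := short_or_long i.
    have nij : i != j by rewrite -(inj_eq val_inj) /= ij ltn_eqF.
    have [c [b [e1 e2]]] := tr i j a nij; exists ((psi_coef im i)^-1 * c), b.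
    rewrite sX sY (osc_e_short _ ij) e1 scalerA; split=> //.
    rewrite mulf_eq0 negb_or => /andP[p0 /e2[c' c'0 e]]; exists ((psi_coef im i)^-1 * c').
      by rewrite mulf_neq0.
    by rewrite (osc_f_short _ ij) e scalerA.
  eexists; exists (a + U_(i) + U_(i))%MM; split.
    by rewrite sX (osc_e_long _ iE) up scalerA.
  move=> c0; eexists; last first.
    by rewrite sY (osc_f_long _ iE) dn !scalerA.
  by rewrite mulf_neq0 // natr0.
- have [[j ij]|iE] := short_or_long i.
    have nij : j != i by rewrite -(inj_eq val_inj) /= ij gtn_eqF.
    have [c [b [e1 e2]]] := tr j i a nij; exists ((psi_coef im i)^-1 * c), b.
    rewrite sX sY (osc_f_short _ ij) e1 scalerA; split=> //.
    rewrite mulf_eq0 negb_or => /andP[p0 /e2[c' c'0 e]]; exists ((psi_coef im i)^-1 * c').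
      by rewrite mulf_neq0.
    by rewrite (osc_e_short _ ij) e scalerA.
  have [a1|a1] := leqP (a i) 1.
    (* An exponent below 2 is killed by the second derivative; with coefficient 0 any monomial may
       stand in the witness. *)
    exists 0, a; rewrite eqxx scale0r sY (osc_f_long _ iE) !mderivX mderivZ mderivX.
    rewrite !scalerA mnmBE mnm1E eqxx -!mulrA -natrM; split=> //.
    by case: (a i) a1 => [|[|]] //; rewrite ?mul0n ?muln0 !mulr0 scale0r.
  pose b := (a - U_(i) - U_(i))%MM.
  have aE : a = (b + U_(i) + U_(i))%MM.
    apply/mnmP=> e; rewrite !(mnmDE, mnmBE, mnm1E).
    case: eqP => [<-|_]; rewrite ?subn0 ?addn0 //.
    by case: (a i) a1 => [|[|c]] // _; rewrite !subn1 !addn1.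
  eexists; exists b; split.
    by rewrite {1}aE sY (osc_f_long _ iE) dn !scalerA.
  move=> c0; exists ((psi_coef im i)^-1 * (im / 2%:R)).
    by apply: contra_neq c0 => ->; rewrite mul0r.
  by rewrite sX (osc_e_long _ iE) up scalerA -aE.
Qed.

End Oscillator.

(** * Polynomials vanishing on an infinite grid *)

Section GridVanishing.
Variables (k : fieldType) (n : nat).
Variable s : 'I_n -> nat -> k.
Hypothesis s_inj : forall i, injective (s i).
Local Notation P := {mpoly k[n]}.
Implicit Types (p : P) (v : 'I_n -> P).

Local Notation ev v p := (mmap (@mpolyC n k) v p).

(** Substitution for one variable becomes evaluation of a univariate polynomial over the integral
    domain [P], so that roots can be counted. *)
Lemma mmap_horner p (j : 'I_n) v (x : P) :
  (mmap (@polyC P \o @mpolyC n k) (fun i => if i == j then 'X else (v i)%:P) p).[x] =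
  ev (fun i => if i == j then x else v i) p.
Proof.
rewrite /mmap horner_sum; apply: eq_bigr => m _; rewrite hornerM hornerC; congr (_ * _).
rewrite /mmap1 horner_prod; apply: eq_bigr => i _; rewrite horner_exp.
by case: eqP; rewrite ?hornerX ?hornerC.
Qed.

(* Substituting polynomials for the variables one at a time turns vanishing on the
   grid into vanishing of [p] at the generic point ['X]. *)
Lemma mpoly_grid_eq0 p : (forall c : 'I_n -> nat, p.@[fun i => s i (c i)] = 0) -> p = 0.
Proof.
move=> p0.
(* The variables of index at least [r] take grid values, the others arbitrary polynomials; at
   [r = n] all are free. *)
have main r : forall v, (forall i : 'I_n, (r <= i)%N -> exists c, v i = (s i c)%:MP) -> ev v p = 0.
  elim: r => [|r IHr] v hv.
    have /choice[c hc] : forall i, exists c, v i = (s i c)%:MP by move=> i; apply: hv.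
    have := congr1 (@mpolyC n k) (p0 c); rewrite mpolyC0 => <-.
    rewrite /mmap mevalE rmorph_sum; apply: eq_bigr => m _ /=; rewrite rmorphM; congr (_ * _).
    by rewrite /mmap1 rmorph_prod; apply: eq_bigr => i _ /=; rewrite hc rmorphXn.
  have [rn|nr] := ltnP r n; last first.
    by apply: IHr => i ri; have := leq_ltn_trans (leq_trans nr ri) (ltn_ord i); rewrite ltnn.
  pose j := Ordinal rn.
  pose q := mmap (@polyC P \o @mpolyC n k) (fun i => if i == j then 'X else (v i)%:P) p.
  have q0 : q = 0.
    apply/eqP/negPn/negP => q0.
    have := @max_poly_roots _ q [seq (s j c)%:MP | c <- iota 0 (size q)] q0.
    rewrite size_map size_iota ltnn map_inj_uniq ?iota_uniq; last first.
      by move=> c c' /(congr1 (meval (fun=> 0))); rewrite !mevalC => /s_inj.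
    move=> h; suff /h/(_ isT) : all (root q) [seq (s j c)%:MP | c <- iota 0 (size q)] by [].
    apply/allP=> _ /mapP[c _ ->]; rewrite /root /q mmap_horner.
    apply/eqP/IHr => i ri; have [->|ij] := eqVneq i j; first by exists c.
    apply: hv; rewrite ltn_neqAle ri andbT; apply: contra_neq ij => e.
    exact: val_inj.
  have := mmap_horner p j v (v j); rewrite -/q q0 horner0 => ->.
  rewrite /mmap; apply: eq_bigr => m _; congr (_ * _); apply: eq_bigr => i _.
  by case: eqP => [->|].
transitivity (ev (fun i => 'X_i) p).
  rewrite {1}[p]mpolyE; apply: eq_bigr => m _.
  by rewrite -mul_mpolyC mpolyXE_id.
by apply: (main n) => i; rewrite leqNgt ltn_ord.
Qed.

End GridVanishing.

(** * Faithfulness of the oscillator representation *)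

Section OscillatorFaithful.
Variables (k : fieldType) (n : nat) (im : k).
Hypothesis char0 : [pchar k] =i pred0.
Hypothesis im2 : im ^+ 2 = -1.
Local Notation P := {mpoly k[n]}.
Implicit Types (i j : 'I_n) (f : P) (a b m : 'X_{1..n}).
Local Notation D := (Ctilde_datum k n).
Local Notation cons := (tgw_cons D).
Local Notation pi := (tgw_cons_pi D).
Local Notation rep := (osc_rep n char0 im2).
Local Notation sact := (sym_act im rep).
Local Notation sym := (tgw_sym {mpoly k[n]} 'I_n).

Lemma word_mono (w : seq sym) a : exists (c : k) b, foldr sact 'X_[a] w = c *: 'X_[b] /\
  (c != 0 -> exists2 c' : k, c' != 0 &
     foldr sact 'X_[b] (rev (map (@tgw_swap k _ _) w)) = c' *: 'X_[a]).
Proof.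
elim: w => [|s w [c [b [e1 e2]]]].
  by exists 1, a; rewrite scale1r; split=> // c0; exists 1; rewrite // scale1r.
have [c1 [b1 [f1 f2]]] := sym_mono char0 im2 s b.
have sZ c' f : sact s (c' *: f) = c' *: sact s f.
  by have := sym_act_linear im rep s c' f 0; rewrite !addr0 (_ : sact s 0 = 0) ?addr0 //;
    have := sym_act_linear im rep s (-1) 0 0; rewrite scaler0 addr0 scaleN1r addNr.
exists (c * c1), b1; rewrite [foldr _ _ _]/= e1 sZ f1 scalerA; split=> //.
rewrite mulf_eq0 negb_or => /andP[/e2[c' c'0 e'] /f2[c1' c1'0 f']].
exists (c1' * c'); first by rewrite mulf_neq0.
rewrite map_cons rev_cons -cats1 foldr_cat [foldr _ _ [:: _]]/= f'.
have := foldr_act_linear (sym_act_linear im rep) (rev (map (@tgw_swap k _ _) w)) c1' 'X_[b] 0.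
rewrite !addr0 => ->; rewrite e' scalerA.
have -> : foldr sact 0 (rev (map (@tgw_swap k _ _) w)) = 0.
  have := foldr_act_linear (sym_act_linear im rep) (rev (map (@tgw_swap k _ _) w)) (-1) 0 0.
  by rewrite scaler0 addr0 scaleN1r addNr.
by rewrite addr0.
Qed.

Local Notation cact := (cons_act im rep).
Let osc := @osc_condition k n im char0 im2.
Let span := @osc_span k n im char0 im2.
Let indep := @osc_indep k n im char0 im2.

Lemma mono_weight_inj : injective (@mono_weight k n).
Proof.
move=> a b /ffunP e; apply/mnmP=> i.
by have := e i; rewrite !ffunE => /addIr/(natr_inj char0).
Qed.

(** Some word of [x] acts nontrivially on the monomial of [f]. Its image lies on the same line as
    [x f], because weight spaces are lines, so the reversed and swapped word brings [x f] back,
    however the other words contribute. *)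
Lemma osc_ret l f d (x : cons) : weightv rep l f -> tgw_cons_comp d x ->
  cact x f <> 0 -> exists2 y, tgw_cons_comp (- d) y & cact y (cact x f) <> 0.
Proof.
move=> hf hx nz; have hxf := weightv_cons char0 im2 span osc hx hf.
have f0 : f != 0 by apply/eqP => f0; apply: nz; rewrite f0 cons_actr0.
have [a [c0 [fE c00]]] := weightv_monoE hf f0.
have [b2 [c2 [bE c20]]] := weightv_monoE hxf (introN eqP nz).
have [ws hw xE] := hx.
have [w wws nw] : exists2 w, w \in ws & foldr sact 'X_[a] w.2 != 0.
  apply: contrapT => no; apply: nz.
  rewrite xE (cons_act_sum char0 im2 span osc) big_seq big1 // => w wws.
  rewrite (cons_actM char0 im2 span osc) (cons_act_scal char0 im2 span osc).
  rewrite fE cons_actZ (cons_act_word char0 im2 span osc).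
  have [->|n0] := eqVneq (foldr sact 'X_[a] w.2) 0; first by rewrite !scaler0.
  by case: no; exists w.
have [c1 [b [e1 e2]]] := word_mono w.2 a.
have c10 : c1 != 0 by apply: contra_neq nw => c1E; rewrite e1 c1E scale0r.
have [c' c'0 e'] := e2 c10.
exists (\prod_(s <- rev (map (@tgw_swap k _ _) w.2)) pi (fgen k s)).
  have <- : \sum_(s <- rev (map (@tgw_swap k {mpoly k[n]} 'I_n) w.2)) tgw_deg s = - d.
    have /eqP <- := allP hw _ wws.
    rewrite (perm_big _ (permEl (perm_rev _))) big_map -sumrN.
    by apply: eq_bigr => -[r|[i|i]] _; rewrite /= ?oppr0 ?opprK.
  exact: cons_comp_prod.
(* Both monomials have the weight of [f] shifted by [wdeg k d]. *)
have bb : b2 = b.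
  apply: mono_weight_inj.
  have := weightv_word im char0 w.2 (weightv_mono char0 im2 a).
  rewrite e1 => h1.
  have ha : mono_weight k a = l.
    by apply/esym/(weightv_coeff hf); rewrite fE mcoeffZ mcoeffX eqxx mulr1.
  have b1 : mono_weight k a + wdeg k d = mono_weight k b.
    have /eqP <- := allP hw _ wws; apply: (weightv_coeff h1).
    by rewrite mcoeffZ mcoeffX eqxx mulr1.
  rewrite -b1 ha; apply/esym/(weightv_coeff hxf).
  by rewrite bE mcoeffZ mcoeffX eqxx mulr1.
rewrite bE bb cons_actZ (cons_act_word char0 im2 span osc) e' scalerA => /eqP.
rewrite scaler_eq0 mulf_eq0 (negbTE c20) (negbTE c'0) /= => /eqP X0.
by have := congr1 (mcoeff a) X0; rewrite mcoeffX eqxx mcoeff0 => /eqP; rewrite oner_eq0.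
Qed.

Lemma osc_R_eq0 r : (forall a, r.@[uval (mono_weight k a)] = 0) -> r = 0 :> P.
Proof.
move=> h; apply: (@mpoly_grid_eq0 k n (fun _ c => c.+1%:R)).
  by move=> _ c c' /(natr_inj char0) [].
move=> c; rewrite -[RHS](h [multinom c i | i < n]); apply: meval_eq => i.
have h2 : (2%:R : k) != 0 by rewrite natr0.
by rewrite /uval ffunE mnmE -natr1; field.
Qed.

Lemma osc_kernel_rad (x : cons) : (forall f, cact x f = 0) -> tgw_rad D x.
Proof.
move=> hx; exists [:: x]; last by rewrite big_seq1.
move=> _ /[!inE]/eqP ->; exists (fun y => forall f, cact y f = 0) => //.
split; [split=> [|y hy] | move=> y hy].
- split=> [f|y z hy hz f|y z hz f|y z hz f].
  + exact: (cons_act0 char0 im2 span osc).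
  + by rewrite (cons_actD char0 im2 span osc) hy hz addr0.
  + by rewrite (cons_actM char0 im2 span osc) hz cons_actr0.
  + by rewrite (cons_actM char0 im2 span osc).
- have [ds [xs [uds hxs yE]]] := gspan_decomp (@tgw_deg k {mpoly k[n]} 'I_n) (cons_span y).
  have hy' : forall f, cact (\sum_(d <- ds) xs d) f = 0 by move=> f; rewrite -yE.
  have hk := cons_act_decomp char0 im2 span indep osc uds hxs hy'.
  exists (map xs ds); last by rewrite big_map.
  by move=> _ /mapP[d dds ->]; split; [apply: hk | exists d; apply: hxs].
- move=> /cons_degree0[r rE]; rewrite rE (_ : r = 0) ?cons_R0 //.
  apply: osc_R_eq0 => a; have := hy 'X_[a].
  rewrite rE (cons_act_R char0 im2 span osc _ (weightv_mono char0 im2 a)) => /eqP.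
  rewrite scaler_eq0 => /orP[/eqP//|/eqP X0].
  by have := congr1 (mcoeff a) X0; rewrite mcoeffX eqxx mcoeff0 => /eqP; rewrite oner_eq0.
Qed.

Lemma osc_A_faithful (a : ACtilde k n) : (forall f, A_act im rep a f = 0) -> a = 0.
Proof.
move=> h; rewrite -[a]tgw_reprK; apply/quot_pi_eq0; apply: osc_kernel_rad.
exact: h.
Qed.

End OscillatorFaithful.

(** * The homomorphism psi and the annihilator *)

Section PointedModule.
Variables (k : fieldType) (n : nat) (im : k).
Hypothesis char0 : [pchar k] =i pred0.
Hypothesis im2 : im ^+ 2 = -1.
Hypothesis n2 : (2 <= n)%N.
Variables (M : lmodType k) (rho : lie_module (@sp_br k n) M).
Hypothesis inf : infinite_dimensional M.
Hypothesis simple : simple_module rho.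
Hypothesis cp : completely_pointed rho.
Implicit Types (m : M) (l : {ffun 'I_n -> k}) (i j : 'I_n).
Local Notation D := (Ctilde_datum k n).

Lemma cp_condition i l m : weightv rho l m ->
  rho (sp_f k i) (rho (sp_e k i) m) =
  (psi_coef im i ^+ 2 * (Ctilde_t k i).@[uval l]) *: m.
Proof.
move=> hm; have [quarter injs] := cp_long_roots cp simple char0 n2 inf.
have h2 : (2%:R : k) != 0 by rewrite natr0.
have h4 : (4%:R : k) != 0 by rewrite natr0.
have [[j ij]|iE] := short_or_long i.
  have nij : i != j by rewrite -(inj_eq val_inj) /= ij ltn_eqF.
  rewrite (sp_e_short k ij) (sp_f_short k ij) (meval_t_short char0 _ ij).
  rewrite /psi_coef -ij ltn_eqF // expr1n mul1r -!/(quad_op rho _ _ _).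
  (* In the orientation [true] of [i], [inj_BA] yields [f_i e_i] up to sign; in the other one it
     yields [e_i f_i], and the commutator has to be subtracted. *)
  have [[] inj] := injs i.
    have := inj_BA char0 inj quarter false nij hm.
    rewrite /pvec /qvec /ocoord /= quad_opNr quad_opC expr0 expr1 mul1r mulN1r.
    move/(congr1 -%R); rewrite opprK -scaleNr => ->; congr (_ *: _); by field.
  have := inj_BA char0 inj quarter true nij hm.
  rewrite /pvec /qvec /ocoord /= quad_opNl [quad_op rho (yvec k i) _ _]quad_opC.
  rewrite expr0 expr1 mul1r mulN1r quad_op_comm ?omegaB !eqxx.
  have nji : (j == i) = false by rewrite eq_sym (negbTE nij).
  rewrite ?(negbTE nij) ?nji ?oppr0 ?scale0r ?scale1r ?scaleN1r ?(addr0, add0r).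
  rewrite (quad_opC _ (yvec k j)) !hm => /(congr1 -%R); rewrite opprK.
  rewrite -scalerBl => /(canRL (addrK _)) ->; rewrite -scaleNr -scalerBl.
  by congr (_ *: _); field.
have lactZ x (c : k) m' : rho x (c *: m') = c *: rho x m'.
  by have := lact_linearr rho x c m' 0; rewrite addr0 lactr0 addr0.
(* For the long root, [(l i + 1) ^ 2 - 1/4] splits into the two factors of [meval_t_long]. *)
have := quarter i l m hm true; rewrite /quad_op /pvec /qvec /ocoord /= expr0 mul1r.
rewrite -(sp_e_long k iE) -(sp_f_long k iE) !lact_scale lactZ scalerA.
move=> h; apply: (scalerI (_ : (2%:R * - 2%:R : k) != 0)).
  by rewrite mulf_neq0 ?oppr_eq0.
rewrite h scalerA (meval_t_long char0 _ iE) /psi_coef iE eqxx exprMn im2.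
by congr (_ *: _); field; rewrite h2.
Qed.

Lemma Uact_transitive m m' : m <> 0 -> exists u, Uact rho u m = m'.
Proof.
move=> m0; have [_ sm] := simple.
case: (sm (fun y => exists u, Uact rho u m = y)) => [|c x y [u <-] [v <-]|x y [u <-]|h|h].
- by exists 0; rewrite Uact0l.
- by exists (Uscal _ c * u + v); rewrite UactD UactM Uact_scal.
- by exists (Ugen _ x * u); rewrite UactM Uact_gen.
- by case: m0; apply: h; exists 1; rewrite Uact1.
- exact: h.
Qed.

Let span := cp_span cp.
Let indep := @cp_indep _ _ _ _ cp.

(** Simplicity gives [u] with [u x m = m]. Only the component of [u] of degree [- d] leads back to
    the weight of [m]. *)
Lemma cp_ret l m d (x : tgw_cons D) : weightv rho l m -> tgw_cons_comp d x ->
  cons_act im rho x m <> 0 ->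
  exists2 y, tgw_cons_comp (- d) y & cons_act im rho y (cons_act im rho x m) <> 0.
Proof.
move=> hm hx nz; have hw := weightv_cons char0 im2 span cp_condition hx hm.
set w := cons_act im rho x m in nz hw *.
have m0 : m <> 0 by move=> m0; apply: nz; rewrite /w m0 cons_actr0.
have [u uw] := Uact_transitive m nz.
have [ds [us [uds hus uE]]] := gspan_decomp (@chevalley_deg n) (chev_all char0 u).
have [y hy yE] := Uact_cons char0 im2 span cp_condition (hus (- d)).
exists y => //; rewrite -yE => e0; apply: m0.
(* The components of [u w - m] by degree. Since [- d] may be missing from [ds], the sum runs over
   [ds] enlarged by it. *)
pose z e := Uact rho (us e) w *+ (e \in ds) - m *+ (e == - d).
have hz e : weightv rho (l + wdeg k d + wdeg k e) (z e).
  rewrite /z -scaleN1r; apply: weightvD.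
    by case: (e \in ds); [apply: weightv_comp (hus e) hw | apply: weightv0].
  apply: weightvZ; case: eqP => [->|_]; last exact: weightv0.
  by rewrite wdegN addrK.
have sz : \sum_(e <- undup (- d :: ds)) z e = 0.
  rewrite sumrB; apply/eqP; rewrite subr_eq0; apply/eqP.
  rewrite [RHS](bigD1_seq (- d)) ?undup_uniq ?mem_undup ?inE ?eqxx //=.
  rewrite [X in _ = _ + X]big1 => [|e /negbTE->]; rewrite ?addr0 //.
  rewrite -[RHS]uw uE Uact_sum /= (undup_id uds).
  by case: ifPn => dds; rewrite ?big_cons ?(negbTE dds) ?mulr0n ?add0r;
    rewrite big_seq [RHS]big_seq; apply: eq_bigr => e ->.
have := indep_wdeg char0 indep (undup_uniq _) hz sz (d := - d).
rewrite mem_undup inE eqxx => /(_ isT); rewrite /z e0 eqxx mul0rn sub0r.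
by move/eqP; rewrite oppr_eq0 => /eqP.
Qed.

(** From one nonzero weight vector the injective long root vectors, one for each index, move every
    coordinate independently in steps of 2. *)
Lemma cp_grid : exists (l0 : {ffun 'I_n -> k}) (s : 'I_n -> bool), forall c : 'I_n -> nat,
  exists2 m, m <> 0 &
    weightv rho (l0 + \sum_i sgn_delta k (s i) i *+ (c i).*2) m.
Proof.
have [_ /choice[s injs]] := cp_long_roots cp simple char0 n2 inf.
have [l0 [m0 [hm0 nm0]]] := ex_weightv cp simple.
exists l0, s => c; elim: (index_enum _) => [|i r [m nm hm]].
  by exists m0; [apply/eqP | rewrite big_nil addr0].
rewrite big_cons addrCA addrC; move: (l0 + _) (hm) => l {}hm.
elim: (c i) => [|a [m' nm' hm']]; first by exists m; rewrite ?addr0.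
exists (quad_op rho (pvec k (s i) i) (pvec k (s i) i) m'); first by move/injs.
by rewrite doubleS !mulrSr !addrA; apply: weightv_pp.
Qed.

Lemma cp_dense (r : {mpoly k[n]}) :
  (forall l m, weightv rho l m -> m <> 0 -> r.@[uval l] = 0) -> r = 0.
Proof.
move=> h; have [l0 [s hs]] := cp_grid.
apply: (@mpoly_grid_eq0 k n (fun i c => l0 i + 2%:R^-1 + (-1) ^+ (~~ s i) *+ c.*2)).
  move=> i c c' /addrI e; apply: double_inj; apply: (natr_inj char0).
  have s0 : (-1) ^+ (~~ s i) != 0 :> k by rewrite signr_eq0.
  by apply: (mulfI s0); rewrite !mulr_natr.
move=> c; have [m nm hm] := hs c; rewrite -[RHS](h _ _ hm nm); apply: meval_eq => i.
rewrite /uval ffunE sum_ffunE (bigD1 i) //= big1 ?addr0 => [|j ji]; last first.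
  by rewrite ffunMnE ffunE eq_sym (negbTE ji) mulr0 mul0rn.
by rewrite ffunMnE ffunE eqxx mulr1 addrAC.
Qed.

End PointedModule.

(** * Existence of psi and its compatibility with the actions *)

Section Psi.
Variables (k : fieldType) (n : nat) (im : k).
Hypothesis char0 : [pchar k] =i pred0.
Hypothesis im2 : im ^+ 2 = -1.
Implicit Types (i j : 'I_n) (u : Usp k n) (a : ACtilde k n).
Local Notation D := (Ctilde_datum k n).
Local Notation rep := (osc_rep n char0 im2).
Let osc := @osc_condition k n im char0 im2.
Let span := @osc_span k n im char0 im2.
Let ret := @osc_ret k n im char0 im2.
Local Notation Aact := (A_act im rep).

Lemma A_faithful a b : (forall f, Aact a f = Aact b f) -> a = b.
Proof.
move=> h; apply/eqP; rewrite -subr_eq0; apply/eqP; apply: (@osc_A_faithful k n im char0 im2) => f.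
apply: (addIr (Aact b f)); rewrite -(A_actD char0 im2 span osc ret) subrK add0r.
exact: h.
Qed.

Lemma psi_comp_ex d u : Usp_comp d u -> exists2 a, Acomp d a & forall f, Aact a f = Uact rep u f.
Proof.
move=> hu; have [x hx xE] := Uact_cons char0 im2 span osc hu.
exists (tgw_pi x); first by exists x.
by move=> f; rewrite (A_act_pi char0 im2 span osc ret) xE.
Qed.

Lemma psi_ex u : exists a, forall f, Aact a f = Uact rep u f.
Proof.
have [ds [us [uds hus ->]]] := gspan_decomp (@chevalley_deg n) (chev_all char0 u).
elim: ds uds => [_|d ds IHds /= /andP[_ /IHds[a aE]]].
  by exists 0 => f; rewrite big_nil Uact0l (A_act0 char0 im2 span osc ret).
have [b _ bE] := psi_comp_ex (hus d).
by exists (b + a) => f; rewrite big_cons (A_actD char0 im2 span osc ret) UactD aE bE.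
Qed.

Section PsiSpec.
Variable psi : {rmorphism Usp k n -> ACtilde k n}.
Hypothesis spec : psi_spec im psi.

Lemma Ascal1 : Ascal n (1 : k) = 1.
Proof. by rewrite /Ascal /tgw_scal scale1r !rmorph1. Qed.
Lemma AscalM (c c' : k) : Ascal n (c * c') = Ascal n c * Ascal n c'.
Proof. by rewrite /Ascal /tgw_scal cons_scalM rmorphM. Qed.

Lemma psi_scal c : psi (Uscal _ c) = Ascal n c. Proof. by case: spec. Qed.
Lemma psi_e i : psi (Ue k i) = Ascal n (psi_coef im i) * AX k i.
Proof.
have [_ psS psL] := spec; rewrite /psi_coef; have [[j ij]|iE] := short_or_long i.
  by have [-> _ _] := psS i j ij; rewrite -ij ltn_eqF // Ascal1 mul1r.
by have [-> _ _] := psL i iE; rewrite iE eqxx.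
Qed.
Lemma psi_f i : psi (Uf k i) = Ascal n (psi_coef im i) * AY k i.
Proof.
have [_ psS psL] := spec; rewrite /psi_coef; have [[j ij]|iE] := short_or_long i.
  by have [_ -> _] := psS i j ij; rewrite -ij ltn_eqF // Ascal1 mul1r.
by have [_ -> _] := psL i iE; rewrite iE eqxx.
Qed.
Lemma psi_h i : exists2 p, Uh k i = Usp_R p & psi (Uh k i) = AR p.
Proof.
have [_ psS psL] := spec; have [[j ij]|iE] := short_or_long i.
  by have [_ _ ->] := psS i j ij; eexists; first by apply/esym/(Usp_R_h k ij).
by have [_ _ ->] := psL i iE; eexists; first by apply/esym/(Usp_R_hn k iE).
Qed.

End PsiSpec.

Section Module.
Variables (M : lmodType k) (rho : lie_module (@sp_br k n) M).
Hypothesis span' : forall m : M, exists2 s : seq M,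
  forall v : M, v \in s -> exists l, weightv rho l v & m = \sum_(v <- s) v.
Hypothesis osc' : forall i l m, weightv rho l m ->
  rho (sp_f k i) (rho (sp_e k i) m) = (psi_coef im i ^+ 2 * (Ctilde_t k i).@[uval l]) *: m.
Hypothesis ret' : forall l m d (x : tgw_cons D), weightv rho l m -> tgw_cons_comp d x ->
  cons_act im rho x m <> 0 ->
  exists2 y, tgw_cons_comp (- d) y & cons_act im rho y (cons_act im rho x m) <> 0.
Implicit Types (m : M).

Lemma A_act_scal (c : k) m : A_act im rho (Ascal n c) m = c *: m.
Proof. by rewrite (A_act_pi char0 im2 span' osc' ret') (cons_act_scal char0 im2 span' osc'). Qed.
Lemma A_act_X i m : A_act im rho (AX k i) m = (psi_coef im i)^-1 *: rho (sp_e k i) m.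
Proof. by rewrite (A_act_pi char0 im2 span' osc' ret') (cons_act_gen char0 im2 span' osc'). Qed.
Lemma A_act_Y i m : A_act im rho (AY k i) m = (psi_coef im i)^-1 *: rho (sp_f k i) m.
Proof. by rewrite (A_act_pi char0 im2 span' osc' ret') (cons_act_gen char0 im2 span' osc'). Qed.
Lemma A_act_R p m : A_act im rho (AR p) m = Uact rho (Usp_R p) m.
Proof. by rewrite (A_act_pi char0 im2 span' osc' ret') (cons_act_gen char0 im2 span' osc'). Qed.

(** Used twice: on the polynomials it determines [psi] by faithfulness, on [M] it places the kernel
    of [psi] inside the annihilator. *)
Lemma psi_act (psi : {rmorphism Usp k n -> ACtilde k n}) : psi_spec im psi ->
  forall u m, A_act im rho (psi u) m = Uact rho u m.
Proof.
move=> spec u.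
have aM := A_actM char0 im2 span' osc' ret'; have aD := A_actD char0 im2 span' osc' ret'.
apply: (@Usp_chev_ind k n char0 (fun u => forall m, A_act im rho (psi u) m = Uact rho u m)) u.
- by move=> m; rewrite rmorph0 Uact0l (A_act0 char0 im2 span' osc' ret').
- by move=> x y hx hy m; rewrite rmorphD aD UactD hx hy.
- by move=> x y hx hy m; rewrite rmorphM aM UactM hx hy.
- by move=> c m; rewrite (psi_scal spec) A_act_scal Uact_scal.
- move=> i m; rewrite (psi_e spec) aM A_act_scal A_act_X scalerA divff ?psi_coef_neq0 //.
  by rewrite scale1r Uact_gen.
- move=> i m; rewrite (psi_f spec) aM A_act_scal A_act_Y scalerA divff ?psi_coef_neq0 //.
  by rewrite scale1r Uact_gen.
- by move=> i m; have [p pE ->] := psi_h spec i; rewrite A_act_R pE.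
Qed.

End Module.

Let osc_scal := A_act_scal span osc ret.
Let osc_X := A_act_X span osc ret.
Let osc_Y := A_act_Y span osc ret.
Let osc_R := A_act_R span osc ret.

(** Faithfulness turns each identity required of the chosen elements into one between operators on
    polynomials, so no relation is verified inside the algebra. *)
Lemma psi_exists : exists psi : {rmorphism Usp k n -> ACtilde k n}, psi_spec im psi.
Proof.
have /choice[psi0 psiE] := psi_ex.
have psi_add : zmod_morphism psi0.
  move=> u v; apply: A_faithful => f.
  apply: (addIr (Aact (psi0 v) f)); rewrite -!(A_actD char0 im2 span osc ret) subrK.
  by rewrite (A_actD char0 im2 span osc ret) !psiE -UactD subrK.
have psi_mul : monoid_morphism psi0.
  split=> [|u v]; apply: A_faithful => f.
    by rewrite psiE Uact1 -Ascal1 osc_scal scale1r.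
  by rewrite (A_actM char0 im2 span osc ret) !psiE UactM.
pose psi : {rmorphism Usp k n -> ACtilde k n} := HB.pack psi0
  (GRing.isZmodMorphism.Build _ _ psi0 psi_add)
  (GRing.isMonoidMorphism.Build _ _ psi0 psi_mul).
have coef0 i := psi_coef_neq0 char0 im2 i.
have he i : psi0 (Ue k i) = Ascal n (psi_coef im i) * AX k i.
  apply: A_faithful => f; rewrite (A_actM char0 im2 span osc ret) osc_scal osc_X psiE.
  by rewrite scalerA divff // scale1r Uact_gen.
have hf i : psi0 (Uf k i) = Ascal n (psi_coef im i) * AY k i.
  apply: A_faithful => f; rewrite (A_actM char0 im2 span osc ret) osc_scal osc_Y psiE.
  by rewrite scalerA divff // scale1r Uact_gen.
have hR p : psi0 (Usp_R p) = AR p.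
  by apply: A_faithful => f; rewrite osc_R psiE.
exists psi; split=> [c|i j ij|i iE]; rewrite -![psi _]/(psi0 _).
- by apply: A_faithful => f; rewrite psiE Uact_scal osc_scal.
- rewrite he hf /psi_coef -ij ltn_eqF // Ascal1 !mul1r; split=> //.
  by rewrite -hR (Usp_R_h k ij).
- rewrite he hf /psi_coef iE eqxx; split=> //.
  by rewrite -hR (Usp_R_hn k iE).
Qed.

End Psi.

(** * Surjectivity, grading, involution and kernel of psi *)

Section PsiProperties.
Variables (k : fieldType) (n : nat) (im : k).
Hypothesis char0 : [pchar k] =i pred0.
Hypothesis im2 : im ^+ 2 = -1.
Variable psi : {rmorphism Usp k n -> ACtilde k n}.
Hypothesis spec : psi_spec im psi.
Implicit Types (i j : 'I_n) (u : Usp k n) (a : ACtilde k n) (p : {mpoly k[n]}).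
Local Notation D := (Ctilde_datum k n).
Local Notation rep := (osc_rep n char0 im2).
Let osc := @osc_condition k n im char0 im2.
Let span := @osc_span k n im char0 im2.
Let ret := @osc_ret k n im char0 im2.
Let act := psi_act char0 im2 span osc ret spec.

Lemma psi_R p : psi (Usp_R p) = AR p.
Proof.
by apply: (@A_faithful k n im char0 im2) => f; rewrite act (A_act_R char0 im2 span osc ret).
Qed.

Lemma psi_comp d u : Usp_comp d u -> exists2 x, tgw_cons_comp d x & psi u = tgw_pi x.
Proof.
move=> hu; have [x hx xE] := Uact_cons char0 im2 span osc hu; exists x => //.
apply: (@A_faithful k n im char0 im2) => f.
by rewrite act (A_act_pi char0 im2 span osc ret) xE.
Qed.

Let UcompM := @gcompM k (Usp k n) (Uscal _) _ (@chevalley_gen k n) _ (@chevalley_deg n)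
  (@UscalM _ _ (@sp_br k n)) (@UscalC _ _ (@sp_br k n)).
Let Ucomp_gen := @gcomp_gen k (Usp k n) (Uscal _) _ (@chevalley_gen k n) _ (@chevalley_deg n)
  (@Uscal1 _ _ (@sp_br k n)).
Let Ucomp_c := @gcomp_c k (Usp k n) (Uscal _) _ (@chevalley_gen k n) _ (@chevalley_deg n).

Lemma Usp_comp_scalM d c u : Usp_comp d u -> Usp_comp d (Uscal _ c * u).
Proof.
by move=> hu; rewrite -[d]add0r; apply: UcompM => //; apply: Ucomp_c.
Qed.

Lemma Usp_R_comp0 p : Usp_comp 0 (Usp_R p).
Proof.
have PM (q r : {mpoly k[n]}) :
    Usp_comp 0 (Usp_R q) -> Usp_comp 0 (Usp_R r) -> Usp_comp 0 (Usp_R (q * r)).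
  by move=> hq hr; have := UcompM hq hr; rewrite addr0 Usp_RM.
have PD (q r : {mpoly k[n]}) :
    Usp_comp 0 (Usp_R q) -> Usp_comp 0 (Usp_R r) -> Usp_comp 0 (Usp_R (q + r)).
  by rewrite Usp_RD; apply: gcompD.
have PC c : Usp_comp 0 (Usp_R (c%:MP : {mpoly k[n]})) by rewrite Usp_RC; apply: Ucomp_c.
have PX i : Usp_comp 0 (Usp_R ('X_i : {mpoly k[n]})).
  rewrite Usp_RX; apply: gcompD; last exact: Ucomp_c.
  elim/big_ind: _ => [||j _]; first exact: gcomp0; first exact: gcompD.
  exact: (Ucomp_gen (ChevH j)).
elim/mpolyind: p => [|c q p _ _ IHp]; first by rewrite -mpolyC0; apply: PC.
apply: (PD) => //; rewrite -mul_mpolyC; apply: (PM) => //.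
rewrite mpolyXE_id; elim/big_ind: _ => //; first by rewrite -mpolyC1; apply: PC.
by move=> i _; elim: (q i) => [|b IHb]; rewrite ?expr0 -?mpolyC1 // exprS; apply: PM.
Qed.

(** Surjectivity in each degree; besides surjectivity itself it shows that the isomorphism reflects
    degrees. *)
Lemma psi_lift d (x : tgw_cons D) : tgw_cons_comp d x ->
  exists2 u, Usp_comp d u & psi u = tgw_pi x.
Proof.
have sym s : exists2 u, Usp_comp (tgw_deg s) u & psi u = tgw_pi (tgw_cons_pi D (fgen k s)).
  have inv i : Ascal n (psi_coef im i)^-1 * Ascal n (psi_coef im i) = 1.
    by rewrite -AscalM mulVf ?psi_coef_neq0 // Ascal1.
  case: s => [r|[i|i]].
  - by exists (Usp_R r); [apply: Usp_R_comp0 | rewrite psi_R].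
  - exists (Uscal _ (psi_coef im i)^-1 * Ue k i).
      by apply: Usp_comp_scalM; apply: (Ucomp_gen (ChevE i)).
    by rewrite rmorphM (psi_scal spec) (psi_e spec) mulrA inv mul1r.
  - exists (Uscal _ (psi_coef im i)^-1 * Uf k i).
      by apply: Usp_comp_scalM; apply: (Ucomp_gen (ChevF i)).
    by rewrite rmorphM (psi_scal spec) (psi_f spec) mulrA inv mul1r.
move=> [ws hw ->]; elim: ws hw => [_|w ws IHws /= /andP[/eqP wd /IHws[u hu uE]]].
  by exists 0; [apply: gcomp0 | rewrite big_nil !rmorph0].
have [v hv vE] : exists2 v, Usp_comp d v &
    psi v = tgw_pi (\prod_(s <- w.2) tgw_cons_pi D (fgen k s)).
  rewrite -wd; elim: w.2 => [|s w2 [v hv vE]].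
    exists 1; last by rewrite big_nil !rmorph1.
    by rewrite big_nil -(Uscal1 (@sp_br k n)); apply: Ucomp_c.
  have [v' hv' v'E] := sym s; exists (v' * v).
    by rewrite big_cons; apply: UcompM.
  by rewrite big_cons !rmorphM vE v'E.
exists (Uscal _ w.1 * v + u); first by apply: gcompD => //; apply: Usp_comp_scalM.
by rewrite big_cons !rmorphD !rmorphM uE vE (psi_scal spec).
Qed.

Lemma psi_surj a : exists u, psi u = a.
Proof.
rewrite -[a]tgw_reprK.
have [ds [xs [uds hxs ->]]] :=
  gspan_decomp (@tgw_deg k {mpoly k[n]} 'I_n) (cons_span (tgw_repr a)).
elim: ds {uds} => [|d ds [u uE]]; first by exists 0; rewrite big_nil !rmorph0.
have [v _ vE] := psi_lift (hxs d).
by exists (v + u); rewrite big_cons !rmorphD uE vE.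
Qed.

Lemma Astar_scal c : Astar (Ascal n c : ACtilde k n) = Ascal n c.
Proof. by rewrite /Astar /Ascal /tgw_scal tgw_star_pi tgw_cons_star_pi fantiZ fanti1. Qed.

Lemma Ascal_central c a : Ascal n c * a = a * Ascal n c.
Proof. by rewrite -[a]tgw_reprK -!rmorphM cons_scalC. Qed.

Lemma psi_star u : psi (Usp_star u) = Astar (psi u).
Proof.
have star0 : Astar (0 : ACtilde k n) = 0.
  by apply: (addrI (Astar 0)); rewrite -tgw_starD !addr0.
have ustar0 : Usp_star (0 : Usp k n) = 0.
  by apply: (addrI (Usp_star 0)); rewrite -Usp_starD !addr0.
apply: (@Usp_chev_ind k n char0 (fun u => psi (Usp_star u) = Astar (psi u))) u.
- by rewrite ustar0 rmorph0 star0.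
- by move=> u v hu hv; rewrite Usp_starD !rmorphD hu hv /Astar tgw_starD.
- by move=> u v hu hv; rewrite Usp_starM !rmorphM hu hv /Astar tgw_starM.
- by move=> c; rewrite Usp_star_scal (psi_scal spec) Astar_scal.
- move=> i; rewrite Usp_star_e (psi_e spec) (psi_f spec) /Astar tgw_starM.
  by rewrite -/(Astar _) -/(Astar _) Astar_scal Ascal_central [Astar _]tgw_star_X.
- move=> i; rewrite Usp_star_f (psi_e spec) (psi_f spec) /Astar tgw_starM.
  by rewrite -/(Astar _) -/(Astar _) Astar_scal Ascal_central [Astar _]tgw_star_Y.
- move=> i; rewrite Usp_star_h; have [p _ ->] := psi_h spec i.
  by rewrite [Astar _]tgw_star_R.
Qed.

Section Annihilator.
Hypothesis n2 : (2 <= n)%N.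
Variables (M : lmodType k) (rho : lie_module (@sp_br k n) M).
Hypothesis inf : infinite_dimensional M.
Hypothesis simple : simple_module rho.
Hypothesis cp : completely_pointed rho.
Local Notation J := (annihilator rho).
Let mspan := cp_span cp.
Let mindep := @cp_indep _ _ _ _ cp.
Let mosc := cp_condition char0 im2 n2 inf simple cp.
Let mret := cp_ret char0 im2 n2 inf simple cp.
Let mact := psi_act char0 im2 mspan mosc mret spec.

(** Components of different degrees send a weight vector to different weight spaces, so each of them
    annihilates [M]. *)
Lemma annihilator_decomp u : J u -> exists (ds : seq {ffun 'I_n -> int}) us,
  [/\ forall d, Usp_comp d (us d), forall d, d \in ds -> J (us d) & u = \sum_(d <- ds) us d].
Proof.
move=> Ju; have [ds [us [uds hus uE]]] := gspan_decomp (@chevalley_deg n) (chev_all char0 u).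
exists ds, us; split=> // d dds; apply: (span_ind mspan).
- exact: Uact0r.
- by move=> m m' hm hm'; rewrite UactDr hm hm' addr0.
move=> l m hm; apply: (indep_wdeg char0 mindep (y := fun d => Uact rho (us d) m) uds) dds.
  by move=> d'; apply: weightv_comp (hus d') hm.
by rewrite -Uact_sum -uE; apply: Ju.
Qed.

Lemma annihilator_kernel u : J u <-> psi u = 0.
Proof.
split=> [Ju|pu m]; last by rewrite -mact pu (A_act0 char0 im2 mspan mosc mret).
have [ds [us [hus Jus ->]]] := annihilator_decomp Ju.
rewrite rmorph_sum big_seq big1 // => d /Jus Jd {u Ju Jus}.
(* If [psi] did not kill this homogeneous component, it would act nontrivially on polynomials;
   returned to degree zero it would be a nonzero element of [R] that still annihilates [M]. *)
have [x hx xE] := psi_comp (hus d); rewrite xE; apply: contrapT => nz.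
have [f nf] : exists f, cons_act im rep x f <> 0.
  apply: contrapT => no; apply: nz; apply/quot_pi_eq0; apply: (@osc_kernel_rad k n im char0 im2).
  by move=> f; apply: contrapT => nf; apply: no; exists f.
have [l [g [hg ng]]] : exists l g, weightv rep l g /\ cons_act im rep x g <> 0.
  apply: contrapT => no; apply: nf; move: f; apply: (span_ind span).
  - exact: cons_actr0.
  - by move=> f f' hf hf'; rewrite cons_actDr hf hf' addr0.
  - by move=> l g hg; apply: contrapT => ng; apply: no; exists l, g.
have [y hy nyx] := ret hg hx ng.
have [|r rE] := @cons_degree0 _ _ _ D (y * x).
  by rewrite -(addNr d); apply: cons_compM.
apply: nyx; rewrite -(cons_actM char0 im2 span osc) rE (_ : r = 0).
  by rewrite cons_R0 (cons_act0 char0 im2 span osc).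
(* [r] is zero at every weight of [M], for it acts on [M] as [y] after an element of [J]. *)
apply: (cp_dense char0 n2 inf simple cp) => l' m hm nm; apply/eqP; apply: contrapT => nr.
apply: nm; have : A_act im rho (tgw_pi (y * x)) m = 0.
  rewrite (rmorphM (@tgw_pi _ _ _ D)) (A_actM char0 im2 mspan mosc mret) /= -xE mact Jd.
  exact: cons_actr0.
rewrite rE (A_act_pi char0 im2 mspan mosc mret) (cons_act_R char0 im2 mspan mosc _ hm).
by move/eqP; rewrite scaler_eq0 => /orP[//|/eqP].
Qed.

Lemma annihilator_graded : graded_ideal (@Usp_comp k n) J.
Proof.
split; first exact: annihilator_two_sided.
move=> u /annihilator_decomp[ds [us [hus Jus uE]]].
exists (map us ds); last by rewrite big_map.
by move=> _ /mapP[d dds ->]; split; [apply: Jus | exists d; apply: hus].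
Qed.

Lemma annihilator_star u : J u -> J (Usp_star u).
Proof.
move/annihilator_kernel => h; apply/annihilator_kernel; rewrite psi_star h.
by apply: (addrI (Astar 0)); rewrite -tgw_starD !addr0.
Qed.

Lemma annihilator_quotient : exists Psi : {rmorphism quot J -> ACtilde k n},
  [/\ bijective Psi,
      forall u, Psi (quot_pi J u) = psi u,
      forall p, Psi (quot_pi J (Usp_R p)) = AR p,
      forall d x, gimage (quot_pi J) (@Usp_comp k n) d x <-> Acomp d (Psi x) &
      forall u, Psi (quot_pi J (Usp_star u)) = Astar (Psi (quot_pi J u))].
Proof.
pose Psi0 (x : quot J) : ACtilde k n := psi (quot_repr x).
have PsiE u : Psi0 (quot_pi J u) = psi u.
  apply/eqP; rewrite -subr_eq0 -rmorphB; apply/eqP/annihilator_kernel.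
  exact: quot_repr_pi.
have Psi_add : zmod_morphism Psi0.
  move=> x y; rewrite -[x]quot_reprK -[y]quot_reprK -(rmorphB (quot_pi J)) !PsiE.
  by rewrite rmorphB.
have Psi_mul : monoid_morphism Psi0.
  split=> [|x y]; first by rewrite -(rmorph1 (quot_pi J)) PsiE rmorph1.
  rewrite -[x]quot_reprK -[y]quot_reprK -(rmorphM (quot_pi J)) !PsiE.
  by rewrite rmorphM.
pose Psi : {rmorphism quot J -> ACtilde k n} := HB.pack Psi0
  (GRing.isZmodMorphism.Build _ _ Psi0 Psi_add)
  (GRing.isMonoidMorphism.Build _ _ Psi0 Psi_mul).
have Psi_inj : injective Psi0.
  move=> x y; rewrite -[x]quot_reprK -[y]quot_reprK !PsiE => e; apply/quot_piP.
  by apply/annihilator_kernel; rewrite rmorphB e subrr.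
exists Psi; split; rewrite -?[GRing.RMorphism.sort Psi]/Psi0.
- have /choice[g gE] : forall a, exists x, Psi0 x = a.
    by move=> a; have [u uE] := psi_surj a; exists (quot_pi J u); rewrite PsiE.
  by exists g => // x; apply: Psi_inj; rewrite gE.
- exact: PsiE.
- by move=> p; rewrite PsiE psi_R.
- move=> d x; split=> [[u hu ->]|[y hy yE]].
    by rewrite PsiE; have [y hy yE] := psi_comp hu; exists y.
  have [u hu uE] := psi_lift hy; exists u => //.
  by apply: Psi_inj; rewrite PsiE uE -yE.
- by move=> u; rewrite !PsiE psi_star.
Qed.

End Annihilator.
End PsiProperties.

Theorem theorem5p11 (k : closedFieldType) (n : nat) (im : k) :
  [pchar k] =i pred0 -> (2 <= n)%N -> im ^+ 2 = -1 ->
  (exists psi : {rmorphism Usp k n -> ACtilde k n}, psi_spec im psi) /\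
  forall psi : {rmorphism Usp k n -> ACtilde k n}, psi_spec im psi ->
    (forall a, exists u, psi u = a) /\
    forall (M : lmodType k) (rho : lie_module (@sp_br k n) M),
      infinite_dimensional M -> simple_module rho -> completely_pointed rho ->
      let J := annihilator rho in
      [/\ forall u, J u <-> psi u = 0,
          graded_ideal (@Usp_comp k n) J,
          forall u, J u -> J (Usp_star u) &
          exists Psi : {rmorphism quot J -> ACtilde k n},
            [/\ bijective Psi,
                forall u, Psi (quot_pi J u) = psi u,
                forall p, Psi (quot_pi J (Usp_R p)) = AR p,
                forall d x,
                  gimage (quot_pi J) (@Usp_comp k n) d x <-> Acomp d (Psi x) &
                forall u, Psi (quot_pi J (Usp_star u)) =
                          Astar (Psi (quot_pi J u))]].
Proof.
move=> char0 n2 im2; split; first exact: psi_exists.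
move=> psi spec; split=> [a|M rho inf simple cp J]; first exact: psi_surj spec a.
split.
- exact: (annihilator_kernel char0 im2 spec n2 inf simple cp).
- exact: (annihilator_graded char0 cp).
- exact: (annihilator_star char0 im2 spec n2 inf simple cp).
- exact: (annihilator_quotient char0 im2 spec n2 inf simple cp).
Qed.
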